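(* Let $\{X_t:t\in\mathbb{Z}\}$ be a strictly stationary sequence of random variables with values in some measure space $\mathcal{X}$, and let $\mathcal{F}$ be a class of measurable functions $\mathcal{X}\to\mathbb{R}$. Assume that there are a real number $\gamma>0$ and an even integer $Q>2$ such that the following hold. (A1) The triangular array $X_{n,t}:=X_t$, $1\le t\le n$, $n\in\mathbb{N}$, is strongly mixing with mixing coefficient $\alpha(\cdot)$ satisfying $$\sum_{t=1}^{\infty}t^{Q-2}\alpha(t)^{\frac{\gamma}{2+\gamma}}<\infty .$$ (A2) With $\rho(\varphi):=E[|\varphi(X_1)|^2]^{1/2}$ for measurable $\varphi:\mathcal{X}\to\mathbb{R}$, $$\int_{0}^{1}x^{-\frac{\gamma}{2+\gamma}}\left(N_{[\,]}(x,\mathcal{F},\rho)\right)^{\frac{1}{Q}}dx<\infty ,$$ and, furthermore, for each $\varepsilon>0$ the bounding class $\mathcal{B}$ (in the definition of the bracketing number $N_{[\,]}(\varepsilon,\mathcal{F},\rho)$) can be chosen such that for all $i=2,\dots,Q$ $$E\left[|b(X_1)|^{i\frac{2+\gamma}{2}}\right]^{\frac12}\le\varepsilon\quad\text{for all } b\in\mathcal{B}.$$ (A3) $\mathcal{F}$ possesses an envelope function $F$ with $E[|F(X_1)|^Q]<\infty$, and there exists a constant $M<\infty$ such that $$\sup_{\varphi\in\mathcal{F}}E\left[|\varphi(X_1)|^{Q\frac{2+\gamma}{2}}\right]\le M .$$ Furthermore, let for all $K\in\mathbb{N}$ and all finite collections $\varphi_k\in\mathcal{F}$, $s_k\in[0,1]$,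 $k=1,\dots,K$, $$\left(G_n(s_k,\varphi_k)\right)_{k=1,\dots,K}\overset{\mathcal{D}}{\longrightarrow}\left(G(s_k,\varphi_k)\right)_{k=1,\dots,K},$$ where $G:=\{G(s,\varphi):s\in[0,1],\varphi\in\mathcal{F}\}$ is a centered Gaussian process. Then $$\left\{G_n(s,\varphi):s\in[0,1],\varphi\in\mathcal{F}\right\}\leadsto G\quad\text{in } l^\infty([0,1]\times\mathcal{F}).$$
   Context: Sequential empirical process: for measurable $\varphi:\mathcal{X}\to\mathbb{R}$ and $s\in[0,1]$, $G_n(s,\varphi):=\frac{1}{\sqrt n}\sum_{i=1}^{\lfloor ns\rfloor}\left(\varphi(X_i)-E[\varphi(X_i)]\right)$, $n\in\mathbb{N}$. $\overset{\mathcal{D}}{\to}$ denotes convergence in distribution. An envelope function of $\mathcal{F}$ is a measurable $F:\mathcal{X}\to\mathbb{R}$ with $|\varphi(x)|\le |F(x)|$ for all $x\in\mathcal{X}$, $\varphi\in\mathcal{F}$. Strong mixing: for a triangular array $\{X_{n,t}:1\le t\le n,n\in\mathbb{N}\}$ let, for $t\le n-1$, $$\alpha_n(t):=\sup_{1\le k\le n-t}\ \sup_{A\in\sigma(X_{n,j}:1\le j\le k),\ B\in\sigma(X_{n,j}:k+t\le j\le n)}|P(A\cap B)-P(A)P(B)|,$$ and $\alpha_n(t):=0$ for $t\ge n$. Let $\alpha(t):=\sup_{n\in\mathbb{N}}\alpha_n(t)$ for $t\in\mathbb{N}$ and $\alpha(0):=1$. The array is called strongly mixing if $\alpha(t)\to0$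 as $t\to\infty$, and $\alpha(\cdot)$ is called its mixing coefficient. Bracketing number: for $\varepsilon>0$, $N_{[\,]}(\varepsilon,\mathcal{F},\rho)$ is the smallest integer $N$ for which there exist a class $\mathcal{B}$ of (measurable) functions $\mathcal{X}\to\mathbb{R}$, called bounding class, and a class $\mathcal{A}\subset\mathcal{F}$, called approximating class, such that $|\mathcal{B}|=|\mathcal{A}|=N$, $\rho(b)<\varepsilon$ for all $b\in\mathcal{B}$, and for every $\varphi\in\mathcal{F}$ there exist $a^*\in\mathcal{A}$ and $b^*\in\mathcal{B}$ with $|\varphi-a^*|\le b^*$ (pointwise). It is $\infty$ if no such integer exists. The choice of the bounding class in (A2) is among the classes $\mathcal{B}$ that, together with some approximating class $\mathcal{A}$, satisfy these requirements with $N=N_{[\,]}(\varepsilon,\mathcal{F},\rho)$. Weak convergence: for a set $T$, $l^\infty(T)$ is the set of bounded real-valued functions on $T$ with the supremum norm and its Borel $\sigma$-algebra. For stochastic processes $Z_n=\{Z_n(t):t\in T\}$ and $Z=\{Z(t):t\in T\}$ in $l^\infty(T)$ with $Z$ Borel measurable, $Z_n\leadsto Z$ means $E^*[H(Z_n)]\to E[H(Z)]$ for all bounded continuous $H:l^\infty(T)\to\mathbb{R}$, where $E^*$ denotes outer expectation. As usual, when the limit is specified through its finite-dimensional distributions, $Z_n\leadsto Z$ is understood to mean that $Z$ has a version which is a Borel measurable random element of $l^\infty(T)$ and that $Z_n$ converges weakly to this version. *)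

(* Defs.v *)
From HB Require Import structures.
From mathcomp Require Import all_boot all_order all_algebra.
From mathcomp Require Import all_classical all_reals all_analysis.
From mathcomp Require Import measurable_realfun.
Import Order.TTheory GRing.Theory Num.Theory.
Import numFieldNormedType.Exports.

Set Implicit Arguments.
Unset Strict Implicit.
Unset Printing Implicit Defensive.

Local Open Scope classical_set_scope.
Local Open Scope ring_scope.

(* The normed space l^oo(T) of bounded real functions on an arbitrary type T. *)
Section linfty.
Context (R : realType) (T : Type).

Definition linfty_pred : {pred T -> R} :=
  fun f => `[< exists M, forall t, `|f t| <= M >].

Record linfty := Linfty {
  linfty_fun :> T -> R ;
  linfty_funP : linfty_fun \in linfty_pred }.

HB.instance Definition _ := [isSub for linfty_fun].
HB.instance Definition _ := [Choice of linfty by <:].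

Lemma linfty_submod_closed : submod_closed linfty_pred.
Proof.
split; first by apply/asboolP; exists 0 => t; rewrite normr0.
move=> a f g /asboolP[M fM] /asboolP[N gN]; apply/asboolP.
exists (`|a| * M + N) => t.
rewrite (le_trans (ler_normD _ _))// lerD// normrM.
by rewrite ler_wpM2l.
Qed.

HB.instance Definition _ :=
  GRing.isSubmodClosed.Build R (T -> R) linfty_pred linfty_submod_closed.
HB.instance Definition _ := [SubChoice_isSubLmodule of linfty by <:].

(* On an empty T, sup set0 = 0 is the right value. *)
Definition linfty_norm (f : linfty) : R := sup (range (fun t => `|f t|)).

Lemma linfty_norm_has_ubound (f : linfty) :
  has_ubound (range (fun t => `|f t|)).
Proof. by case: f => f /= /asboolP[M fM]; exists M => _ [t _ <-]. Qed.

Lemma le_linfty_norm (f : linfty) t : `|f t| <= linfty_norm f.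
Proof. by apply: ub_le_sup; [exact: linfty_norm_has_ubound|exists t]. Qed.

Lemma linfty_norm_le (f : linfty) (M : R) :
  0 <= M -> (forall t, `|f t| <= M) -> linfty_norm f <= M.
Proof.
move=> M0 fM; rewrite /linfty_norm.
have [->|/set0P ne] := eqVneq (range (fun t => `|f t|)) set0.
  by rewrite sup0.
by apply: ge_sup => // _ [t _ <-].
Qed.

Lemma linfty_norm_ge0 (f : linfty) : 0 <= linfty_norm f.
Proof.
rewrite /linfty_norm.
have [->|/set0P[_ [t _ _]]] := eqVneq (range (fun t => `|f t|)) set0.
  by rewrite sup0.
exact: le_trans (le_linfty_norm f t).
Qed.

Lemma ler_linfty_normD (f g : linfty) :
  linfty_norm (f + g) <= linfty_norm f + linfty_norm g.
Proof.
apply: linfty_norm_le; first by rewrite addr_ge0 ?linfty_norm_ge0.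
by move=> t; rewrite (le_trans (ler_normD _ _))// lerD// le_linfty_norm.
Qed.

Lemma linfty_normZ (a : R) (f : linfty) :
  linfty_norm (a *: f) = `|a| * linfty_norm f.
Proof.
have leZ (b : R) (g : linfty) : linfty_norm (b *: g) <= `|b| * linfty_norm g.
  apply: linfty_norm_le; first by rewrite mulr_ge0 ?linfty_norm_ge0.
  by move=> t; rewrite normrM ler_wpM2l ?le_linfty_norm.
apply/eqP; rewrite eq_le leZ /=.
have [->|a0] := eqVneq a 0; first by rewrite normr0 mul0r linfty_norm_ge0.
rewrite -ler_pdivlMl ?normr_gt0// -normfV.
by rewrite -{1}(scalerK a0 f) leZ.
Qed.

Lemma linfty_norm_eq0 (f : linfty) : linfty_norm f = 0 -> f = 0.
Proof.
move=> f0; apply/val_inj/funext => t /=.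
by apply/eqP; rewrite -normr_le0 -f0 le_linfty_norm.
Qed.

HB.instance Definition _ := Lmodule_isNormed.Build R linfty
  ler_linfty_normD linfty_normZ linfty_norm_eq0.

End linfty.

Section finite_dimensional_distributions.
Context (R : realType) (d d' : measure_display) (Omega : measurableType d)
  (E : measurableType d') (P : probability Omega R) (I : Type).

Definition fidi (Y : I -> Omega -> E) (n : nat) (t : n.-tuple I) :
    set (n.-tuple E) -> \bar R :=
  pushforward P (fun w => [tuple Y (tnth t i) w | i < n]).

End finite_dimensional_distributions.

Definition same_fidis (R : realType) (d1 d2 d' : measure_display)
    (Omega1 : measurableType d1) (Omega2 : measurableType d2)
    (E : measurableType d') (P1 : probability Omega1 R)
    (P2 : probability Omega2 R) (I : Type)
    (Y1 : I -> Omega1 -> E) (Y2 : I -> Omega2 -> E) : Prop :=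
  forall (n : nat) (t : n.-tuple I) (A : set (n.-tuple E)),
    measurable A -> fidi P1 Y1 t A = fidi P2 Y2 t A.

Definition strictly_stationary (R : realType) (d d' : measure_display)
    (Omega : measurableType d) (E : measurableType d')
    (P : probability Omega R) (X : int -> Omega -> E) : Prop :=
  forall h : int, same_fidis P P (fun t => X (t + h)) X.

Section strong_mixing.
Context (R : realType) (d d' : measure_display) (Omega : measurableType d)
  (E : measurableType d') (P : probability Omega R).
Local Open Scope ereal_scope.

Definition sigma_gen (Y : nat -> Omega -> E) (J : set nat) :
    set (set Omega) :=
  <<s \bigcup_(j in J) preimage_set_system setT (Y j) measurable >>.

(* The n-th row of the array is Y n 1, ..., Y n n. *)
Definition alpha_row (Y : nat -> nat -> Omega -> E) (n t : nat) : \bar R :=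
  if (t < n)%N then
    ereal_sup [set ereal_sup [set `|P (A `&` B) - P A * P B|
        | A in sigma_gen (Y n) [set j | (1 <= j <= k)%N]
        & B in sigma_gen (Y n) [set j | (k + t <= j <= n)%N]]
      | k in [set k | (1 <= k <= n - t)%N]]
  else 0.

Definition alpha_mixing (Y : nat -> nat -> Omega -> E) (t : nat) : \bar R :=
  if t == 0%N then 1 else ereal_sup (range (fun n => alpha_row Y n t)).

Definition strongly_mixing (Y : nat -> nat -> Omega -> E) : Prop :=
  alpha_mixing Y t @[t --> \oo] --> 0.

End strong_mixing.

Section bracketing.
Context (R : realType) (d : measure_display) (E : measurableType d)
  (F : set (E -> R)) (rho : (E -> R) -> \bar R).

(* Bounding class B and approximating class A, both of cardinality N. *)
Definition is_bracketing (eps : R) (N : nat) (B A : set (E -> R)) : Prop :=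
  [/\ (B #= `I_N)%card /\ (A #= `I_N)%card,
      A `<=` F,
      forall b, B b -> measurable_fun setT b /\ (rho b < eps%:E)%E &
      forall phi, F phi -> exists a b,
        [/\ A a, B b & forall x, `|phi x - a x| <= b x]].

(* ereal_inf set0 = +oo, and the infimum of a nonempty set of natural numbers
   is attained. *)
Definition bracketing_number (eps : R) : \bar R :=
  ereal_inf [set (N%:R)%:E | N in
    [set N : nat | exists B A, is_bracketing eps N B A]].

End bracketing.

Section convergence.
Context (R : realType) (d : measure_display) (Omega : measurableType d)
  (P : probability Omega R).

Definition abs_moment (Y : Omega -> R) (p : R) : \bar R :=
  'E_P[fun w => `|Y w| `^ p].

Definition L2_norm_at (d1 : measure_display) (E : measurableType d1)
    (Y : Omega -> E) (phi : E -> R) : \bar R :=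
  (abs_moment (phi \o Y) 2 `^ 2^-1)%E.

(* The infimum is over measurable majorants whose integral exists, possibly
   with an infinite value. *)
Definition outer_expectation (Y : Omega -> \bar R) : \bar R :=
  (ereal_inf [set \int[P]_w U w | U in
    [set U : Omega -> \bar R |
      [/\ measurable_fun setT U,
          (forall w, Y w <= U w) &
          \int[P]_w (U^\+ w) < +oo \/ \int[P]_w (U^\- w) < +oo]]])%E.

Context (d' : measure_display) (Omega' : measurableType d')
  (P' : probability Omega' R).

Definition cvg_in_distribution (E : topologicalType) (Yn : nat -> Omega -> E)
    (Y : Omega' -> E) : Prop :=
  forall h : E -> R, continuous h -> bounded_fun h ->
    ('E_P[h \o Yn n] @[n --> \oo] --> 'E_P'[h \o Y])%E.

Definition fidi_cvg (I : Type) (Yn : nat -> I -> Omega -> R)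
    (Y : I -> Omega' -> R) : Prop :=
  forall (K : nat) (t : 'I_K -> I),
    cvg_in_distribution (fun n w => \row_(k < K) Yn n (t k) w)
                        (fun w => \row_(k < K) Y (t k) w).

Definition borel_measurable (E : normedModType R) (Z : Omega' -> E) : Prop :=
  measurable_fun setT (Z : Omega' -> g_sigma_algebraType (@open E)).

Definition weakly_converges (I : Type) (Zn : nat -> Omega -> linfty R I)
    (Z : Omega' -> linfty R I) : Prop :=
  forall H : linfty R I -> R, continuous H -> bounded_fun H ->
    (outer_expectation (fun w => (H (Zn n w))%:E) @[n --> \oo]
      --> 'E_P'[H \o Z])%E.

End convergence.

(* The sample paths of the Yn lie in l^oo(I), and some Borel measurable random
   element Z of l^oo(I) with the finite-dimensional distributions of Y, possibly
   on another probability space, is the weak limit of the Yn. *)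
Definition leadsto (R : realType) (d d' : measure_display)
    (Omega : measurableType d) (P : probability Omega R)
    (Omega' : measurableType d') (P' : probability Omega' R) (I : Type)
    (Yn : nat -> I -> Omega -> R) (Y : I -> Omega' -> R) : Prop :=
  exists2 Zn : nat -> Omega -> linfty R I,
    (forall n w t, Zn n w t = Yn n t w) &
    exists (d'' : measure_display) (Omega'' : measurableType d'')
        (P'' : probability Omega'' R) (Z : Omega'' -> linfty R I),
      [/\ borel_measurable Z,
          same_fidis P'' P' (fun t w => Z w t) Y &
          weakly_converges P P'' Zn Z].

(* normal_prob m 0 is not the Dirac measure at m. *)
Definition normal_law (R : realType) (m s : R) : set R -> \bar R :=
  if s == 0 then \d_m else normal_prob m s.

Definition centered_gaussian_process (R : realType) (d : measure_display)
    (Omega : measurableType d) (P : probability Omega R) (I : Type)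
    (G : I -> Omega -> R) : Prop :=
  forall (K : nat) (t : 'I_K -> I) (a : 'I_K -> R),
    exists2 s : R, 0 <= s & forall A : set R, measurable A ->
      pushforward P (fun w => \sum_(k < K) a k * G (t k) w) A
      = normal_law 0 s A.

Section sequential_empirical_process.
Context (R : realType) (d d' : measure_display) (Omega : measurableType d)
  (E : measurableType d') (P : probability Omega R) (X : int -> Omega -> E).

Definition seq_empirical (n : nat) (s : R) (phi : E -> R) (w : Omega) : R :=
  (Num.sqrt n%:R)^-1 * \sum_(1 <= i < (Num.truncn (n%:R * s)).+1)
    (phi (X i%:Z w) - fine 'E_P[phi \o X i%:Z]).

Definition seq_index (F : set (E -> R)) : set (R * (E -> R)) :=
  `[0, 1] `*` F.

Definition seq_empirical_process (F : set (E -> R)) (n : nat)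
    (t : seq_index F) : Omega -> R :=
  seq_empirical n (set_val t).1 (set_val t).2.

End sequential_empirical_process.

(* Main.v *)
(* Covariance inequalities for strongly mixing sequences bound the Q-th moment
   of partial sums, hence their running maxima, and hence the maximum over a
   finite family of functions of these maxima, at the cost of a factor
   N^(1/Q). Chaining along the brackets of size 2^-k, down to a level that
   grows with n, and cutting the time interval into finitely many blocks make
   the process close in mean, uniformly in (s, phi), to its values on a finite
   grid. With the convergence of the finite-dimensional distributions, this
   turns the discretizations of G into a uniformly Cauchy sequence, whose limit
   is the required version of G and the weak limit of the process. *)

(* With theta = 2 + gamma, a bracket of size x has moments of order q theta / 2 at most x^2, and the
   covariance inequality turns this bound into its power 2 / theta, that is r^2 with r =
   x^(2/theta). The Q-th moment of a sum of n terms is then at most a multiple of n r^2 + (n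
   r^2)^(Q/2), and only the second term has the Gaussian scale. The first is harmless when n^kap <=
   n r^2, so for given n the chain must stop at a level K with 2^-K not too small. What is left
   below K is bounded by the brackets themselves, whose means cost sqrt n * 2^-K. Both demands are
   met by 2^K close to n^t with t = (1 - kap) theta / 4, which exceeds 1/2 for small kap because
   theta > 2.

   The other obstacle is measurability: suprema over F and maps into l^oo need not be measurable.
   Hence each supremum is replaced by an explicit measurable majorant, valid at every sample point,
   with a bound on its mean; and the limit is approximated by maps with countably many values, all
   of whose preimages are measurable. *)
Require Import Defs.
From mathcomp Require Import all_boot all_order all_algebra.
From mathcomp Require Import all_classical all_reals all_analysis.
From mathcomp Require Import measurable_realfun.
From mathcomp Require Import ring lra zify.
Import Order.TTheory GRing.Theory Num.Theory.
Import numFieldNormedType.Exports.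

Set Implicit Arguments.
Unset Strict Implicit.
Unset Printing Implicit Defensive.

Local Open Scope classical_set_scope.
Local Open Scope ring_scope.

(** * Integration and covariance inequalities *)

Section real_expectation.
Context {R : realType} {d : measure_display} {T : measurableType d}.
Variable P : probability T R.
Implicit Types f g : T -> R.
Local Notation integ f := (P.-integrable setT (EFin \o f)).

Lemma integ_le f g : measurable_fun setT f -> integ g ->
  (forall w, `|f w| <= g w) -> integ f.
Proof.
move=> mf ig fg; apply: le_integrable ig => //; first exact/measurable_EFinP.
by move=> w _ /=; rewrite lee_fin (le_trans (fg w))// ler_norm.
Qed.

Lemma integ_cst c : integ (fun=> c).
Proof. by apply: finite_measure_integrable_cst. Qed.

Lemma integ_bounded f M : measurable_fun setT f -> (forall w, `|f w| <= M) ->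
  integ f.
Proof. by move=> mf fM; apply: integ_le mf (integ_cst M) fM. Qed.

Lemma integD f g : integ f -> integ g -> integ (fun w => f w + g w).
Proof. by move=> fi gi; apply: (integrableD measurableT fi gi). Qed.

Lemma integZ c f : integ f -> integ (fun w => c * f w).
Proof. by move=> fi; apply: (integrableZl measurableT c fi). Qed.

Lemma integN f : integ f -> integ (fun w => - f w).
Proof. by move=> fi; apply: (integrableN fi). Qed.

Lemma integB f g : integ f -> integ g -> integ (fun w => f w - g w).
Proof. by move=> fi gi; apply: integD => //; exact: integN. Qed.

Lemma integ_sum (I : Type) (r : seq I) (F : I -> T -> R) :
  (forall i, integ (F i)) -> integ (fun w => \sum_(i <- r) F i w).
Proof.
move=> Fi; elim: r => [|i r IH].
  by under eq_fun do rewrite big_nil; exact: integ_cst.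
by under eq_fun do rewrite big_cons; exact: integD.
Qed.

Lemma integ_norm f : integ f -> integ (fun w => `|f w|).
Proof. by move=> fi; exact: integrable_norm fi. Qed.

Lemma EFin_Rintegral f : integ f -> (\int[P]_w f w)%:E = (\int[P]_w (f w)%:E)%E.
Proof.
by move=> fi; rewrite /Rintegral fineK//; exact: integrable_fin_num.
Qed.

Lemma Rintegral_sum (I : Type) (r : seq I) (F : I -> T -> R) :
  (forall i, integ (F i)) ->
  \int[P]_w (\sum_(i <- r) F i w) = \sum_(i <- r) \int[P]_w F i w.
Proof.
move=> Fi; elim: r => [|i r IH].
  rewrite big_nil (@eq_Rintegral _ _ _ _ _ (fun=> 0)); last by move=> w _; rewrite big_nil.
  by rewrite Rintegral_cst// mul0r.
rewrite big_cons -IH -RintegralD//; last exact: integ_sum.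
by apply: eq_Rintegral => w _; rewrite big_cons.
Qed.

Lemma Rintegral_cstT (c : R) : \int[P]_w c = c.
Proof.
rewrite Rintegral_cst//; have h : fine (P setT) = 1 by rewrite probability_setT.
exact: etrans (congr1 _ h) (mulr1 c).
Qed.

Lemma ge0_integ f (M : R) : measurable_fun setT f -> (forall w, 0 <= f w) ->
  (\int[P]_w (f w)%:E <= M%:E)%E -> integ f.
Proof.
move=> mf f0 fM; apply/integrableP; split; first exact/measurable_EFinP.
rewrite (eq_integral (fun w => (f w)%:E)); first exact: le_lt_trans fM (ltry _).
by move=> w _ /=; rewrite ger0_norm.
Qed.

Lemma Rintegral_indic A : measurable A -> \int[P]_w (\1_A w : R) = fine (P A).
Proof. by move=> mA; rewrite /Rintegral integral_indic// setIT. Qed.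

Lemma ler_norm_Rintegral f g : integ f -> integ g -> (forall w, `|f w| <= g w) ->
  `|\int[P]_w f w| <= \int[P]_w g w.
Proof.
move=> fi gi fg; rewrite (le_trans (le_normr_Rintegral _ fi))//.
by apply: le_Rintegral => //; exact: integ_norm.
Qed.

Lemma ler_Rintegral f g : integ f -> integ g -> (forall w, f w <= g w) ->
  \int[P]_w f w <= \int[P]_w g w.
Proof. by move=> fi gi fg; apply: le_Rintegral. Qed.

End real_expectation.

Section level_counting.
Context {R : realType}.

(** The integer part of [u] for 0 <= u <= N, written as a sum over the thresholds 1, ..., N: with
    [u = N * z w] the summands become indicators of superlevel sets of [z]. *)
Definition level_count (N : nat) (u : R) : R :=
  \sum_(0 <= j < N) ((j.+1%:R : R) <= u)%R%:R.

Lemma level_count_bounds N u : 0 <= u -> u <= N%:R ->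
  u - 1 <= level_count N u <= u.
Proof.
move=> u0; rewrite /level_count.
have full n : n%:R <= u -> \sum_(0 <= j < n) ((j.+1%:R : R) <= u)%R%:R = n%:R :> R.
  move=> nu; rewrite (eq_big_nat _ _ (F2 := fun=> 1)).
    by rewrite big_const_nat iter_addr_0 subn0.
  by move=> i /andP[_ ni]; rewrite (le_trans _ nu)// ler_nat.
have bnd n : \sum_(0 <= j < n) ((j.+1%:R : R) <= u)%R%:R <= u :> R.
  elim: n => [|n IH]; first by rewrite big_geq.
  have [nu|un] := leP n.+1%:R u; first by rewrite full.
  by rewrite big_nat_recr//= (leNgt _.+1%:R) un addr0.
rewrite bnd andbT.
elim: N => [|N IH] uN.
  by rewrite big_geq// lerBlDr add0r (le_trans uN).
have [nu|un] := leP N.+1%:R u.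
  by rewrite full//; move: uN nu; lra.
rewrite big_nat_recr//= (leNgt _.+1%:R) un addr0.
have [uN'|Nu] := leP u N%:R; first exact: IH.
by rewrite full ?ltW//; move: un; rewrite -natr1; lra.
Qed.

End level_counting.

Section covariance_inequality.
Context {R : realType} {d : measure_display} {T : measurableType d}.
Variable P : probability T R.
Local Notation integ f := (P.-integrable setT (EFin \o f)).

Definition cov (f g : T -> R) : R :=
  \int[P]_w (f w * g w) - (\int[P]_w f w) * (\int[P]_w g w).

(** A discrete form of Hoeffding's covariance formula. Up to 1/N, [x] is the average of the
    indicators of the sets x >= j/N, so the covariance is, up to 4/N, an average of N^2 covariances
    of superlevel events, each at most [a]. *)
Lemma cov_unit_interval (a : R) (x y : T -> R) :
  measurable_fun setT x -> measurable_fun setT y ->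
  (forall w, 0 <= x w <= 1) -> (forall w, 0 <= y w <= 1) ->
  (forall s t : R, `|fine (P ([set w | s <= x w] `&` [set w | t <= y w])) -
     fine (P [set w | s <= x w]) * fine (P [set w | t <= y w])| <= a) ->
  `|cov x y| <= a.
Proof.
move=> mx my x01 y01 h.
have mA (z : T -> R) (s : R) : measurable_fun setT z -> measurable [set w | s <= z w].
  move=> mz; rewrite [X in measurable X](_ : _ = setT `&` z @^-1` `[s, +oo[).
    by apply: mz => //; exact: measurable_itv.
  by apply/seteqP; split => w /=; rewrite in_itv/= andbT; tauto.
suff main N : (0 < N)%N -> `|cov x y| <= a + 4 / N%:R.
  apply/ler_addgt0Pr => e e0.
  have [N N0 Ne] : exists2 N, (0 < N)%N & 4 / N%:R <= e.
    exists (Num.truncn (4 / e)).+1 => //.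
    rewrite ler_pdivrMr ?ltr0n// mulrC -ler_pdivrMr//.
    by rewrite ltW// truncnS_gt.
  by rewrite (le_trans (main N N0))// lerD2l.
move=> N0; have N0' : 0 < N%:R :> R by rewrite ltr0n.
pose lx (z : T -> R) w := N%:R^-1 * level_count N (N%:R * z w).
have lxE (z : T -> R) w : lx z w = \sum_(0 <= j < N)
    N%:R^-1 * \1_[set w | j.+1%:R / N%:R <= z w] w.
  rewrite /lx /level_count mulr_sumr; apply: eq_bigr => j _; congr (_ * _).
  have -> : (j.+1%:R <= N%:R * z w) = (j.+1%:R / N%:R <= z w).
    by rewrite ler_pdivrMr// mulrC.
  rewrite indicE; case: (boolP (_ <= z w)) => hh; first by rewrite mem_set.
  by rewrite memNset//=; exact/negP.
have lxB (z : T -> R) w : 0 <= z w <= 1 -> z w - N%:R^-1 <= lx z w <= z w.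
  move=> /andP[z0 z1]; have /andP[b1 b2] : N%:R * z w - 1 <= level_count N (N%:R * z w) <= N%:R * z w.
    by apply: level_count_bounds; rewrite ?mulr_ge0// ler_piMr.
  rewrite /lx mulrC ler_pdivrMr// ler_pdivlMr// mulrBl mulVf ?gt_eqF//.
  by rewrite ![z w * _]mulrC b1 b2.
have mlx (z : T -> R) : measurable_fun setT z -> measurable_fun setT (lx z).
  move=> mz; rewrite (_ : lx z = (fun w => \sum_(0 <= j < N)
    N%:R^-1 * \1_[set w | j.+1%:R / N%:R <= z w] w)); last exact/funext.
  apply: measurable_sum => j; apply: measurable_funM => //.
  by apply: measurable_indic; exact: mA.
have lx01 (z : T -> R) w : 0 <= z w <= 1 -> 0 <= lx z w <= 1.
  move=> z01; have /andP[_ h2] := lxB z w z01; move: z01 => /andP[_ z1].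
  rewrite (le_trans h2)// andbT /lx mulr_ge0// sumr_ge0// => i _.
have ix : integ x by apply: (@integ_bounded _ _ _ P _ 1) => // w; move: (x01 w); rewrite ler_norml; lra.
have iy : integ y by apply: (@integ_bounded _ _ _ P _ 1) => // w; move: (y01 w); rewrite ler_norml; lra.
have ilx : integ (lx x) by apply: (@integ_bounded _ _ _ P _ 1) => [|w]; [exact: mlx|move: (lx01 x w (x01 w)); rewrite ler_norml; lra].
have ily : integ (lx y) by apply: (@integ_bounded _ _ _ P _ 1) => [|w]; [exact: mlx|move: (lx01 y w (y01 w)); rewrite ler_norml; lra].
have prod_le (p q : R) : 0 <= p <= 1 -> 0 <= q <= 1 -> 0 <= p * q <= 1.
  move=> /andP[p0 p1] /andP[q0 q1]; rewrite mulr_ge0//=.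
  by rewrite -[leRHS]mul1r ler_pM.
have ixy : integ (fun w => x w * y w).
  apply: (@integ_bounded _ _ _ P _ 1) => [|w]; first exact: measurable_funM.
  by move: (prod_le _ _ (x01 w) (y01 w)); rewrite ler_norml; lra.
have ilxy : integ (fun w => lx x w * lx y w).
  apply: (@integ_bounded _ _ _ P _ 1) => [|w]; first by apply: measurable_funM; exact: mlx.
  by move: (prod_le _ _ (lx01 _ _ (x01 w)) (lx01 _ _ (y01 w))); rewrite ler_norml; lra.
set n1 := N%:R^-1 in lxB *.
have n1_0 : 0 <= n1 by rewrite invr_ge0.
have Ebound (z : T -> R) : integ z -> integ (lx z) -> (forall w, 0 <= z w <= 1) ->
   `|\int[P]_w z w - \int[P]_w lx z w| <= n1 /\ 0 <= \int[P]_w lx z w <= 1 /\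
    0 <= \int[P]_w z w <= 1.
  move=> iz ilz z01; split; [|split].
  - rewrite -RintegralB// -[leRHS](Rintegral_cstT P); apply: ler_norm_Rintegral.
    + exact: integB.
    + exact: integ_cst.
    + by move=> w; have := lxB z w (z01 w); rewrite ler_norml; lra.
  - rewrite Rintegral_ge0/=; last by move=> w _; case/andP: (lx01 z w (z01 w)).
    rewrite -[leRHS](Rintegral_cstT P); apply: ler_Rintegral => //; first exact: integ_cst.
    by move=> w; case/andP: (lx01 z w (z01 w)).
  - rewrite Rintegral_ge0/=; last by move=> w _; case/andP: (z01 w).
    rewrite -[leRHS](Rintegral_cstT P); apply: ler_Rintegral => //; first exact: integ_cst.
    by move=> w; case/andP: (z01 w).
have [Ex1 [Ex2 Ex3]] := Ebound x ix ilx x01.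
have [Ey1 [Ey2 Ey3]] := Ebound y iy ily y01.
have Exy : `|\int[P]_w (x w * y w) - \int[P]_w (lx x w * lx y w)| <= 2 * n1.
  rewrite -RintegralB// -[leRHS](Rintegral_cstT P); apply: ler_norm_Rintegral.
  - exact: integB.
  - exact: integ_cst.
  - move=> w; have := lxB x w (x01 w); have := lxB y w (y01 w).
    have := lx01 x w (x01 w); have := lx01 y w (y01 w).
    have := x01 w; have := y01 w; rewrite ler_norml; nra.
have step : `|cov (lx x) (lx y)| <= a.
  rewrite /cov.
  have -> : \int[P]_w (lx x w * lx y w) = \sum_(0 <= i < N) \sum_(0 <= j < N)
     n1 ^+ 2 * fine (P ([set w | i.+1%:R * n1 <= x w] `&` [set w | j.+1%:R * n1 <= y w])).
    have iI (A B : set T) w : (\1_A w * \1_B w : R) = \1_(A `&` B) w by rewrite indicI.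
    under eq_Rintegral => w _.
      rewrite !lxE mulr_suml; under eq_bigr => i _.
        rewrite mulr_sumr; under eq_bigr => j _ do rewrite mulrACA -expr2 iI.
      over.
    over.
    have ii (A : set T) c : measurable A -> integ (fun w => c * \1_A w).
      by move=> mA'; apply: integZ; exact: integrable_indic.
    rewrite Rintegral_sum => [|i]; last first.
      by apply: integ_sum => j; apply: ii; apply: measurableI; exact: mA.
    apply: eq_bigr => i _; rewrite Rintegral_sum => [|j]; last first.
      by apply: ii; apply: measurableI; exact: mA.
    apply: eq_bigr => j _; have mI := measurableI _ _ (mA x (i.+1%:R * n1) mx) (mA y (j.+1%:R * n1) my).
    by rewrite RintegralZl// ?Rintegral_indic//; exact: integrable_indic.
  have El (z : T -> R) : measurable_fun setT z ->
      \int[P]_w lx z w = \sum_(0 <= i < N) n1 * fine (P [set w | i.+1%:R * n1 <= z w]).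
    move=> mz; under eq_Rintegral => w _ do rewrite lxE.
    rewrite Rintegral_sum => [|i]; last by apply: integZ; apply: integrable_indic => //; exact: mA.
    apply: eq_bigr => i _; have mAz := mA z (i.+1%:R * n1) mz.
    by rewrite RintegralZl// ?Rintegral_indic//; exact: integrable_indic.
  rewrite !El// mulr_suml -sumrB.
  have -> : a = \sum_(0 <= i < N) \sum_(0 <= j < N) n1 ^+ 2 * a.
    rewrite !big_const_nat !iter_addr_0 !subn0 -mulrnA -mulr_natl natrM mulrA.
    by rewrite -expr2 -exprMn mulfV ?gt_eqF// expr1n mul1r.
  rewrite (le_trans (ler_norm_sum _ _ _))//; apply: ler_sum => i _.
  rewrite mulr_sumr -sumrB (le_trans (ler_norm_sum _ _ _))//; apply: ler_sum => j _.
  rewrite mulrACA -expr2 -mulrBr normrM ger0_norm ?exprn_ge0// ler_wpM2l ?exprn_ge0//.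
move: step; rewrite /cov.
set A := \int[P]_w (x w * y w) in Exy *. set B := \int[P]_w (lx x w * lx y w) in Exy *.
set ex := \int[P]_w x w in Ex1 Ex2 Ex3 *. set ey := \int[P]_w y w in Ey1 Ey2 Ey3 *.
set fx := \int[P]_w lx x w in Ex1 Ex2 Ex3 *. set fy := \int[P]_w lx y w in Ey1 Ey2 Ey3 *.
have : `|ex * ey - fx * fy| <= 2 * n1.
  have -> : ex * ey - fx * fy = (ex - fx) * ey + fx * (ey - fy) by ring.
  rewrite (le_trans (ler_normD _ _))// mulr_natl mulr2n lerD// normrM.
    by rewrite -[leRHS]mulr1 ler_pM// ger0_norm; case/andP: Ey3.
  by rewrite -[leRHS]mul1r ler_pM// ger0_norm; case/andP: Ex2.
move: Exy; rewrite !ler_norml; lra.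
Qed.

(** Young's inequality with the exponent conjugate to [q], which is at most [p]; since x >= 1, it
    may be raised to [p]. *)
Lemma mulr_le_powRD (p q x y : R) : 0 < p -> 0 < q -> p^-1 + q^-1 <= 1 ->
  1 <= x -> 0 <= y -> x * y <= x `^ p + y `^ q.
Proof.
move=> p0 q0 pq x1 y0; have x0 : 0 <= x by exact: le_trans x1.
have pi0 : 0 < p^-1 by rewrite invr_gt0.
have qi0 : 0 < q^-1 by rewrite invr_gt0.
have r0 : 0 < (1 - q^-1) by lra.
have := @conjugate_powR R x y (1 - q^-1)^-1 q x0 y0.
rewrite invr_gt0 r0 q0 invrK => /(_ isT isT) h.
apply: (le_trans (h ltac:(lra))); apply: lerD.
  rewrite (le_trans _ (_ : x `^ (1 - q^-1)^-1 <= _))//; last first.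
    by rewrite ler_powR// -[leRHS]invrK lef_pV2 ?posrE//; lra.
  by rewrite ler_piMr ?powR_ge0//; lra.
by rewrite ler_piMr ?powR_ge0//; lra.
Qed.

Lemma Rintegral_le_EFin (f : T -> R) M : integ f ->
  (\int[P]_w (f w)%:E <= M%:E)%E -> \int[P]_w f w <= M.
Proof. by move=> fi; rewrite -EFin_Rintegral// lee_fin. Qed.

(** Truncation at 1: the truncated variables have covariance at most [a], and the excess of each
    variable, and of the product, over its truncation is dominated by the powers [x ^ p] and
    [y ^ q], whose means are at most [a]. The condition a <= 1 absorbs the quadratic error in the
    product of the means. *)
Lemma cov_ge0_normalized (a p q : R) (x y : T -> R) :
  0 < a -> a <= 1 -> 0 < p -> 0 < q -> p^-1 + q^-1 <= 1 ->
  measurable_fun setT x -> measurable_fun setT y ->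
  (forall w, 0 <= x w) -> (forall w, 0 <= y w) ->
  (\int[P]_w (x w `^ p)%:E <= a%:E)%E -> (\int[P]_w (y w `^ q)%:E <= a%:E)%E ->
  (forall s t : R, `|fine (P ([set w | s <= Num.min (x w) 1] `&` [set w | t <= Num.min (y w) 1])) -
     fine (P [set w | s <= Num.min (x w) 1]) * fine (P [set w | t <= Num.min (y w) 1])| <= a) ->
  [/\ integ x, integ y, integ (fun w => x w * y w) & `|cov x y| <= 6 * a].
Proof.
move=> a0 a1 p0 q0 pq mx my x0 y0 xp yq h.
pose x' w := Num.min (x w) 1; pose y' w := Num.min (y w) 1.
have mx' : measurable_fun setT x' by exact: measurable_minr.
have my' : measurable_fun setT y' by exact: measurable_minr.
have x'01 w : 0 <= x' w <= 1 by rewrite /x' le_min x0 ler01 ge_min lexx orbT.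
have y'01 w : 0 <= y' w <= 1 by rewrite /y' le_min y0 ler01 ge_min lexx orbT.
have mpow (z : T -> R) r : measurable_fun setT z -> measurable_fun setT (fun w => z w `^ r).
  by move=> mz; apply: measurableT_comp (measurable_powR r) mz.
have ixp : integ (fun w => x w `^ p) by apply: ge0_integ xp => // [|w]; [exact: mpow|exact: powR_ge0].
have iyq : integ (fun w => y w `^ q) by apply: ge0_integ yq => // [|w]; [exact: mpow|exact: powR_ge0].
have pi0 : 0 < p^-1 by rewrite invr_gt0.
have qi0 : 0 < q^-1 by rewrite invr_gt0.
have p1 : 1 <= p by rewrite -[leRHS]invrK -[leLHS]invr1 lef_pV2 ?posrE//; lra.
have q1 : 1 <= q by rewrite -[leRHS]invrK -[leLHS]invr1 lef_pV2 ?posrE//; lra.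
have Exp := Rintegral_le_EFin ixp xp. have Eyq := Rintegral_le_EFin iyq yq.
have xx' w : x w - x' w <= x w `^ p.
  rewrite /x'; have [x1|x1] := leP (x w) 1; first by rewrite subrr powR_ge0.
  by rewrite (le_trans _ (le1r_powR _ p1)) ?ltW//; lra.
have yy' w : y w - y' w <= y w `^ q.
  rewrite /y'; have [y1|y1] := leP (y w) 1; first by rewrite subrr powR_ge0.
  by rewrite (le_trans _ (le1r_powR _ q1)) ?ltW//; lra.
have xx'0 w : x' w <= x w by rewrite /x' ge_min lexx.
have yy'0 w : y' w <= y w by rewrite /y' ge_min lexx.
have ix' : integ x' by apply: (@integ_bounded _ _ _ P _ 1) => // w; move: (x'01 w); rewrite ler_norml; lra.
have iy' : integ y' by apply: (@integ_bounded _ _ _ P _ 1) => // w; move: (y'01 w); rewrite ler_norml; lra.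
have ix : integ x.
  apply: integ_le (integD ixp ix') _ => // w; rewrite ger0_norm//.
  by move: (xx' w); lra.
have iy : integ y.
  apply: integ_le (integD iyq iy') _ => // w; rewrite ger0_norm//.
  by move: (yy' w); lra.
have xyxy w : x w * y w - x' w * y' w <= x w `^ p + y w `^ q.
  have [x1|x1] := leP 1 (x w).
    rewrite (le_trans _ (mulr_le_powRD p0 q0 pq x1 (y0 w)))// gerBl.
    by rewrite mulr_ge0//; [case/andP: (x'01 w)|case/andP: (y'01 w)].
  have [y1|y1] := leP 1 (y w).
    have qp : q^-1 + p^-1 <= 1 by rewrite addrC.
    rewrite mulrC addrC [leRHS]addrC addrC (le_trans _ (mulr_le_powRD q0 p0 qp y1 (x0 w)))// gerBl.
    by rewrite mulr_ge0//; [case/andP: (x'01 w)|case/andP: (y'01 w)].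
  have -> : x' w = x w by rewrite /x' min_l// ltW.
  have -> : y' w = y w by rewrite /y' min_l// ltW.
  by rewrite subrr addr_ge0// powR_ge0.
have ix'y' : integ (fun w => x' w * y' w).
  apply: (@integ_bounded _ _ _ P _ 1) => [|w]; first exact: measurable_funM.
  by move: (x'01 w) (y'01 w); rewrite ler_norml; nra.
have xy0 w : 0 <= x w * y w - x' w * y' w.
  rewrite subr_ge0 ler_pM//; first by case/andP: (x'01 w).
  by case/andP: (y'01 w).
have ixy : integ (fun w => x w * y w).
  apply: (@integ_le _ _ _ P _ (fun w => x' w * y' w + (x w `^ p + y w `^ q))).
  - exact: measurable_funM.
  - by apply: integD => //; exact: integD.
  - by move=> w; rewrite ger0_norm ?mulr_ge0//; move: (xyxy w); lra.
split=> //.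
have hc := cov_unit_interval mx' my' x'01 y'01 h.
have Exy : 0 <= \int[P]_w (x w * y w) - \int[P]_w (x' w * y' w) <= 2 * a.
  rewrite -RintegralB// Rintegral_ge0//=.
  apply: (@le_trans _ _ (\int[P]_w (x w `^ p + y w `^ q))).
    apply: ler_Rintegral => //; first exact: integB.
    exact: integD.
  by rewrite RintegralD// [leRHS]mulr_natl mulr2n lerD.
have Ex : 0 <= \int[P]_w x w - \int[P]_w x' w <= a.
  rewrite -RintegralB// Rintegral_ge0//=; last by move=> w _; rewrite subr_ge0.
  by apply: le_trans Exp; apply: ler_Rintegral => //; exact: integB.
have Ey : 0 <= \int[P]_w y w - \int[P]_w y' w <= a.
  rewrite -RintegralB// Rintegral_ge0//=; last by move=> w _; rewrite subr_ge0.
  by apply: le_trans Eyq; apply: ler_Rintegral => //; exact: integB.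
have E01 (z : T -> R) : integ z -> (forall w, 0 <= z w <= 1) -> 0 <= \int[P]_w z w <= 1.
  move=> iz z01; rewrite Rintegral_ge0/=; last by move=> w _; case/andP: (z01 w).
  rewrite -[leRHS](Rintegral_cstT P); apply: ler_Rintegral => //; first exact: integ_cst.
  by move=> w; case/andP: (z01 w).
have := E01 _ ix' x'01; have := E01 _ iy' y'01.
move: hc Exy Ex Ey; rewrite /cov !ler_norml.
set A := \int[P]_w (x w * y w); set B := \int[P]_w (x' w * y' w).
set ex := \int[P]_w x w; set ey := \int[P]_w y w.
set fx := \int[P]_w x' w; set fy := \int[P]_w y' w.
move=> h1 h2 h3 h4 h5 h6.
have : 0 <= ex * ey - fx * fy <= 3 * a by nra.
lra.
Qed.

Lemma g_sigma_measurable_fun (G : set (set T)) (f : T -> R) :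
  G `<=` measurable -> measurable_fun setT (f : g_sigma_algebraType G -> R) ->
  measurable_fun setT f.
Proof.
move=> Gm mf _ B mB; rewrite setTI.
have := mf measurableT B mB; rewrite setTI.
apply: smallest_sub => //; exact: sigma_algebra_measurable.
Qed.

Lemma g_sigma_superlevel (G : set (set T)) (f : T -> R) (s : R) :
  measurable_fun setT (f : g_sigma_algebraType G -> R) ->
  <<s G >> [set w | s <= f w].
Proof.
move=> mf; have := mf measurableT (`[s, +oo[%classic : set R) (measurable_itv _).
rewrite setTI (_ : f @^-1` _ = [set w | s <= f w])//.
by apply/seteqP; split => w /=; rewrite in_itv/= andbT.
Qed.

(** Davydov's inequality. Dividing by (M/a)^(1/p) and (M/a)^(1/q) brings both moments down to [a],
    the normalized case. Splitting into positive and negative parts produces four covariances, hence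
    24 = 4 * 6. *)
Lemma cov_mixing (GA GB : set (set T)) (a p q M : R) (U V : T -> R) :
  GA `<=` measurable -> GB `<=` measurable ->
  (forall A B, <<s GA >> A -> <<s GB >> B ->
     `|fine (P (A `&` B)) - fine (P A) * fine (P B)| <= a) ->
  0 < a -> a <= 1 -> 0 < p -> 0 < q -> p^-1 + q^-1 <= 1 -> 0 < M ->
  measurable_fun setT (U : g_sigma_algebraType GA -> R) ->
  measurable_fun setT (V : g_sigma_algebraType GB -> R) ->
  (\int[P]_w (`|U w| `^ p)%:E <= M%:E)%E ->
  (\int[P]_w (`|V w| `^ q)%:E <= M%:E)%E ->
  [/\ integ U, integ V, integ (fun w => U w * V w) &
      `|cov U V| <= 24 * (a * (M / a) `^ (p^-1 + q^-1))].
Proof.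
move=> GAm GBm mix a0 a1 p0 q0 pq M0.
have Ma0 : 0 < M / a by rewrite divr_gt0.
pose s := (M / a) `^ p^-1; pose t := (M / a) `^ q^-1.
have s0 : 0 < s by rewrite powR_gt0.
have t0 : 0 < t by rewrite powR_gt0.
have stn0 : s * t != 0 by rewrite gt_eqF// mulr_gt0.
have stE : (M / a) `^ (p^-1 + q^-1) = s * t.
  by rewrite powRD//; apply/implyP => _; rewrite gt_eqF.
have scaled_moment (z : T -> R) r c : 0 < r -> 0 < c -> c `^ r = M / a ->
    measurable_fun setT z -> (forall w, 0 <= z w) ->
    (\int[P]_w (z w `^ r)%:E <= M%:E)%E -> (\int[P]_w ((c^-1 * z w) `^ r)%:E <= a%:E)%E.
  move=> r0 c0 cr mz z0 zM.
  under eq_integral => w _.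
    rewrite powRM ?invr_ge0 ?(ltW c0)// -powR_inv1 ?(ltW c0)// powRAC cr powR_inv1 ?(ltW Ma0)//.
    rewrite EFinM.
  over.
  rewrite ge0_integralZl//; last 3 first.
  - by apply/measurable_EFinP; apply: measurableT_comp (measurable_powR r) mz.
  - by move=> w _; rewrite lee_fin powR_ge0.
  - by rewrite lee_fin invr_ge0 ltW.
  apply: (@le_trans _ _ ((M / a)^-1%:E * M%:E)%E).
    by rewrite lee_wpmul2l// lee_fin invr_ge0 ltW.
  by rewrite -EFinM lee_fin invf_div mulfVK// gt_eqF.
have sp : s `^ p = M / a by rewrite /s -powRrM mulVf ?gt_eqF// powRr1// ltW.
have tq : t `^ q = M / a by rewrite /t -powRrM mulVf ?gt_eqF// powRr1// ltW.
have nonneg (x y : T -> R) : (forall w, 0 <= x w) -> (forall w, 0 <= y w) ->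
  measurable_fun setT (x : g_sigma_algebraType GA -> R) ->
  measurable_fun setT (y : g_sigma_algebraType GB -> R) ->
  (\int[P]_w (x w `^ p)%:E <= M%:E)%E -> (\int[P]_w (y w `^ q)%:E <= M%:E)%E ->
  [/\ integ x, integ y, integ (fun w => x w * y w) & `|cov x y| <= 6 * a * (s * t)].
  move=> x0 y0 mx my xM yM.
  have mx' := g_sigma_measurable_fun GAm mx.
  have my' := g_sigma_measurable_fun GBm my.
  have := @cov_ge0_normalized a p q (fun w => s^-1 * x w) (fun w => t^-1 * y w) a0 a1 p0 q0 pq.
  have msx : measurable_fun setT (fun w => s^-1 * x w) by apply: measurable_funM.
  have mty : measurable_fun setT (fun w => t^-1 * y w) by apply: measurable_funM.
  move=> /(_ msx mty).
  have sx0 w : 0 <= s^-1 * x w by rewrite mulr_ge0// invr_ge0 ltW.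
  have ty0 w : 0 <= t^-1 * y w by rewrite mulr_ge0// invr_ge0 ltW.
  move=> /(_ sx0 ty0 (scaled_moment x p s p0 s0 sp mx' x0 xM) (scaled_moment y q t q0 t0 tq my' y0 yM)).
  case.
    move=> u v; apply: mix; apply: g_sigma_superlevel.
      by apply: measurable_minr => //; apply: measurable_funM.
    by apply: measurable_minr => //; apply: measurable_funM.
  have K (c : R) (z : T -> R) : 0 < c -> integ (fun w => c^-1 * z w) -> integ z.
    move=> c0 /(integZ c); rewrite (_ : (fun w => c * (c^-1 * z w)) = z)//.
    by apply/funext => w; rewrite mulVKf// gt_eqF.
  move=> ix iy ixy hc.
  have ix' := K _ _ s0 ix. have iy' := K _ _ t0 iy.
  have ixy' : integ (fun w => x w * y w).
    apply: (K (s * t)); first by rewrite mulr_gt0.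
    rewrite (_ : (fun w => _) = (fun w => s^-1 * x w * (t^-1 * y w)))//.
    by apply/funext => w; rewrite invfM mulrACA.
  split => //.
  have -> : cov x y = (s * t) * cov (fun w => s^-1 * x w) (fun w => t^-1 * y w).
    rewrite /cov !RintegralZl// mulrBr; congr (_ - _).
      rewrite -RintegralZl//; apply: eq_Rintegral => w _.
      by rewrite (mulrACA s^-1) -invfM mulVKf.
    by rewrite (mulrACA s^-1) -invfM mulVKf.
  have st0 : 0 <= s * t by rewrite mulr_ge0// ltW.
  by rewrite normrM mulrC (ger0_norm st0) ler_wpM2r.
move=> mU mV UM VM.
have pos (G : set (set T)) (z : T -> R) : measurable_fun setT (z : g_sigma_algebraType G -> R) ->
  measurable_fun setT ((fun w => Num.max (z w) 0) : g_sigma_algebraType G -> R).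
  by move=> mz; apply: measurable_maxr.
have neg (G : set (set T)) (z : T -> R) : measurable_fun setT (z : g_sigma_algebraType G -> R) ->
  measurable_fun setT ((fun w => - z w) : g_sigma_algebraType G -> R).
  by move=> mz; apply: measurable_funN.
have mom (z y : T -> R) r : 0 < r -> measurable_fun setT z -> measurable_fun setT y ->
  (forall w, 0 <= z w) -> (forall w, z w <= `|y w|) ->
  (\int[P]_w (`|y w| `^ r)%:E <= M%:E)%E -> (\int[P]_w (z w `^ r)%:E <= M%:E)%E.
  move=> r0 mz my z0 zy; apply: le_trans; apply: ge0_le_integral => //.
  - by move=> w _; rewrite lee_fin powR_ge0.
  - by apply/measurable_EFinP; apply: measurableT_comp (measurable_powR r) mz.
  - apply/measurable_EFinP; apply: measurableT_comp (measurable_powR r) _.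
    exact: measurableT_comp.
  - by move=> w _; rewrite lee_fin ge0_ler_powR ?nnegrE// ltW.
pose U1 w := Num.max (U w) 0; pose U2 w := Num.max (- U w) 0.
pose V1 w := Num.max (V w) 0; pose V2 w := Num.max (- V w) 0.
have mU1 := pos _ _ mU. have mU2 := pos _ _ (neg _ _ mU).
have mV1 := pos _ _ mV. have mV2 := pos _ _ (neg _ _ mV).
have mUT := g_sigma_measurable_fun GAm mU. have mVT := g_sigma_measurable_fun GBm mV.
have max0 (z : R) : 0 <= Num.max z 0 by rewrite le_max lexx orbT.
have maxn (z : R) : Num.max z 0 <= `|z| by rewrite ge_max ler_norm normr_ge0.
have maxn' (z : R) : Num.max (- z) 0 <= `|z| by rewrite -normrN.
have M1 := mom _ _ p p0 (g_sigma_measurable_fun GAm mU1) mUT (fun w => max0 (U w)) (fun w => maxn (U w)) UM.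
have M2 := mom _ _ p p0 (g_sigma_measurable_fun GAm mU2) mUT (fun w => max0 (- U w)) (fun w => maxn' (U w)) UM.
have N1 := mom _ _ q q0 (g_sigma_measurable_fun GBm mV1) mVT (fun w => max0 (V w)) (fun w => maxn (V w)) VM.
have N2 := mom _ _ q q0 (g_sigma_measurable_fun GBm mV2) mVT (fun w => max0 (- V w)) (fun w => maxn' (V w)) VM.
have [i1 j1 k11 c11] := nonneg U1 V1 (fun w => max0 (U w)) (fun w => max0 (V w)) mU1 mV1 M1 N1.
have [i2 j2 k22 c22] := nonneg U2 V2 (fun w => max0 (- U w)) (fun w => max0 (- V w)) mU2 mV2 M2 N2.
have [_ _ k12 c12] := nonneg U1 V2 (fun w => max0 (U w)) (fun w => max0 (- V w)) mU1 mV2 M1 N2.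
have [_ _ k21 c21] := nonneg U2 V1 (fun w => max0 (- U w)) (fun w => max0 (V w)) mU2 mV1 M2 N1.
have decomp (z : R) : z = Num.max z 0 - Num.max (- z) 0.
  have [z0|/ltW z0] := leP z 0.
    by rewrite max_l ?oppr_ge0// sub0r opprK.
  by rewrite max_r ?oppr_le0// subr0.
have UE : U = fun w => U1 w - U2 w by apply/funext => w; exact: decomp.
have VE : V = fun w => V1 w - V2 w by apply/funext => w; exact: decomp.
have UVE w : U w * V w = (U1 w * V1 w - U1 w * V2 w) - (U2 w * V1 w - U2 w * V2 w).
  by rewrite UE VE; ring.
have iUV : integ (fun w => U w * V w).
  rewrite (_ : (fun w => U w * V w) = (fun w => (U1 w * V1 w - U1 w * V2 w) - (U2 w * V1 w - U2 w * V2 w))).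
    by apply: integB; apply: integB.
  exact/funext.
split => //; [by rewrite UE; exact: integB|by rewrite VE; exact: integB|].
rewrite stE.
have -> : cov U V = cov U1 V1 - cov U1 V2 - (cov U2 V1 - cov U2 V2).
  have EUV : \int[P]_w (U w * V w) = \int[P]_w (U1 w * V1 w - U1 w * V2 w - (U2 w * V1 w - U2 w * V2 w)).
    by apply: eq_Rintegral => w _; exact: UVE.
  have EU : \int[P]_w U w = \int[P]_w (U1 w - U2 w) by rewrite {1}UE.
  have EV : \int[P]_w V w = \int[P]_w (V1 w - V2 w) by rewrite {1}VE.
  rewrite /cov EUV EU EV !RintegralB//; [ring|exact: integB..].
move: c11 c22 c12 c21; rewrite !ler_norml; lra.
Qed.

End covariance_inequality.

(** * Sums over sorted index sequences *)

Section iterated_sums.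
Context {R : realType}.
Implicit Types (F G H : seq nat -> R).

(** The sum over all index sequences of length [k] with entries in [a, b[. Sequences, rather than
    tuples, let [take], [drop] and [scanl] act on the indices. *)
Fixpoint isum (a b k : nat) (G : seq nat -> R) : R :=
  if k is k'.+1 then \sum_(a <= i < b) isum a b k' (fun s => G (i :: s))
  else G [::].

Lemma ler_isum a b k G H :
  (forall s, size s = k -> all (fun i => a <= i < b)%N s -> G s <= H s) ->
  isum a b k G <= isum a b k H.
Proof.
elim: k G H => [|k IH] G H GH /=; first exact: GH.
rewrite big_nat [leRHS]big_nat; apply: ler_sum => i /andP[ai ib].
by apply: IH => s sk sab; apply: GH => /=; rewrite ?sk// ai ib.
Qed.

Lemma eq_isum a b k G H : (forall s, size s = k -> G s = H s) ->
  isum a b k G = isum a b k H.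
Proof.
move=> GH; apply/eqP; rewrite eq_le; apply/andP; split;
  by apply: ler_isum => s sk _; rewrite GH.
Qed.

Lemma isum_ge0 a b k G : (forall s, 0 <= G s) -> 0 <= isum a b k G.
Proof.
elim: k G => [|k IH] G G0 //=; apply: sumr_ge0 => i _; exact: IH.
Qed.

Lemma isumD a b k G H : isum a b k (fun s => G s + H s) =
  isum a b k G + isum a b k H.
Proof.
elim: k G H => [|k IH] G H //=; rewrite -big_split/=.
by apply: eq_bigr => i _; rewrite IH.
Qed.

Lemma isumZ a b k c G : isum a b k (fun s => c * G s) = c * isum a b k G.
Proof.
elim: k G => [|k IH] G //=; rewrite mulr_sumr.
by apply: eq_bigr => i _; rewrite IH.
Qed.

Lemma isum_eq0 a b k G : (forall s, G s = 0) -> isum a b k G = 0.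
Proof.
move=> G0; rewrite -[RHS](mul0r (isum a b k (fun=> 0))) -isumZ.
by apply: eq_isum => s _; rewrite G0 mul0r.
Qed.

Lemma isum_sum a b k (I : eqType) (r : seq I) (G : I -> seq nat -> R) :
  isum a b k (fun s => \sum_(i <- r) G i s) = \sum_(i <- r) isum a b k (G i).
Proof.
elim: r => [|i r IH]; last first.
  rewrite big_cons -IH -isumD; apply: eq_isum => s _.
  by rewrite big_cons.
by rewrite big_nil isum_eq0// => s; rewrite big_nil.
Qed.

Lemma ler_norm_isum a b k G : `|isum a b k G| <= isum a b k (fun s => `|G s|).
Proof.
elim: k G => [|k IH] G //=.
by rewrite (le_trans (ler_norm_sum _ _ _))//; apply: ler_sum => i _.
Qed.

Lemma exprn_isum a b k (x : nat -> R) :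
  (\sum_(a <= i < b) x i) ^+ k = isum a b k (fun s => \prod_(i <- s) x i).
Proof.
elim: k => [|k IH] /=; first by rewrite big_nil expr0.
rewrite exprS IH mulr_suml; apply: eq_bigr => i _.
by rewrite -isumZ; apply: eq_isum => s _; rewrite big_cons.
Qed.

Definition perm_invariant F := forall s t, perm_eq s t -> F s = F t.

Lemma perm_invariant_cons F i : perm_invariant F ->
  perm_invariant (fun s => F (i :: s)).
Proof. by move=> Fp s t st; apply: Fp; rewrite perm_cons. Qed.

(** A sequence either avoids [p] or has [p] at one of [q.+1] positions, from which symmetry moves it
    to the front. Repeated occurrences of [p] are counted several times, hence only an
    inequality. *)
Lemma isum_split_min p e q F : (p < e)%N -> perm_invariant F ->
  (forall s, 0 <= F s) ->
  isum p e q.+1 F <=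
  isum p.+1 e q.+1 F + q.+1%:R * isum p e q (fun s => F (p :: s)).
Proof.
move=> pe; elim: q F => [|q IH] F Fp F0 /=.
  by rewrite big_ltn// mul1r addrC.
rewrite big_ltn//= [X in _ <= _ + _ * X](_ : _ = \sum_(p <= i < e) isum p e q (fun s => F [:: p, i & s]))//.
set A := \sum_(p <= i < e) _.
have -> : q.+2%:R * A = A + q.+1%:R * A :> R by rewrite -[in LHS]addn1 addnC natrD mulrDl mul1r.
rewrite [leRHS]addrCA lerD2l.
apply: (@le_trans _ _ (\sum_(p.+1 <= i < e) (isum p.+1 e q.+1 (fun s => F (i :: s)) +
  q.+1%:R * isum p e q (fun s => F [:: i, p & s])))).
  rewrite big_nat [leRHS]big_nat; apply: ler_sum => i /andP[pi ie].
  exact: (IH (fun s => F (i :: s)) (perm_invariant_cons i Fp)).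
rewrite big_split/= lerD2l -mulr_sumr ler_wpM2l//.
rewrite /A [leRHS]big_ltn//= -[leLHS]add0r lerD ?isum_ge0//.
apply: ler_sum => i _; apply: ler_isum => s _ _.
rewrite (Fp [:: i, p & s] [:: p, i & s])//.
by apply/permP => P; rewrite /= addnCA.
Qed.

(* A multiset of indices is determined by its minimum and the successive gaps of
   its sorted enumeration. *)
Lemma isum_le_gaps n q p e F : (e <= p + n)%N -> perm_invariant F ->
  (forall s, 0 <= F s) ->
  isum p e q F <= q`!%:R * isum 0 n q (fun g => F (scanl addn p g)).
Proof.
elim: q p F => [|q IH] p F epn Fp F0; first by rewrite /= mul1r.
have main m : (e - p <= m)%N -> forall p', (p <= p')%N -> (e - p' <= m)%N ->
  isum p' e q.+1 F <=
    q.+1`!%:R * \sum_(p' <= l < e) isum 0 n q (fun g => F (l :: scanl addn l g)).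
  move=> _; elim: m => [|m IHm] p' pp'.
    rewrite leqn0 subn_eq0 => ep'.
    by rewrite /= big_geq// big_geq// mulr0.
  move=> epm; have [ep'|p'e] := leqP e p'.
    by rewrite /= big_geq// big_geq// mulr0.
  apply: (le_trans (isum_split_min q p'e Fp F0)).
  rewrite [in leRHS]big_ltn// mulrDr addrC; apply: lerD.
    rewrite factS natrM -mulrA ler_wpM2l//.
    apply: (IH p' (fun s => F (p' :: s))) => //.
      by rewrite (leq_trans epn)// leq_add2r.
    exact: perm_invariant_cons.
  by apply: IHm; [exact: leqW|rewrite subnS; lia].
apply: (le_trans (main (e - p)%N (leqnn _) p (leqnn _) (leqnn _))).
rewrite ler_wpM2l//= -[X in \sum_(X <= _ < _) _]add0n big_addn.
have epn' : (e - p <= n)%N by rewrite leq_subLR.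
rewrite (@big_cat_nat _ _ _ (e - p) 0 n)//= -[leLHS]addr0 lerD//.
  by apply: ler_sum => i _; rewrite addnC.
by apply: sumr_ge0 => i _; exact: isum_ge0.
Qed.

(** The last indices depend on the first ones only through their starting point, and [D] is uniform
    in that point. *)
Lemma isum_take_drop n m r p F1 F2 (D : R) : (forall s, 0 <= F1 s) ->
  (forall p', (p <= p')%N -> isum 0 n r (fun g => F2 (scanl addn p' g)) <= D) ->
  isum 0 n (m + r) (fun g => F1 (take m (scanl addn p g)) *
                             F2 (drop m (scanl addn p g))) <=
  isum 0 n m (fun g => F1 (scanl addn p g)) * D.
Proof.
elim: m p F1 => [|m IH] p F1 F10 F2D.
  rewrite add0n /= (@eq_isum _ _ _ _ (fun g => F1 [::] * F2 (scanl addn p g))).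
    by rewrite isumZ ler_wpM2l// F2D.
  by move=> s _; rewrite take0 drop0.
rewrite addSn /= mulr_suml; apply: ler_sum => i _.
apply: (IH (p + i)%N (fun s => F1 ((p + i)%N :: s))) => // p' pp'.
by apply: F2D; rewrite (leq_trans _ pp')// leq_addr.
Qed.

Lemma sum_leq_indicator n r :
  \sum_(0 <= i < n) ((i <= r)%N%:R : R) <= r.+1%:R.
Proof.
suff -> : \sum_(0 <= i < n) ((i <= r)%N%:R : R) = (minn n r.+1)%:R.
  by rewrite ler_nat geq_minr.
elim: n => [|n IH]; first by rewrite big_geq// min0n.
rewrite big_nat_recr//= IH -natrD; congr (_%:R).
case: (leqP n r) => h /=; lia.
Qed.

Lemma isum_all_leq n k r :
  isum 0 n k (fun g => (all (fun i => i <= r)%N g)%:R) <= r.+1%:R ^+ k.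
Proof.
elim: k => [|k IH] //=.
rewrite exprS.
apply: (@le_trans _ _ (\sum_(0 <= i < n) (i <= r)%N%:R * r.+1%:R ^+ k)).
  apply: ler_sum => i _; case: (i <= r)%N => /=.
    by rewrite mul1r.
  by rewrite mul0r isum_eq0.
by rewrite -mulr_suml ler_wpM2r ?exprn_ge0// sum_leq_indicator.
Qed.

(** There are [k] positions for an entry equal to [r], and [r.+1] values for each of the others. *)
Lemma isum_max_eq n k r :
  isum 0 n k (fun g => (all (fun i => i <= r)%N g && (r \in g))%:R) <=
  k%:R * r.+1%:R ^+ k.-1.
Proof.
elim: k => [|k IH] /=; first by rewrite mul0r.
have step (i : nat) : isum 0 n k (fun s => ((i <= r)%N &&
     all (fun j => j <= r)%N s && (r \in i :: s))%:R) <=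
   (i == r)%:R * r.+1%:R ^+ k + (i <= r)%N%:R * (k%:R * r.+1%:R ^+ k.-1).
  have [ir|ri] := leqP i r => /=; last first.
    by rewrite isum_eq0// mul0r addr0 mulr_ge0// exprn_ge0.
  have [->|ne] := eqVneq i r => /=; rewrite ?mul1r ?mul0r ?add0r.
    rewrite -[leLHS]addr0 lerD ?mulr_ge0 ?exprn_ge0//.
    apply: le_trans (isum_all_leq n k r); apply: ler_isum => s _ _.
    by rewrite ler_nat; case: all => //; rewrite leq_b1.
  apply: le_trans IH; apply: ler_isum => s _ _.
  by rewrite in_cons eq_sym (negbTE ne).
apply: (le_trans (ler_sum _ (fun i _ => step i))).
rewrite big_split/= -!mulr_suml.
have -> : k.+1%:R * r.+1%:R ^+ k = r.+1%:R ^+ k + r.+1%:R * (k%:R * r.+1%:R ^+ k.-1) :> R.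
  case: k {IH step} => [|k] /=; first by rewrite mul0r mulr0 addr0 mul1r.
  by rewrite mulrCA -exprS -[in LHS]addn1 natrD mulrDl mul1r addrC.
apply: lerD; last by rewrite ler_wpM2r ?mulr_ge0 ?exprn_ge0// sum_leq_indicator.
rewrite ler_piMl ?exprn_ge0//.
have [rn|nr] := ltnP r n.
  rewrite (bigD1_seq r) ?mem_index_iota ?iota_uniq//= eqxx big1 ?addr0//.
  by move=> i /negbTE ->.
rewrite big1_seq// => i; rewrite mem_index_iota => /andP[_ /andP[_ iN]].
by case: eqP => // ir; move: iN; rewrite ir ltnNge nr.
Qed.

Lemma foldr_maxn_all (g : seq nat) : all (fun i => i <= foldr maxn 0 g)%N g.
Proof.
elim: g => [//|i g IH] /=; rewrite leq_maxl/=.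
by apply: sub_all IH => j jg; rewrite (leq_trans jg)// leq_maxr.
Qed.

Lemma foldr_maxn_mem (g : seq nat) : (0 < size g)%N -> foldr maxn 0 g \in g.
Proof.
elim: g => [//|i [|j g] IH] _; first by rewrite /= maxn0 mem_head.
rewrite [foldr _ _ _]/= {1}/maxn; case: ifP => _; last exact: mem_head.
by rewrite in_cons IH ?orbT.
Qed.

Lemma isum_foldr_maxn (v : nat -> R) n k : (forall r, 0 <= v r) -> (0 < k)%N ->
  isum 0 n k (fun g => v (foldr maxn 0 g)) <=
  k%:R * \sum_(0 <= r < n) r.+1%:R ^+ k.-1 * v r.
Proof.
move=> v0 k0.
apply: (@le_trans _ _ (isum 0 n k (fun g => \sum_(0 <= r < n)
    v r * (all (fun i => i <= r)%N g && (r \in g))%:R))).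
  apply: ler_isum => g gk gn; have g0 : (0 < size g)%N by rewrite gk.
  have rg := foldr_maxn_mem g0.
  rewrite (bigD1_seq (foldr maxn 0 g)) ?iota_uniq//=; last first.
    by rewrite mem_index_iota; exact: (allP gn).
  by rewrite foldr_maxn_all rg mulr1 lerDl sumr_ge0// => r _; rewrite mulr_ge0.
rewrite isum_sum mulr_sumr; apply: ler_sum => r _.
rewrite isumZ mulrA [leRHS]mulrC ler_wpM2l//; exact: isum_max_eq.
Qed.

Lemma expr_between (y : R) (a e b : nat) : 0 <= y -> (a <= e <= b)%N ->
  y ^+ e <= y ^+ a + y ^+ b.
Proof.
move=> y0 /andP[ae eb]; have [y1|y1] := leP y 1.
  by rewrite -[leLHS]addr0 lerD ?exprn_ge0// ler_wiXn2l.
by rewrite -[leLHS]add0r lerD ?exprn_ge0// ler_weXn2l// ltW.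
Qed.

Lemma scanl_addn_sorted p g :
  sorted leq (scanl addn p g) && all (fun i => p <= i)%N (scanl addn p g).
Proof.
suff : path leq p (scanl addn p g).
  move=> pp; rewrite (path_sorted pp)/=; exact: (order_path_min leq_trans pp).
by elim: g p => [//|i g IH] p /=; rewrite leq_addr IH.
Qed.

Lemma nth_scanl_addn p g m : (m.+1 < size g)%N ->
  (nth 0 (scanl addn p g) m.+1 - nth 0 (scanl addn p g) m = nth 0 g m.+1)%N.
Proof.
elim: g p m => [//|i g IH] p [|m] /= mg; last by rewrite IH.
by case: g mg {IH} => // j g _ /=; rewrite addKn.
Qed.

(** Bounds of the form y^2 + y^k are stable under products: all four exponents lie between 2 and a +
    b. This is what lets the recursion over splits close. *)
Lemma mulr_expr_between (y : R) (a b : nat) : 0 <= y -> (2 <= a)%N -> (2 <= b)%N ->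
  (y ^+ 2 + y ^+ a) * (y ^+ 2 + y ^+ b) <= 4 * (y ^+ 2 + y ^+ (a + b)).
Proof.
move=> y0 a2 b2; rewrite mulrDl !mulrDr -!exprD.
have h e : (2 <= e <= a + b)%N -> y ^+ e <= y ^+ 2 + y ^+ (a + b).
  exact: expr_between.
have h1 := h (2 + 2)%N ltac:(lia). have h2 := h (2 + b)%N ltac:(lia).
have h3 := h (a + 2)%N ltac:(lia). have h4 := h (a + b)%N ltac:(lia).
lra.
Qed.

(* Splitting a sorted index sequence at its largest gap turns the sum over all
   gap sequences into products of lower order sums plus a remainder, in which a
   largest gap [r] leaves at most [r.+1 ^+ (q - 2)] choices for the others. *)
Lemma gap_sum_bound (Q : nat) (V C : R) (v : nat -> R) :
  (forall r, 0 <= v r) -> 0 <= C ->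
  (forall n, \sum_(0 <= r < n) r.+1%:R ^+ (Q - 2) * v r <= V) ->
  forall q, (q <= Q)%N -> exists2 K : R, 0 <= K &
  forall F n (y c : R), (forall s, 0 <= F s) -> 0 <= y -> 0 <= c ->
  n%:R * c <= C * y ^+ 2 -> (forall i, (0 < i)%N -> F [:: i] = 0) ->
  (forall s m, sorted leq s -> all (fun i => 0 < i)%N s ->
     (2 <= size s <= Q)%N -> (0 < m < size s)%N ->
     F s <= F (take m s) * F (drop m s) + c * v (nth 0 s m - nth 0 s m.-1)%N) ->
  forall k p, (0 < k <= q)%N -> (0 < p)%N ->
  isum 0 n k (fun g => F (scanl addn p g)) <=
  (k != 1)%N%:R * (K * (y ^+ 2 + y ^+ k)).
Proof.
move=> v0 C0 vV; have V0 : 0 <= V.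
  by have := vV 0; rewrite big_geq.
elim=> [|q IH] qQ; first by exists 0 => // F n y c _ _ _ _ _ _ [].
have [K K0 HK] := IH (ltnW qQ).
(* [K] keeps the bound at lower orders, the second term pays for the products at the [q] possible
   split positions, the third for the covariance remainders. *)
exists (K + q%:R * (4 * K ^+ 2) + C * q%:R * V).
  by rewrite !addr_ge0 ?mulr_ge0 ?exprn_ge0.
move=> F n y c F0 y0 c0 nc F1 Fsplit k p /andP[k0 kq1] p0.
have Ey k' : 0 <= y ^+ 2 + y ^+ k' by rewrite addr_ge0 ?exprn_ge0.
have HKF := HK F n y c F0 y0 c0 nc F1 Fsplit.
have [kq|qk] := leqP k q.
  apply: (le_trans (HKF k p _ p0)); first by rewrite k0.
  rewrite ler_wpM2l// ler_wpM2r// -addrA lerDl.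
  by rewrite addr_ge0 ?mulr_ge0 ?exprn_ge0.
have {k k0 kq1 qk} -> : k = q.+1 by apply/eqP; rewrite eqn_leq kq1.
case: q => [|q] in qQ IH HKF HK *.
  rewrite eqxx mul0r /= big_nat big1// => i _.
  by rewrite F1// addn_gt0 p0.
rewrite mul1r.
(* The position of the largest gap varies with [g], so its product is bounded by the sum over all
   positions. [behead] removes the first entry of [g], which fixes the smallest index and is no gap
   between two indices. *)
apply: (@le_trans _ _ (isum 0 n q.+2 (fun g =>
  \sum_(1 <= m < q.+2) F (take m (scanl addn p g)) * F (drop m (scanl addn p g)) +
  c * v (foldr maxn 0%N (behead g))))).
  apply: ler_isum => -[//|g0 g] /= [sg] _.
  have rg : foldr maxn 0%N g \in g by rewrite foldr_maxn_mem// sg.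
  set s := (p + g0)%N :: _.
  have ss : s = scanl addn p (g0 :: g) by [].
  have sizes : size s = q.+2 by rewrite ss size_scanl/= sg.
  pose j := index (foldr maxn 0%N g) g.
  have jq : (j < q.+1)%N by rewrite -sg index_mem.
  have /andP[s_sorted s_ge] := scanl_addn_sorted p (g0 :: g).
  have s_gt0 : all (fun i => 0 < i)%N s.
    by apply: sub_all s_ge => i; exact: leq_trans.
  have h1 : (2 <= size s <= Q)%N by rewrite sizes qQ.
  have h2 : (0 < j.+1 < size s)%N by rewrite sizes.
  apply: (le_trans (Fsplit s j.+1 s_sorted s_gt0 h1 h2)).
  rewrite [in v _]ss /= -[X in _ <= _ + c * v X](nth_index 0%N rg) -/j.
  have -> : (nth 0 (scanl addn (p + g0) g) j - nth 0 s j = nth 0 g j)%N.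
    by rewrite -[RHS](@nth_scanl_addn p (g0 :: g) j)//= sg.
  rewrite lerD2r (bigD1_seq j.+1) ?iota_uniq ?mem_index_iota//=.
  by rewrite lerDl sumr_ge0// => m _; rewrite mulr_ge0.
rewrite isumD isum_sum.
have -> : (K + q.+1%:R * (4 * K ^+ 2) + C * q.+1%:R * V) * (y ^+ 2 + y ^+ q.+2) =
   K * (y ^+ 2 + y ^+ q.+2) + q.+1%:R * (4 * K ^+ 2) * (y ^+ 2 + y ^+ q.+2)
   + C * q.+1%:R * V * (y ^+ 2 + y ^+ q.+2) by ring.
apply: lerD.
  rewrite -[leLHS]add0r lerD ?mulr_ge0//.
  have -> : q.+1%:R * (4 * K ^+ 2) * (y ^+ 2 + y ^+ q.+2) =
     \sum_(1 <= m < q.+2) (4 * K ^+ 2) * (y ^+ 2 + y ^+ q.+2).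
    by rewrite big_const_nat iter_addr_0 subn1/= -mulrA mulr_natl.
  rewrite big_nat [leRHS]big_nat; apply: ler_sum => m /andP[m0 mq].
  have mE : (m + (q.+2 - m) = q.+2)%N by rewrite subnKC// ltnW.
  rewrite -{1}mE.
  apply: (@le_trans _ _ (isum 0 n m (fun g => F (scanl addn p g)) *
    ((q.+2 - m != 1)%N%:R * (K * (y ^+ 2 + y ^+ (q.+2 - m)))))).
    apply: isum_take_drop => // p' pp'.
    by apply: HKF; [lia|exact: leq_trans pp'].
  (* A split that isolates one index contributes nothing, since [F] vanishes on singletons; in the
     remaining case both factors have order at least 2. *)
  have [m1|m1] := eqVneq m 1%N.
    rewrite m1 /= big_nat big1; last by move=> i _; rewrite F1// addn_gt0 p0.
    by rewrite mul0r !mulr_ge0 ?exprn_ge0.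
  have [r1|r1] := eqVneq (q.+2 - m)%N 1%N.
    by rewrite mul0r mulr0 !mulr_ge0 ?exprn_ge0.
  rewrite mul1r.
  apply: (@le_trans _ _ ((K * (y ^+ 2 + y ^+ m)) * (K * (y ^+ 2 + y ^+ (q.+2 - m))))).
    rewrite ler_wpM2r ?mulr_ge0//.
    have := HKF m p _ p0; rewrite m1 mul1r; apply.
    by rewrite m0.
  rewrite mulrACA [in leRHS]mulrAC -!mulrA mulrA -expr2 [leRHS]mulrA [leRHS]mulrC.
  have := @mulr_expr_between y m (q.+2 - m) y0 ltac:(lia) ltac:(lia).
  rewrite mE => h.
  have K20 : 0 <= K ^+ 2 by rewrite exprn_ge0.
  have := ler_wpM2l K20 h; lra.
rewrite isumZ.
(* The smallest index is free and gives the factor [n], which [c] absorbs by n c <= C y^2. *)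
have -> : isum 0 n q.+2 (fun g => v (foldr maxn 0%N (behead g))) =
    n%:R * isum 0 n q.+1 (fun g => v (foldr maxn 0%N g)).
  rewrite -[LHS]/(\sum_(0 <= i < n) isum 0 n q.+1 (fun g => v (foldr maxn 0%N g))).
  by rewrite big_const_nat iter_addr_0 subn0 mulr_natl.
rewrite mulrA (mulrC c).
apply: (@le_trans _ _ (C * y ^+ 2 * (q.+1%:R * V))).
  apply: ler_pM; rewrite ?mulr_ge0// ?isum_ge0//.
  apply: (le_trans (isum_foldr_maxn n v0 (ltn0Sn q))).
  rewrite ler_wpM2l//= (le_trans _ (vV n))//.
  apply: ler_sum => r _; rewrite ler_wpM2r// ler_weXn2l ?ler1n//.
  by move: qQ; lia.
rewrite mulrACA -!mulrA ler_wpM2l// ler_wpM2l//.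
by rewrite mulrA -expr2 mulrC ler_wpM2l// lerDl exprn_ge0.
Qed.

End iterated_sums.

(** * Moment and maximal inequalities for mixing sums *)

Lemma measurable_prod_seq {R : realType} d (S : measurableType d) (s : seq nat)
    (x : nat -> S -> R) :
  (forall i, i \in s -> measurable_fun setT (x i)) ->
  measurable_fun setT (fun w => \prod_(i <- s) x i w).
Proof.
elim: s => [|i s IH] xm.
  by under eq_fun do rewrite big_nil; exact: measurable_cst.
under eq_fun do rewrite big_cons.
apply: measurable_funM; first by apply: xm; exact: mem_head.
by apply: IH => j js; apply: xm; rewrite in_cons js orbT.
Qed.

Section moment_inequality.
Context {R : realType} {d dE : measure_display} {T : measurableType d}
  {E : measurableType dE}.
Variables (P : probability T R) (Y : nat -> T -> E).
Hypothesis mY : forall i, measurable_fun setT (Y i).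
Variables (theta : R) (Q : nat) (v : nat -> R) (V : R).
Hypothesis theta_gt2 : 2 < theta.
Hypothesis Q_ge2 : (2 <= Q)%N.
Hypothesis Q_even : ~~ odd Q.
Hypothesis v_gt0 : forall t, 0 < v t.
Hypothesis v_le1 : forall t, v t <= 1.
Hypothesis v_sum : forall n, \sum_(0 <= r < n) r.+1%:R ^+ (Q - 2) * v r <= V.
(** [v t] stands for the mixing coefficient to the power 1 - 2/theta, which is what the covariance
    inequality leaves of it when 1/p + 1/q = 2/theta. *)
Hypothesis mixing : forall k t n A B, (0 < k)%N -> (k + t <= n)%N ->
  sigma_gen Y [set j | (1 <= j <= k)%N] A ->
  sigma_gen Y [set j | (k + t <= j <= n)%N] B ->
  `|fine (P (A `&` B)) - fine (P A) * fine (P B)| <= v t `^ (1 - 2 / theta)^-1.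
Local Notation integ f := (P.-integrable setT (EFin \o f)).

Let sigma_sub (J : set nat) :
  \bigcup_(j in J) preimage_set_system setT (Y j) measurable `<=` measurable.
Proof.
by move=> A [j _ [B mB <-]]; apply: mY.
Qed.

Let sigma_gen_measurable (J : set nat) i : J i ->
  measurable_fun setT (Y i : g_sigma_algebraType
    (\bigcup_(j in J) preimage_set_system setT (Y j) measurable) -> E).
Proof.
move=> Ji _ B mB; apply: sub_sigma_algebra; exists i => //; by exists B.
Qed.

Section one_sequence.
Variables (h : nat -> E -> R) (M : R).
Hypothesis mh : forall i, measurable_fun setT (h i).
Hypothesis M_gt0 : 0 < M.
Let xi i w := h i (Y i w).
Hypothesis momh : forall i q, (0 < i)%N -> (2 <= q <= Q)%N ->
  (\int[P]_w (`|xi i w| `^ (q%:R * (theta / 2)))%:E <= M%:E)%E.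
Hypothesis centered : forall i, (0 < i)%N -> \int[P]_w xi i w = 0.

Let mxi i : measurable_fun setT (xi i).
Proof. exact: measurableT_comp. Qed.

(** The product is at most the largest factor to the power [size s]. This replaces the generalized
    Hölder inequality, at the cost of a factor [size s] in the moments. *)
Lemma powR_norm_prod (p : R) (x : nat -> R) (s : seq nat) : 0 <= p ->
  (0 < size s)%N ->
  `|\prod_(i <- s) x i| `^ p <= \sum_(i <- s) `|x i| `^ (p * (size s)%:R).
Proof.
move=> p0 s0; rewrite normr_prod.
have [j js jmax] : exists2 j, j \in s & forall i, i \in s -> `|x i| <= `|x j|.
  elim: s s0 => [//|a [|b s] IH] _.
    by exists a; [rewrite inE|move=> i; rewrite inE => /eqP ->].
  have [j js jmax] := IH isT; have [aj|ja] := leP `|x a| `|x j|.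
    exists j; first by rewrite in_cons js orbT.
    by move=> i; rewrite in_cons => /orP[/eqP ->//|]; exact: jmax.
  exists a; first by rewrite mem_head.
  move=> i; rewrite in_cons => /orP[/eqP ->//|/jmax ij]; exact: le_trans ij (ltW ja).
apply: (@le_trans _ _ (`|x j| `^ (p * (size s)%:R))).
  rewrite mulrC powRrM powR_mulrn// ge0_ler_powR ?nnegrE ?prodr_ge0 ?exprn_ge0//.
  rewrite big_seq -[leRHS](_ : \prod_(i <- s | i \in s) `|x j| = _); last first.
    by rewrite -big_seq big_const_seq count_predT iter_mulr_1.
  by apply: ler_prod => i /jmax ->; rewrite andbT.
rewrite (big_rem j)//= lerDl sumr_ge0// => i _; exact: powR_ge0.
Qed.

Let mpow i r : measurable_fun setT (fun w => `|xi i w| `^ r).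
Proof.
apply: measurableT_comp (measurable_powR r) _.
exact: measurableT_comp.
Qed.

Let mprod (s : seq nat) : measurable_fun setT (fun w => \prod_(i <- s) xi i w).
Proof. by apply: measurable_prod => i _. Qed.

Let moment_prod (p : R) (q : nat) (s : seq nat) : 0 <= p -> (0 < size s)%N ->
  (2 <= q <= Q)%N -> p * (size s)%:R = q%:R * (theta / 2) ->
  all (fun i => 0 < i)%N s ->
  (\int[P]_w (`|\prod_(i <- s) xi i w| `^ p)%:E <= ((size s)%:R * M)%:E)%E.
Proof.
move=> p0 s0 q2 pq spos.
apply: (@le_trans _ _ (\int[P]_w (\sum_(i <- s) (`|xi i w| `^ (q%:R * (theta / 2)))%:E))%E).
  apply: ge0_le_integral => //.
  - apply/measurable_EFinP; apply: measurableT_comp (measurable_powR p) _.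
    exact: measurableT_comp.
  - by apply: emeasurable_sum => i; apply/measurable_EFinP.
  - by move=> w _; rewrite sumEFin lee_fin -pq; exact: powR_norm_prod.
rewrite ge0_integral_sum//; last by move=> i; apply/measurable_EFinP.
rewrite big_seq; apply: (@le_trans _ _ (\sum_(i <- s | i \in s) M%:E)%E).
  by apply: lee_sum => i si; apply: momh => //; exact: (allP spos).
by rewrite -big_seq sumEFin big_const_seq count_predT iter_addr_0 mulr_natl.
Qed.

Let integ_prod (s : seq nat) : all (fun i => 0 < i)%N s -> (size s <= Q)%N ->
  integ (fun w => \prod_(i <- s) xi i w).
Proof.
move=> spos sQ; case: s => [|a s] in spos sQ *.
  by under eq_fun do rewrite big_nil; exact: integ_cst.
set s' := a :: s in spos sQ *.
have q0 : 0 <= Q%:R * (theta / 2) by rewrite mulr_ge0// divr_ge0// ltW// (lt_trans _ theta_gt2).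
have QQ : (2 <= Q <= Q)%N by rewrite Q_ge2/=.
(* The test on [i] makes every summand integrable: moments are only assumed for positive times. *)
pose B w := \sum_(i <- s') (1 + if (0 < i)%N then `|xi i w| `^ (Q%:R * (theta / 2)) else 0).
apply: (@integ_le _ _ _ P _ B) => //.
  apply: integ_sum => i; apply: integD; first exact: integ_cst.
  case: (ltnP 0 i) => i0; last exact: integ_cst.
  by apply: ge0_integ (momh i0 QQ) => // w; exact: powR_ge0.
move=> w; rewrite -[leLHS]powRr1//.
apply: (le_trans (powR_norm_prod _ ler01 _)) => //.
rewrite big_seq /B [leRHS]big_seq; apply: ler_sum => i si.
have -> : (0 < i)%N by exact: (allP spos).
rewrite mul1r; have [x1|x1] := leP `|xi i w| 1.
  rewrite -[leLHS]addr0 lerD ?powR_ge0//.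
  have [->|xn] := eqVneq `|xi i w| 0.
    by rewrite powR0 ?pnatr_eq0.
  by rewrite -[leRHS](powRr0 `|xi i w|) ger_powR// lt_neqAle eq_sym xn normr_ge0.
rewrite -[leLHS]add0r lerD// ler_powR ?(ltW x1)//.
have th1 : 1 <= theta / 2 by rewrite ler_pdivlMr// mul1r ltW.
by rewrite (@le_trans _ _ Q%:R) ?ler_nat// ler_peMr.
Qed.

Let F s := `|\int[P]_w \prod_(i <- s) xi i w|.

(** The covariance inequality across the gap before position [m]. The exponents q theta / (2 m) and
    q theta / (2 (q - m)) reduce both products to moments of order q theta / 2 of single variables,
    and their inverses add up to 2/theta. *)
Let F_split s m : sorted leq s -> all (fun i => 0 < i)%N s ->
  (2 <= size s <= Q)%N -> (0 < m < size s)%N ->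
  F s <= F (take m s) * F (drop m s) +
    24 * Q%:R * M `^ (2 / theta) * v (nth 0 s m - nth 0 s m.-1)%N.
Proof.
move=> ss spos sQ /andP[m0 ms].
have theta0 : 0 < theta by exact: lt_trans theta_gt2.
set q := size s in sQ ms *; set t := (nth 0 s m - nth 0 s m.-1)%N.
have /andP[q2 qQ] := sQ.
pose k := nth 0%N s m.-1; pose n := last 0%N s.
have mono i j : (i <= j)%N -> (j < q)%N -> (nth 0 s i <= nth 0 s j)%N.
  move=> ij jq; apply: (sorted_leq_nth leq_trans leqnn) => //.
  by rewrite inE (leq_ltn_trans ij).
have ktE : (k + t = nth 0 s m)%N by rewrite /t subnKC// mono// leq_pred.
have nE : n = nth 0%N s q.-1 by rewrite /n nth_last.
have k0 : (0 < k)%N by apply: (allP spos); rewrite mem_nth// (leq_ltn_trans (leq_pred _)).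
have q0N : (0 < q)%N by exact: ltn_trans q2.
have hm : (m <= q.-1)%N by rewrite -ltnS (prednK q0N).
have hq : (q.-1 < q)%N by rewrite (prednK q0N).
have ktn : (k + t <= n)%N by rewrite ktE nE mono.
pose a := v t `^ (1 - 2 / theta)^-1.
have th1 : 0 < 1 - 2 / theta by rewrite subr_gt0 ltr_pdivrMr// mul1r.
have a0 : 0 < a by rewrite powR_gt0.
have a1 : a <= 1.
  by rewrite -(powRr0 (v t)) ger_powR ?v_gt0 ?v_le1// invr_ge0 ltW.
have m0' : 0 < m%:R :> R by rewrite ltr0n.
have qm0 : 0 < (q - m)%:R :> R by rewrite ltr0n subn_gt0.
have q0 : 0 < q%:R :> R by rewrite ltr0n.
pose p1 := q%:R * (theta / 2) / m%:R; pose p2 := q%:R * (theta / 2) / (q - m)%:R.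
have p10 : 0 < p1 by rewrite !divr_gt0// mulr_gt0// divr_gt0.
have p20 : 0 < p2 by rewrite !divr_gt0// mulr_gt0// divr_gt0.
have pE : p1^-1 + p2^-1 = 2 / theta.
  rewrite /p1 /p2 !invf_div -mulrDl -natrD subnKC ?(ltnW ms)//.
  by rewrite invfM mulrA mulfV ?gt_eqF// mul1r invf_div.
have size1 : size (take m s) = m by rewrite size_takel// ltnW.
have size2 : size (drop m s) = (q - m)%N by rewrite size_drop.
have pos1 : all (fun i => 0 < i)%N (take m s) by apply/allP => i /mem_take; exact: (allP spos).
have pos2 : all (fun i => 0 < i)%N (drop m s) by apply/allP => i /mem_drop; exact: (allP spos).
have qM0 : 0 < q%:R * M by rewrite mulr_gt0.
have := @cov_mixing _ _ _ P _ _ a p1 p2 (q%:R * M)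
  (fun w => \prod_(i <- take m s) xi i w) (fun w => \prod_(i <- drop m s) xi i w)
  (@sigma_sub [set j | (1 <= j <= k)%N]) (@sigma_sub [set j | (k + t <= j <= n)%N]).
case=> //.
- by move=> A B; exact: mixing.
- by rewrite pE ler_pdivrMr// mul1r ltW.
- apply: measurable_prod_seq => i /(nthP 0%N)[j]; rewrite size1 => jm <-.
  rewrite nth_take//; apply: measurableT_comp => //; apply: sigma_gen_measurable => /=.
  have jm1 : (j <= m.-1)%N by rewrite -ltnS (prednK m0).
  have m1q : (m.-1 < q)%N by exact: leq_ltn_trans (leq_pred _) ms.
  by rewrite (allP spos) ?mem_nth ?(ltn_trans jm)//= /k mono.
- apply: measurable_prod_seq => i /(nthP 0%N)[j]; rewrite size2 => jm <-.
  rewrite nth_drop//; apply: measurableT_comp => //; apply: sigma_gen_measurable => /=.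
  have mjq : (m + j < q)%N by rewrite -ltn_subRL.
  have mjq1 : (m + j <= q.-1)%N by rewrite -ltnS (prednK q0N).
  by rewrite ktE nE !mono ?leq_addr.
- apply: le_trans (@moment_prod p1 q _ (ltW p10) _ sQ _ pos1) _; rewrite ?size1//.
    by rewrite /p1 mulfVK// gt_eqF.
  by rewrite lee_fin ler_wpM2r ?(ltW M_gt0)// ler_nat ltnW.
- apply: le_trans (@moment_prod p2 q _ (ltW p20) _ sQ _ pos2) _; rewrite ?size2//.
  + by rewrite subn_gt0.
  + by rewrite /p2 mulfVK// gt_eqF.
  + by rewrite lee_fin ler_wpM2r ?(ltW M_gt0)// ler_nat leq_subr.
move=> _ _ _; rewrite /cov pE => hc.
have aE : a * (q%:R * M / a) `^ (2 / theta) = (q%:R * M) `^ (2 / theta) * v t.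
  rewrite powRM ?invr_ge0 ?(ltW a0) ?(ltW qM0)// -(powR_inv1 (ltW a0)) -powRrM mulN1r.
  rewrite mulrCA; congr (_ * _).
  rewrite -{1}(powRr1 (ltW a0)) -powRD; last by rewrite (gt_eqF a0) implybT.
  by rewrite /a -powRrM mulVf ?gt_eqF// powRr1// ltW.
have prodE w : \prod_(i <- s) xi i w =
    (\prod_(i <- take m s) xi i w) * (\prod_(i <- drop m s) xi i w).
  by rewrite -big_cat cat_take_drop.
have -> : F s = `|\int[P]_w ((\prod_(i <- take m s) xi i w) * (\prod_(i <- drop m s) xi i w))|.
  by congr (`| _ |); apply: eq_Rintegral => w _; exact: prodE.
rewrite /F -normrM -lerBlDl (le_trans (lerB_dist _ _))// (le_trans hc)// aE.
rewrite -!mulrA ler_wpM2l// mulrA ler_wpM2r ?(ltW (v_gt0 _))//.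
rewrite powRM ?(ltW M_gt0)// ler_wpM2r ?powR_ge0//.
rewrite (@le_trans _ _ q%:R) ?ler_nat//.
by rewrite ler1_powR ?ler1n ?(ltn_trans _ q2)// ler_pdivrMr// mul1r ltW.
Qed.

Let integ_isum a b k (G : seq nat -> T -> R) :
  (forall s, size s = k -> all (fun i => a <= i < b)%N s -> integ (G s)) ->
  integ (fun w => isum a b k (G^~ w)) /\
  \int[P]_w isum a b k (G^~ w) = isum a b k (fun s => \int[P]_w G s w).
Proof.
elim: k G => [|k IH] G iG; first by split; [exact: iG|].
pose G' i w := if (a <= i < b)%N then isum a b k (fun s => G (i :: s) w) else 0.
have GE w : isum a b k.+1 (G^~ w) = \sum_(a <= i < b) G' i w.
  by rewrite /= big_nat [RHS]big_nat; apply: eq_bigr => i ab; rewrite /G' ab.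
have iG' i : integ (G' i).
  rewrite /G'; case: (boolP (a <= i < b)%N) => ab; last exact: integ_cst.
  by case: (IH (fun s => G (i :: s))) => // s sk sab; apply: iG => /=; rewrite ?sk// ab.
split.
  rewrite (_ : (fun w => _) = (fun w => \sum_(a <= i < b) G' i w)); last exact/funext.
  exact: integ_sum.
under eq_Rintegral => w _ do rewrite GE.
rewrite Rintegral_sum// /= big_nat [RHS]big_nat; apply: eq_bigr => i ab.
rewrite /G' ab; case: (IH (fun s => G (i :: s))) => // s sk sab.
by apply: iG => /=; rewrite ?sk// ab.
Qed.

Lemma moment_sum_isum p n : (0 < p)%N ->
  integ (fun w => (\sum_(p <= i < p + n) xi i w) ^+ Q) /\
  \int[P]_w ((\sum_(p <= i < p + n) xi i w) ^+ Q) <=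
  Q`!%:R * isum 0 n Q (fun g => F (scanl addn p g)).
Proof.
move=> p0.
have := @integ_isum p (p + n)%N Q (fun s w => \prod_(i <- s) xi i w).
case=> [s sk sab|i1 e1].
  apply: integ_prod; last by rewrite sk.
  by apply: sub_all sab => i /andP[pi _]; exact: leq_trans pi.
have SE w : (\sum_(p <= i < p + n) xi i w) ^+ Q =
    isum p (p + n) Q (fun s => \prod_(i <- s) xi i w) by exact: exprn_isum.
split.
  by rewrite (_ : (fun w => _) = (fun w => isum p (p + n) Q (fun s => \prod_(i <- s) xi i w))); last exact/funext.
under eq_Rintegral => w _ do rewrite SE.
rewrite e1 (le_trans (ler_norm _))// (le_trans (ler_norm_isum _ _ _ _))//.
apply: isum_le_gaps => //.
move=> s t st; rewrite /F; congr (`| _ |); apply: eq_Rintegral => w _.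
exact: perm_big.
Qed.

(** The long hypothesis is the conclusion of [gap_sum_bound], taken as an argument so that [K] is
    fixed before [h] and [M]. *)
Lemma moment_sum_le K p n : (0 < p)%N ->
  (forall (F : seq nat -> R) n (y c : R), (forall s, 0 <= F s) -> 0 <= y -> 0 <= c ->
  n%:R * c <= 24 * Q%:R * y ^+ 2 -> (forall i, (0 < i)%N -> F [:: i] = 0) ->
  (forall s m, sorted leq s -> all (fun i => 0 < i)%N s ->
     (2 <= size s <= Q)%N -> (0 < m < size s)%N ->
     F s <= F (take m s) * F (drop m s) + c * v (nth 0 s m - nth 0 s m.-1)%N) ->
  forall k p, (0 < k <= Q)%N -> (0 < p)%N ->
  isum 0 n k (fun g => F (scanl addn p g)) <=
  (k != 1)%N%:R * (K * (y ^+ 2 + y ^+ k))) ->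
  \int[P]_w ((\sum_(p <= i < p + n) xi i w) ^+ Q) <=
  Q`!%:R * (K * (n%:R * M `^ (2 / theta) + (Num.sqrt (n%:R * M `^ (2 / theta))) ^+ Q)).
Proof.
move=> p0 HK; have [_ h1] := moment_sum_isum n p0.
apply: (le_trans h1); rewrite ler_wpM2l//.
have nM0 : 0 <= n%:R * M `^ (2 / theta) by rewrite mulr_ge0// powR_ge0.
(* This makes n c = 24 Q y^2 for the constant c of [F_split]. *)
pose y := Num.sqrt (n%:R * M `^ (2 / theta)).
have y2 : y ^+ 2 = n%:R * M `^ (2 / theta) by rewrite sqr_sqrtr.
have Q1 : Q != 1%N by rewrite neq_ltn orbC Q_ge2.
have := HK F n y (24 * Q%:R * M `^ (2 / theta)).
rewrite y2 => /(_ _ _ _ _ _ F_split Q p); rewrite Q1 mul1r; apply => //.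
- by move=> s; exact: normr_ge0.
- exact: sqrtr_ge0.
- by rewrite !mulr_ge0// powR_ge0.
- by rewrite mulrCA.
- move=> i i0; rewrite /F (_ : \int[P]_w _ = 0) ?normr0//.
  by rewrite -[RHS](centered i0); apply: eq_Rintegral => w _; rewrite big_seq1.
- by rewrite leqnn andbT (ltn_trans _ Q_ge2).
Qed.

End one_sequence.

Lemma moment_sum_bound : exists2 K : R, 0 <= K & forall (h : nat -> E -> R) (M : R),
  (forall i, measurable_fun setT (h i)) -> 0 < M ->
  (forall i q, (0 < i)%N -> (2 <= q <= Q)%N ->
    (\int[P]_w (`|h i (Y i w)| `^ (q%:R * (theta / 2)))%:E <= M%:E)%E) ->
  (forall i, (0 < i)%N -> \int[P]_w h i (Y i w) = 0) ->
  forall p n, (0 < p)%N ->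
  (\int[P]_w (`|\sum_(p <= i < p + n) h i (Y i w)| ^+ Q)%:E <=
   (K * (n%:R * M `^ (2 / theta) + Num.sqrt (n%:R * M `^ (2 / theta)) ^+ Q))%:E)%E.
Proof.
have C0 : 0 <= 24 * Q%:R :> R by rewrite mulr_ge0.
have [K K0 HK] := gap_sum_bound (fun r => ltW (v_gt0 r)) C0 v_sum (leqnn Q).
exists (Q`!%:R * K); first by rewrite mulr_ge0.
move=> h M mh M0 momh ch p n p0.
have [i1 _] := moment_sum_isum mh momh n p0.
under eq_integral => w _.
  rewrite -normrX ger0_norm; last by rewrite exprn_even_ge0.
over.
rewrite -EFin_Rintegral// lee_fin -mulrA; exact: moment_sum_le.
Qed.

End moment_inequality.

Section maximal_inequality.
Context {R : realType} {d : measure_display} {T : measurableType d}.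
Variable P : probability T R.

(** Compare [u] with [dl * v]. The factor of v^Q can be brought as near to 1 as desired, whereas the
    factor 2^(Q-1) of convexity would accumulate over the dyadic recursion. *)
Lemma exprD_le_mix (Q : nat) (dl u v : R) : 0 < dl -> 0 <= u -> 0 <= v ->
  (u + v) ^+ Q <= (1 + dl^-1) ^+ Q * u ^+ Q + (1 + dl) ^+ Q * v ^+ Q.
Proof.
move=> d0 u0 v0; have di0 : 0 < dl^-1 by rewrite invr_gt0.
have e0 : 0 <= 1 + dl^-1 by rewrite addr_ge0 ?(ltW di0).
have f0 : 0 <= 1 + dl by rewrite addr_ge0 ?(ltW d0).
have [udv|dvu] := leP u (dl * v).
  rewrite -[leLHS]add0r lerD ?mulr_ge0 ?exprn_ge0//.
  rewrite -exprMn lerXn2r ?nnegrE ?addr_ge0 ?mulr_ge0//.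
  by rewrite mulrDl mul1r addrC lerD2l.
rewrite -[leLHS]addr0 lerD ?mulr_ge0 ?exprn_ge0//.
rewrite -exprMn lerXn2r ?nnegrE ?addr_ge0 ?mulr_ge0//.
rewrite mulrDl mul1r lerD2l mulrC ler_pdivlMr// mulrC; exact: ltW.
Qed.

Variables (Q : nat) (kap : R).
Hypothesis Q_ge4 : (4 <= Q)%N.
Hypothesis kap01 : 0 < kap < 1.
(** Growth allowed to the linear term at each doubling: more than the factor 2 (1 + dl)^Q that the
    recursion produces, but less than 4, by which the term of order Q/2 grows at least. *)
Let B : R := 2 * 2 `^ kap.

Let S (x : nat -> T -> R) p k w := \sum_(p <= i < p + k) x i w.

Lemma sqrt2_expr_ge4 : 4 <= Num.sqrt (2 : R) ^+ Q.
Proof.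
have s1 : 1 <= Num.sqrt (2 : R) by rewrite -[leLHS]sqrtr1 ler_sqrt; lra.
rewrite (@le_trans _ _ (Num.sqrt (2 : R) ^+ 4))//; last by rewrite ler_weXn2l.
by rewrite -[4%N]/(2 * 2)%N exprM sqr_sqrtr//; lra.
Qed.

Let B_lt4 : 2 < B < 4.
Proof.
have /andP[k0 k1] := kap01; rewrite /B.
have : 2 `^ kap < (2 : R) `^ 1.
  by rewrite /powR gt_eqF// ltr_expR ltr_pM2r// ln_gt0//; lra.
have : (2 : R) `^ 0 < 2 `^ kap.
  by rewrite /powR gt_eqF// ltr_expR ltr_pM2r// ln_gt0//; lra.
rewrite powRr0 powRr1//; lra.
Qed.

(** A partial sum over a block of length 2^(r+1) lies in the first half, or is the whole first half
    plus a partial sum of the second. So the maximum is at most the sum of the first half plus the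
    larger of the maxima of the two halves. *)
Lemma dyadic_maximal (K : R) : 0 <= K -> exists2 K', 0 <= K' &
  forall (x : nat -> T -> R) (t : R), (forall i, measurable_fun setT (x i)) -> 0 <= t ->
  (forall p n, (0 < p)%N ->
    (\int[P]_w (`|S x p n w| ^+ Q)%:E <=
      (K * (n%:R * t + Num.sqrt (n%:R * t) ^+ Q))%:E)%E) ->
  forall r p, (0 < p)%N -> exists Mf : T -> R, [/\ measurable_fun setT Mf,
    (forall w, 0 <= Mf w), (forall k w, (k <= 2 ^ r)%N -> `|S x p k w| <= Mf w) &
    (\int[P]_w (Mf w ^+ Q)%:E <= (K' * (B ^+ r * t + Num.sqrt (2 ^+ r * t) ^+ Q))%:E)%E].
Proof.
move=> K0; have /andP[k0 k1] := kap01; have /andP[B2 B4] := B_lt4.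
have Qpos : (0 < Q)%N by exact: leq_trans Q_ge4.
have Q0 : (Q%:R : R) != 0 by rewrite pnatr_eq0 -lt0n.
(* Then (1 + dl)^Q = 2^(kap/2), so that 2 (1 + dl)^Q stays strictly below [B]. *)
pose dl : R := 2 `^ (kap / 2 / Q%:R) - 1.
have d0 : 0 < dl.
  rewrite subr_gt0 -[ltLHS](powRr0 2) /powR gt_eqF// ltr_expR ltr_pM2r ?ln_gt0 ?ltr1n//.
  by rewrite !divr_gt0// ltr0n.
have beta : (1 + dl) ^+ Q = 2 `^ (kap / 2).
  rewrite /dl addrC subrK -powR_mulrn ?powR_ge0// -powRrM mulfVK//.
have beta0 : 0 <= (1 + dl) ^+ Q by rewrite beta powR_ge0.
have gap0 : 0 < B - 2 * (1 + dl) ^+ Q.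
  rewrite beta /B subr_gt0 ltr_pM2l//.
  by rewrite /powR gt_eqF// ltr_expR ltr_pM2r ?ln_gt0 ?ltr1n//; lra.
pose A := (1 + dl^-1) ^+ Q.
have A0 : 0 <= A by rewrite exprn_ge0// addr_ge0// invr_ge0 ltW.
(* The first summand settles r = 0; the second gives A K <= K' (B - 2 (1 + dl)^Q), which is the
   induction step. *)
exists (K + A * K / (B - 2 * (1 + dl) ^+ Q)).
  by rewrite addr_ge0// divr_ge0 ?mulr_ge0 ?(ltW gap0)//.
set K' := K + _ => x t mx t0 hx; have K'0 : 0 <= K'.
  by rewrite addr_ge0// divr_ge0 ?mulr_ge0 ?(ltW gap0)//.
have mS p k : measurable_fun setT (S x p k) by apply: measurable_sum.
have mX (f : T -> R) : measurable_fun setT f -> measurable_fun setT (fun w => (f w ^+ Q)%:E).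
  by move=> mf; apply/measurable_EFinP; exact: measurable_funX.
have mN (f : T -> R) : measurable_fun setT f -> measurable_fun setT (fun w => `|f w|).
  by move=> mf; exact: measurableT_comp.
elim=> [|r IH] p p0.
  exists (fun w => `|S x p 1 w|); split => //.
  - exact: mN.
  - case=> [|[|//]] w _; last by [].
    by rewrite /S addn0 big_geq// normr0.
  - apply: (le_trans (hx p 1%N p0)).
    rewrite lee_fin !expr0 !mul1r ler_wpM2r ?addr_ge0 ?exprn_ge0 ?sqrtr_ge0//.
    by rewrite lerDl divr_ge0 ?mulr_ge0 ?(ltW gap0)//.
have [M1 [mM1 M10 M1S EM1]] := IH p p0.
have [M2 [mM2 M20 M2S EM2]] := IH (p + 2 ^ r)%N (ltn_addr _ p0).
pose M12 w := Num.max (M1 w) (M2 w).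
have mM12 : measurable_fun setT M12 by exact: measurable_maxr.
have M120 w : 0 <= M12 w by rewrite le_max M10.
exists (fun w => `|S x p (2 ^ r) w| + M12 w); split.
- by apply: measurable_funD => //; exact: mN.
- by move=> w; rewrite addr_ge0.
- move=> k w k2; have [kr|rk] := leqP k (2 ^ r).
    by rewrite -[leLHS]add0r lerD// le_max M1S.
  have -> : S x p k w = S x p (2 ^ r) w + S x (p + 2 ^ r) (k - 2 ^ r) w.
    rewrite /S (@big_cat_nat _ _ _ (p + 2 ^ r))/= ?leq_addr ?leq_add2l ?(ltnW rk)//.
    by rewrite -addnA subnKC ?(ltnW rk).
  rewrite (le_trans (ler_normD _ _))// lerD2l le_max M2S ?orbT//.
  by rewrite leq_subLR addnn -mul2n -expnS.
apply: (@le_trans _ _ (\int[P]_w ((A * `|S x p (2 ^ r) w| ^+ Q)%:E +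
   ((1 + dl) ^+ Q * M1 w ^+ Q + (1 + dl) ^+ Q * M2 w ^+ Q)%:E))%E).
  apply: ge0_le_integral => //.
  - by move=> w _; rewrite lee_fin exprn_ge0// addr_ge0.
  - by apply: mX; apply: measurable_funD => //; exact: mN.
  - apply: emeasurable_funD; apply/measurable_EFinP.
      by apply: measurable_funM => //; apply: measurable_funX; exact: mN.
    by apply: measurable_funD; apply: measurable_funM => //; exact: measurable_funX.
  - move=> w _; rewrite -EFinD lee_fin (le_trans (exprD_le_mix Q d0 _ _))// lerD2l -mulrDr.
    rewrite ler_wpM2l// /M12; case: (leP (M1 w) (M2 w)) => _.
      by rewrite lerDr exprn_ge0.
    by rewrite lerDl exprn_ge0.
have mXc c (f : T -> R) : measurable_fun setT f -> measurable_fun setT (fun w => (c * f w ^+ Q)%:E).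
  by move=> mf; apply/measurable_EFinP; apply: measurable_funM => //; exact: measurable_funX.
have Xc0 c (f : T -> R) : 0 <= c -> (forall w, 0 <= f w) -> forall w, setT w -> (0 <= (c * f w ^+ Q)%:E)%E.
  by move=> c0 f0 w _; rewrite lee_fin mulr_ge0// exprn_ge0.
under eq_integral do rewrite EFinD.
rewrite ge0_integralD//; last 4 first.
- by apply: Xc0 => // w.
- by apply: mXc; exact: mN.
- by move=> w _; rewrite -EFinD lee_fin addr_ge0// mulr_ge0// exprn_ge0.
- by apply: emeasurable_funD; exact: mXc.
rewrite ge0_integralD//; last 4 first.
- by apply: Xc0.
- exact: mXc.
- by apply: Xc0.
- exact: mXc.
have IZ c (f : T -> R) (b : R) : 0 <= c -> measurable_fun setT f -> (forall w, 0 <= f w) ->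
    (\int[P]_w (f w ^+ Q)%:E <= b%:E)%E -> (\int[P]_w (c * f w ^+ Q)%:E <= (c * b)%:E)%E.
  move=> c0 mf f0 fb; under eq_integral do rewrite EFinM.
  rewrite ge0_integralZl//; last 2 first.
  - exact: mX.
  - by move=> w _; rewrite lee_fin exprn_ge0.
  by rewrite EFinM lee_wpmul2l.
have H1 := IZ A _ _ A0 (mN _ (mS p (2 ^ r)%N)) (fun w => normr_ge0 _) (hx p (2 ^ r)%N p0).
have H2 := IZ _ _ _ beta0 mM1 M10 EM1.
have H3 := IZ _ _ _ beta0 mM2 M20 EM2.
apply: (le_trans (leeD H1 (leeD H2 H3))).
rewrite -!EFinD lee_fin natrX.
set z := Num.sqrt (2 ^+ r * t) ^+ Q.
have z0 : 0 <= z by rewrite exprn_ge0// sqrtr_ge0.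
have zS : 4 * z <= Num.sqrt (2 ^+ r.+1 * t) ^+ Q.
  rewrite exprS -mulrA sqrtrM// exprMn ler_wpM2r//; exact: sqrt2_expr_ge4.
have B2r : 2 ^+ r * t <= B ^+ r * t.
  by rewrite ler_wpM2r// lerXn2r ?nnegrE ?(ltW B2)// ltW// (lt_trans _ B2).
have Br0 : 0 <= B ^+ r * t by rewrite mulr_ge0// exprn_ge0// ltW// (lt_trans _ B2).
have AK : A * K <= K' * (B - 2 * (1 + dl) ^+ Q).
  rewrite /K' mulrDl mulfVK ?gt_eqF// lerDr mulr_ge0// ltW//.
rewrite [B ^+ r.+1]exprS -[B * _ * _]mulrA.
move: B2r Br0 AK zS z0 B4 gap0 K'0 K0 A0 beta0.
set u := B ^+ r * t; set a := 2 ^+ r * t; set b := (1 + dl) ^+ Q; set z' := Num.sqrt _ ^+ Q.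
move=> h1 h2 h3 h4 h5 h6 h7 h8 h9 h10 h11.
have e1 : A * (K * (a + z)) <= K' * (B - 2 * b) * (u + z).
  rewrite mulrA ler_pM ?mulr_ge0 ?addr_ge0 ?lerD// mulr_ge0// exprn_ge0//.
have e2 : K' * (4 * z) <= K' * z' by rewrite ler_wpM2l.
have e3 : 0 <= K' * (4 - B) * z by rewrite !mulr_ge0// subr_ge0 ltW.
lra.
Qed.

(** With 2^r between n and 2n, the linear term is of order n^kap (n t), hence at most (n t)^2 by
    hypothesis, and this is at most the term of order Q/2 because n t >= 1 and Q >= 4. *)
Lemma maximal_partial_sum (K : R) : 0 <= K -> exists2 K', 0 <= K' &
  forall (x : nat -> T -> R) (t : R), (forall i, measurable_fun setT (x i)) -> 0 <= t ->
  (forall p n, (0 < p)%N ->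
    (\int[P]_w (`|S x p n w| ^+ Q)%:E <=
      (K * (n%:R * t + Num.sqrt (n%:R * t) ^+ Q))%:E)%E) ->
  forall n p, (0 < p)%N -> (0 < n)%N -> n%:R `^ kap <= n%:R * t ->
  exists Mf : T -> R, [/\ measurable_fun setT Mf,
    (forall w, 0 <= Mf w), (forall k w, (k <= n)%N -> `|S x p k w| <= Mf w) &
    (\int[P]_w (Mf w ^+ Q)%:E <= (K' * Num.sqrt (n%:R * t) ^+ Q)%:E)%E].
Proof.
move=> K0; have [K' K'0 HK] := dyadic_maximal K0.
have /andP[k0 k1] := kap01; have /andP[B2 B4] := B_lt4.
exists (K' * (4 + Num.sqrt 2 ^+ Q)).
  by rewrite mulr_ge0// addr_ge0// exprn_ge0// sqrtr_ge0.
move=> x t mx t0 hx n p p0 n0 nt.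
pose r := up_log 2 n.
have [Mf [mM M0 MS EM]] := HK x t mx t0 hx r p p0.
have nr : (n <= 2 ^ r)%N by exact: up_logP.
have rn : (2 ^ r <= 2 * n)%N.
  have [n1|n1] := leqP n 1.
    have n1e : n = 1%N by apply/eqP; rewrite eqn_leq n1.
    by rewrite /r n1e up_log1.
  have := up_log_bounds (isT : 1 < 2)%N n1; rewrite -/r => /andP[h _].
  have r0 : (0 < r)%N by rewrite up_log_gt0 n1.
  by rewrite -(prednK r0) expnS leq_mul2l/= ltnW.
exists Mf; split => //.
  by move=> k w kn; apply: MS; exact: leq_trans nr.
apply: (le_trans EM); rewrite lee_fin -mulrA ler_wpM2l// mulrDl.
have nR : 1 <= n%:R :> R by rewrite ler1n.
have n0R : 0 <= n%:R :> R by exact: le_trans nR.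
have nk1 : 1 <= n%:R `^ kap :> R by rewrite -[leLHS](powRr0 (n%:R : R)) ler_powR// ltW.
have rnR : 2 ^+ r <= 2 * n%:R :> R by rewrite -natrX -natrM ler_nat.
apply: lerD; last first.
  rewrite -exprMn -sqrtrM// lerXn2r ?nnegrE ?sqrtr_ge0// ler_sqrt; last by rewrite !mulr_ge0.
  by rewrite mulrA ler_wpM2r.
have nt1 : 1 <= n%:R * t by exact: le_trans nt.
have y1 : 1 <= Num.sqrt (n%:R * t) by rewrite -[leLHS]sqrtr1 ler_sqrt// (le_trans ler01).
have y4 : (n%:R * t) ^+ 2 <= Num.sqrt (n%:R * t) ^+ Q.
  rewrite (@le_trans _ _ (Num.sqrt (n%:R * t) ^+ 4))//; last by rewrite ler_weXn2l.
  by rewrite -[4%N]/(2 * 2)%N exprM sqr_sqrtr// (le_trans ler01).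
have BE : B ^+ r <= 4 * (n%:R * n%:R `^ kap).
  rewrite /B exprMn.
  have -> : (2 `^ kap) ^+ r = (2 ^+ r) `^ kap :> R.
    by rewrite -powR_mulrn ?powR_ge0// powRAC powR_mulrn.
  have -> : 4 * (n%:R * n%:R `^ kap) = (2 * n%:R) * (2 * n%:R `^ kap) :> R by ring.
  rewrite ler_pM ?exprn_ge0 ?powR_ge0//.
  rewrite (@le_trans _ _ ((2 * n%:R) `^ kap))//.
    by rewrite ge0_ler_powR ?nnegrE ?mulr_ge0 ?exprn_ge0// ltW.
  rewrite powRM// ler_wpM2r ?powR_ge0//.
  by rewrite ler1_powR ?ler1n// ltW.
apply: (@le_trans _ _ (4 * (n%:R * t) ^+ 2)); last by rewrite ler_wpM2l.
apply: (@le_trans _ _ (4 * (n%:R * n%:R `^ kap) * t)); first by rewrite ler_wpM2r.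
have -> : 4 * (n%:R * n%:R `^ kap) * t = 4 * (n%:R `^ kap * (n%:R * t)) by ring.
by rewrite ler_wpM2l// expr2 ler_wpM2r// (le_trans ler01).
Qed.

End maximal_inequality.

Section elementary.
Context {R : realType} {d : measure_display} {T : measurableType d}.
Variable P : probability T R.
Local Notation integ f := (P.-integrable setT (EFin \o f)).

Lemma measurable_norm_powR (f : T -> R) p : measurable_fun setT f ->
  measurable_fun setT (fun w => `|f w| `^ p).
Proof.
move=> mf; apply: measurableT_comp (measurable_powR p) _.
exact: measurableT_comp.
Qed.

Lemma integral_cstT (c : R) : (\int[P]_w c%:E)%E = c%:E.
Proof. by rewrite -(EFin_Rintegral (integ_cst P c)) Rintegral_cstT. Qed.

(** Split at y = s. Integrated with [s ^ p] bounding the p-th moment, it bounds the mean by 2 s,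
    which serves in place of Jensen's inequality. *)
Lemma le_young (s y p : R) : 0 < s -> 0 <= y -> 1 <= p ->
  y <= s + y `^ p * s `^ (1 - p).
Proof.
move=> s0 y0 p1; have [ys|sy] := leP y s.
  by rewrite -[leLHS]addr0 lerD// mulr_ge0 ?powR_ge0.
rewrite -[leLHS]add0r lerD ?(ltW s0)//.
have y1 : 0 < y by exact: lt_trans sy.
have -> : y `^ p = y * y `^ (p - 1) by rewrite mulr_powRB1// (lt_le_trans ltr01).
rewrite -mulrA ler_peMr// -[1 - p]opprB powRN.
rewrite ler_pdivlMr ?powR_gt0// mul1r ge0_ler_powR ?nnegrE ?subr_ge0// ltW//.
Qed.

Lemma moment_le_integ (f : T -> R) p M : 1 <= p -> measurable_fun setT f ->
  (\int[P]_w (`|f w| `^ p)%:E <= M%:E)%E -> integ f.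
Proof.
move=> p1 mf fM.
have ip : integ (fun w => `|f w| `^ p).
  by apply: ge0_integ fM => //; exact: measurable_norm_powR.
apply: (@integ_le _ _ _ P _ (fun w => 1 + `|f w| `^ p)) => //.
  by apply: integD => //; exact: integ_cst.
move=> w; have := @le_young 1 `|f w| p ltr01 (normr_ge0 _) p1.
by rewrite powR1 mulr1.
Qed.

Lemma moment_le_mean (f : T -> R) p s : 1 <= p -> 0 < s -> measurable_fun setT f ->
  (\int[P]_w (`|f w| `^ p)%:E <= (s `^ p)%:E)%E ->
  `|\int[P]_w f w| <= 2 * s.
Proof.
move=> p1 s0 mf fM; have fi := moment_le_integ p1 mf fM.
have ip : integ (fun w => `|f w| `^ p).
  by apply: ge0_integ fM => //; exact: measurable_norm_powR.
have fM' := Rintegral_le_EFin ip fM.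
have ic := integ_cst P s.
have iZ := integZ (s `^ (1 - p)) ip.
apply: (@le_trans _ _ (\int[P]_w (s + s `^ (1 - p) * `|f w| `^ p))).
  apply: ler_norm_Rintegral => //; first exact: integD.
  by move=> w; rewrite mulrC; exact: le_young.
rewrite RintegralD// Rintegral_cstT RintegralZl// mulr2n mulrDl mul1r lerD2l.
apply: (@le_trans _ _ (s `^ (1 - p) * s `^ p)); first by rewrite ler_wpM2l ?powR_ge0.
rewrite -powRD; last by rewrite (gt_eqF s0) implybT.
by rewrite subrK powRr1// ltW.
Qed.

Lemma powR_normB_le (u m p : R) : 0 <= p ->
  `|u - m| `^ p <= 2 `^ p * (`|u| `^ p + `|m| `^ p).
Proof.
move=> p0; apply: (@le_trans _ _ ((2 * Num.max `|u| `|m|) `^ p)).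
  rewrite ge0_ler_powR ?nnegrE ?mulr_ge0 ?le_max ?normr_ge0//.
  rewrite (le_trans (ler_normB _ _))// mulr2n mulrDl mul1r.
  by rewrite lerD// le_max lexx ?orbT.
rewrite powRM ?le_max ?normr_ge0// ler_wpM2l ?powR_ge0//.
case: (leP `|u| `|m|) => _; first by rewrite lerDr powR_ge0.
by rewrite lerDl powR_ge0.
Qed.

Lemma centered_moment (f : T -> R) p s : 1 <= p -> 0 < s -> measurable_fun setT f ->
  (\int[P]_w (`|f w| `^ p)%:E <= (s `^ p)%:E)%E ->
  (\int[P]_w (`|f w - \int[P]_w f w| `^ p)%:E <= (2 * 4 `^ p * s `^ p)%:E)%E.
Proof.
move=> p1 s0 mf fM; set m := \int[P]_w f w.
have p0 : 0 <= p by exact: le_trans p1.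
have hm : `|m| <= 2 * s by exact: moment_le_mean fM.
have c0 : 0 <= 2 `^ p * `|m| `^ p by rewrite mulr_ge0 ?powR_ge0.
apply: (@le_trans _ _ (\int[P]_w ((2 `^ p)%:E * (`|f w| `^ p)%:E + (2 `^ p * `|m| `^ p)%:E))%E).
  apply: ge0_le_integral => //.
  - by apply/measurable_EFinP; apply: measurable_norm_powR; exact: measurable_funB.
  - apply: emeasurable_funD => //; apply: measurable_funeM; apply/measurable_EFinP.
    exact: measurable_norm_powR.
  - by move=> w _; rewrite -EFinM -EFinD lee_fin -mulrDr powR_normB_le.
have mfp : measurable_fun setT (fun w => (`|f w| `^ p)%:E).
  by apply/measurable_EFinP; exact: measurable_norm_powR.
have f0 w : setT w -> (0 <= (`|f w| `^ p)%:E)%E by move=> _; rewrite lee_fin powR_ge0.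
have a0 : (0 <= (2 `^ p : R)%:E)%E by rewrite lee_fin powR_ge0.
rewrite ge0_integralD//; last exact: measurable_funeM.
rewrite integral_cstT ge0_integralZl//.
apply: (@le_trans _ _ ((2 `^ p)%:E * (s `^ p)%:E + (2 `^ p * `|m| `^ p)%:E)%E).
  by rewrite leeD2r// lee_wpmul2l// lee_fin powR_ge0.
rewrite -EFinM -EFinD lee_fin.
have h4 : 4 `^ p = 2 `^ p * 2 `^ p :> R.
  by rewrite -powRM//; congr (_ `^ _); lra.
have h2 : 1 <= 2 `^ p :> R by rewrite -[leLHS](powRr0 (2 : R)) ler_powR//; lra.
have h3 : `|m| `^ p <= 2 `^ p * s `^ p.
  by rewrite -powRM// ?(ltW s0)// ge0_ler_powR ?nnegrE// mulr_ge0// ltW.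
have h5 : 0 <= s `^ p by exact: powR_ge0.
rewrite h4; move: h2 h3 h5; set a := 2 `^ p; set b := s `^ p; set c := `|m| `^ p.
move=> h2 h3 h5; have : a * c <= a * (a * b) by rewrite ler_wpM2l//; lra.
have : a * b <= a * (a * b) by rewrite ler_wpM2l ?ler_peMl//; lra.
lra.
Qed.

(** Since y <= lam + y^Q / lam^(Q-1), the maximum is at most lam plus the sum of the Q-th powers
    over lam^(Q-1); lam = c |J|^(1/Q) balances the two means. *)
Lemma finite_max_bound (J : finType) (Q : nat) (c : R) (Y : J -> T -> R) :
  (0 < Q)%N -> 0 < c -> (forall j, measurable_fun setT (Y j)) ->
  (forall j w, 0 <= Y j w) ->
  (forall j, (\int[P]_w (Y j w ^+ Q)%:E <= (c ^+ Q)%:E)%E) ->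
  exists U : T -> R, [/\ measurable_fun setT U, forall w, 0 <= U w,
    forall j w, Y j w <= U w &
    (\int[P]_w (U w)%:E <= (2 * c * #|J|%:R `^ Q%:R^-1)%:E)%E].
Proof.
move=> Q0 c0 mY Y0 EY.
have [J0|J0] := posnP #|J|.
  exists (fun=> 0); split => //; last first.
    by rewrite integral0 lee_fin mulr_ge0 ?powR_ge0// mulr_ge0// ltW.
  by move=> j; have := max_card (pred1 j); rewrite card1 J0.
have N0 : 0 < #|J|%:R :> R by rewrite ltr0n.
pose lam := c * #|J|%:R `^ Q%:R^-1.
have lam0 : 0 < lam by rewrite mulr_gt0// powR_gt0.
have lamQ : lam ^+ Q = c ^+ Q * #|J|%:R.
  rewrite exprMn -[X in _ * X]powR_mulrn ?powR_ge0// -powRrM mulVf ?powRr1//.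
  by rewrite pnatr_eq0 -lt0n.
have lm0 : 0 <= (lam ^+ Q.-1)^-1 by rewrite invr_ge0 exprn_ge0// ltW.
pose U w := lam + (lam ^+ Q.-1)^-1 * \sum_j Y j w ^+ Q.
have mS : measurable_fun setT (fun w => \sum_j Y j w ^+ Q).
  by apply: measurable_sum => j; exact: measurable_funX.
have S0 w : 0 <= \sum_j Y j w ^+ Q by apply: sumr_ge0 => j _; rewrite exprn_ge0.
exists U; split.
- by apply: measurable_funD => //; exact: measurable_funM.
- by move=> w; rewrite addr_ge0 ?mulr_ge0// ltW.
- move=> j w; have [yl|ly] := leP (Y j w) lam.
    by rewrite -[leLHS]addr0 lerD// mulr_ge0.
  rewrite -[leLHS]add0r lerD ?(ltW lam0)// mulrC ler_pdivlMr ?exprn_gt0//.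
  rewrite (bigD1 j)//= -[leLHS]addr0 lerD//; last first.
    by apply: sumr_ge0 => i _; rewrite exprn_ge0.
  rewrite -(prednK Q0) exprS ler_wpM2l// lerXn2r ?nnegrE// ltW//.
rewrite /U; under eq_integral do rewrite EFinD [X in (_ + X)%E]EFinM.
have lamE : (0 <= lam%:E)%E by rewrite lee_fin ltW.
have mSE : measurable_fun setT (fun w => (\sum_j Y j w ^+ Q)%:E) by exact/measurable_EFinP.
have SE0 w : setT w -> (0 <= (\sum_j Y j w ^+ Q)%:E)%E by move=> _; rewrite lee_fin.
rewrite ge0_integralD//; try exact: measurable_funeM; try by move=> w wT; rewrite mule_ge0 ?SE0 ?lee_fin.
rewrite integral_cstT ge0_integralZl//.
have ES : (\int[P]_w (\sum_j Y j w ^+ Q)%:E <= (#|J|%:R * c ^+ Q)%:E)%E.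
  under eq_integral do rewrite -sumEFin.
  rewrite ge0_integral_sum//; last 2 first.
  - by move=> j; apply/measurable_EFinP/measurable_funX.
  - by move=> j w _; rewrite lee_fin exprn_ge0.
  apply: (@le_trans _ _ (\sum_(j : J) (c ^+ Q)%:E)%E); first exact: lee_sum.
  by rewrite sumEFin sumr_const mulr_natl.
apply: (@le_trans _ _ (lam%:E + ((lam ^+ Q.-1)^-1)%:E * (#|J|%:R * c ^+ Q)%:E)%E).
  by rewrite leeD2l// lee_wpmul2l// lee_fin.
rewrite -EFinM -EFinD lee_fin [#|J|%:R * _]mulrC -lamQ.
rewrite -{2}(prednK Q0) exprS mulrCA mulVf ?mulr1 ?expf_neq0 ?gt_eqF//.
by rewrite -mulrA -/lam mulr2n mulrDl mul1r.
Qed.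

End elementary.

Section partial_sums.
Context {R : realType} {d dE : measure_display} {T : measurableType d}
  {E : measurableType dE}.
Variables (P : probability T R) (Y : nat -> T -> E).
Hypothesis mY : forall i, measurable_fun setT (Y i).
Hypothesis stationary : forall i (g : E -> R), (0 < i)%N ->
  measurable_fun setT g -> (forall x, 0 <= g x) ->
  (\int[P]_w (g (Y i w))%:E = \int[P]_w (g (Y 1%N w))%:E)%E.
Variables (theta kap : R) (Q : nat) (v : nat -> R) (V : R).
Hypothesis theta_gt2 : 2 < theta.
Hypothesis kap01 : 0 < kap < 1.
Hypothesis Q_ge4 : (4 <= Q)%N.
Hypothesis Q_even : ~~ odd Q.
Hypothesis v_gt0 : forall t, 0 < v t.
Hypothesis v_le1 : forall t, v t <= 1.
Hypothesis v_sum : forall n, \sum_(0 <= r < n) r.+1%:R ^+ (Q - 2) * v r <= V.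
Hypothesis mixing : forall k t n A B, (0 < k)%N -> (k + t <= n)%N ->
  sigma_gen Y [set j | (1 <= j <= k)%N] A ->
  sigma_gen Y [set j | (k + t <= j <= n)%N] B ->
  `|fine (P (A `&` B)) - fine (P A) * fine (P B)| <= v t `^ (1 - 2 / theta)^-1.
Local Notation integ f := (P.-integrable setT (EFin \o f)).

Definition centered (f : E -> R) (i : nat) (w : T) : R :=
  f (Y i w) - \int[P]_w f (Y i w).

Definition psum (f : E -> R) (p k : nat) (w : T) : R :=
  \sum_(p <= i < p + k) centered f i w.

Let Q_ge2 : (2 <= Q)%N. Proof. exact: leq_trans Q_ge4. Qed.
Let theta_gt0 : 0 < theta. Proof. exact: lt_trans theta_gt2. Qed.
Let th1 : 1 <= theta / 2. Proof. by rewrite ler_pdivlMr// mul1r ltW. Qed.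
Let thi0 : 0 <= 2 / theta. Proof. by rewrite divr_ge0// ltW. Qed.

Let exponent_ge1 q : (2 <= q)%N -> 1 <= q%:R * (theta / 2).
Proof.
move=> q2; rewrite -[leLHS]mulr1 ler_pM// ler1n.
exact: leq_trans q2.
Qed.

(** The bound is a square because the bounding class is controlled through square roots of these
    moments; [x] is then the size of the bracket. *)
Definition moments_le (f : E -> R) (x : R) := forall q, (2 <= q <= Q)%N ->
  (\int[P]_w (`|f (Y 1%N w)| `^ (q%:R * (theta / 2)))%:E <= (x ^+ 2)%:E)%E.

Lemma stationary_moment (f : E -> R) p i : (0 < i)%N -> measurable_fun setT f ->
  (\int[P]_w (`|f (Y i w)| `^ p)%:E = \int[P]_w (`|f (Y 1%N w)| `^ p)%:E)%E.
Proof.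
move=> i0 mf; apply: (@stationary i (fun y => `|f y| `^ p)) => //.
exact: measurable_norm_powR.
Qed.

Lemma moments_le_integ (f : E -> R) x i : measurable_fun setT f -> (0 < i)%N ->
  moments_le f x -> integ (fun w => f (Y i w)).
Proof.
move=> mf i0 /(_ 2%N); rewrite Q_ge2 => /(_ isT) h.
apply: (@moment_le_integ _ _ _ P _ (2%:R * (theta / 2)) (x ^+ 2)).
- exact: exponent_ge1.
- exact: measurableT_comp.
- by rewrite stationary_moment.
Qed.

Lemma moments_le_centered : exists2 C1 : R, 1 <= C1 & forall f x i q,
  measurable_fun setT f -> 0 < x -> moments_le f x -> (0 < i)%N -> (2 <= q <= Q)%N ->
  (\int[P]_w (`|centered f i w| `^ (q%:R * (theta / 2)))%:E <= (C1 * x ^+ 2)%:E)%E.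
Proof.
exists (2 * 4 `^ (Q%:R * (theta / 2))).
  rewrite -[leLHS]mulr1 ler_pM//; first lra.
  rewrite -[leLHS](powRr0 (4 : R)) ler_powR//; first lra.
  by rewrite (le_trans ler01)// exponent_ge1.
move=> f x i q mf x0 fx i0 qQ; have /andP[q2 q_le] := qQ.
have p1 := exponent_ge1 q2; set p := q%:R * (theta / 2) in p1 *.
have p0 : p != 0 by rewrite gt_eqF// (lt_le_trans ltr01).
have s0 : 0 < (x ^+ 2) `^ p^-1 by rewrite powR_gt0// exprn_gt0.
have sp : ((x ^+ 2) `^ p^-1) `^ p = x ^+ 2.
  by rewrite -powRrM mulVf// powRr1// exprn_ge0// ltW.
have mfY : measurable_fun setT (fun w => f (Y i w)) by exact: measurableT_comp.
apply: (le_trans (centered_moment p1 s0 mfY _)).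
  by rewrite stationary_moment// sp; exact: fx.
rewrite sp lee_fin ler_wpM2r ?exprn_ge0 ?(ltW x0)// ler_wpM2l// ler_powR//; first lra.
by rewrite /p ler_wpM2r ?ler_nat// (le_trans ler01).
Qed.

Let mcentered (f : E -> R) i : measurable_fun setT f -> measurable_fun setT (centered f i).
Proof. by move=> mf; apply: measurable_funB => //; exact: measurableT_comp. Qed.

Lemma centered_mean0 f i : integ (fun w => f (Y i w)) -> \int[P]_w centered f i w = 0.
Proof.
by move=> fi; rewrite RintegralB ?Rintegral_cstT ?subrr//; exact: integ_cst.
Qed.

(** The bound [x ^+ 2] enters the covariance inequality to the power 2/theta, hence the size
    [x ^ (2 / theta)] of the sums. The lower bound on its square is what allows the linear term to
    be absorbed. *)
Definition moment_maximal_inequality C := forall f x n p,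
  measurable_fun setT f -> 0 < x -> moments_le f x -> (0 < p)%N -> (0 < n)%N ->
  n%:R `^ kap <= n%:R * (x `^ (2 / theta)) ^+ 2 ->
  exists Mf : T -> R, [/\ measurable_fun setT Mf, forall w, 0 <= Mf w,
    forall k w, (k <= n)%N -> `|psum f p k w| <= Mf w &
    (\int[P]_w (Mf w ^+ Q)%:E <= ((C * Num.sqrt n%:R * x `^ (2 / theta)) ^+ Q)%:E)%E].

Lemma psum_maximal : exists2 C : R, 0 < C & moment_maximal_inequality C.
Proof.
have [C1 C11 HC1] := moments_le_centered.
have C10 : 0 < C1 by exact: lt_le_trans C11.
have [K K0 HK] := moment_sum_bound mY theta_gt2 Q_ge2 Q_even v_gt0 v_le1 v_sum mixing.
have [K' K'0 HK'] := maximal_partial_sum P Q_ge4 kap01 K0.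
pose D := C1 `^ (2 / theta).
have D1 : 1 <= D by rewrite -(powRr0 C1) ler_powR.
have D0 : 0 <= D by exact: le_trans D1.
exists ((K' + 1) * Num.sqrt D).
  by rewrite mulr_gt0 ?ltr_wpDl// sqrtr_gt0 (lt_le_trans ltr01).
move=> f x n p mf x0 fx p0 n0 nx.
pose t := (C1 * x ^+ 2) `^ (2 / theta).
have tE : t = D * (x `^ (2 / theta)) ^+ 2.
  rewrite /t powRM ?exprn_ge0 ?ltW// -/D; congr (_ * _).
  by rewrite -(powR_mulrn 2 (ltW x0)) powRAC powR_mulrn ?powR_ge0.
have y0 : 0 <= (x `^ (2 / theta)) ^+ 2 by rewrite exprn_ge0// powR_ge0.
have M0 : 0 < C1 * x ^+ 2 by rewrite mulr_gt0// exprn_gt0.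
have hsum p' n' : (0 < p')%N ->
  (\int[P]_w (`|\sum_(p' <= i < p' + n') centered f i w| ^+ Q)%:E <=
      (K * (n'%:R * t + Num.sqrt (n'%:R * t) ^+ Q))%:E)%E.
  move=> p'0; apply: (HK (fun i y => f y - \int[P]_w f (Y i w)) (C1 * x ^+ 2)) => //.
  - by move=> i; exact: measurable_funB.
  - by move=> i q i0 qQ; exact: HC1.
  - by move=> i i0; apply: centered_mean0; exact: moments_le_integ fx.
have nt : n%:R `^ kap <= n%:R * t.
  by rewrite (le_trans nx)// tE ler_wpM2l// ler_peMl.
have [Mf [mM M0' MS EM]] := HK' (centered f) t (fun i => mcentered i mf) (powR_ge0 _ _) hsum n p p0 n0 nt.
exists Mf; split => //; apply: (le_trans EM); rewrite lee_fin.
have -> : Num.sqrt (n%:R * t) = Num.sqrt D * Num.sqrt n%:R * x `^ (2 / theta).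
  rewrite tE mulrCA sqrtrM// sqrtrM// sqrtr_sqr ger0_norm ?powR_ge0//.
  by rewrite mulrA.
have -> : (K' + 1) * Num.sqrt D * Num.sqrt n%:R * x `^ (2 / theta) =
    (K' + 1) * (Num.sqrt D * Num.sqrt n%:R * x `^ (2 / theta)) by rewrite !mulrA.
rewrite [leRHS]exprMn ler_wpM2r ?exprn_ge0 ?mulr_ge0 ?sqrtr_ge0 ?powR_ge0//.
have K1 : 1 <= K' + 1 by rewrite lerDr.
rewrite (@le_trans _ _ (K' + 1))//; first by rewrite lerDl.
by rewrite -[leLHS]expr1 ler_weXn2l// (leq_trans _ Q_ge4).
Qed.

Lemma psumB f g p k w : (forall i, (0 < i)%N -> integ (fun w => f (Y i w))) ->
  (forall i, (0 < i)%N -> integ (fun w => g (Y i w))) -> (0 < p)%N ->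
  psum (fun x => f x - g x) p k w = psum f p k w - psum g p k w.
Proof.
move=> fi gi p0; rewrite /psum -sumrB big_nat [RHS]big_nat; apply: eq_bigr => i /andP[pi _].
have i0 : (0 < i)%N by exact: leq_trans pi.
rewrite /centered RintegralB//; [ring|exact: fi|exact: gi].
Qed.

(** The starting points [p j] may differ, so that one inequality serves the links of the chain,
    which start at time 1, and the oscillations over time blocks. *)
Definition finite_family_inequality C := forall (J : finType) (f : J -> E -> R) (p : J -> nat) x n,
  (forall j, measurable_fun setT (f j)) -> 0 < x ->
  (forall j, moments_le (f j) x) ->
  (forall j, 0 < p j)%N -> (0 < n)%N ->
  n%:R `^ kap <= n%:R * (x `^ (2 / theta)) ^+ 2 ->
  exists U : T -> R, [/\ measurable_fun setT U, forall w, 0 <= U w,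
    forall j k w, (k <= n)%N -> `|psum (f j) (p j) k w| <= Num.sqrt n%:R * U w &
    (\int[P]_w (U w)%:E <= (2 * C * x `^ (2 / theta) * #|J|%:R `^ Q%:R^-1)%:E)%E].

Section finite_family.
Variable C : R.
Hypothesis C_gt0 : 0 < C.
Hypothesis HC : moment_maximal_inequality C.

Lemma psum_finite_family : finite_family_inequality C.
Proof.
move=> J f p x n mf x0 fx p0 n0 nx.
have sn0 : 0 < Num.sqrt n%:R :> R by rewrite sqrtr_gt0 ltr0n.
have H j := HC (mf j) x0 (fx j) (p0 j) n0 nx.
pose M j := proj1_sig (cid (H j)).
have HM j : [/\ measurable_fun setT (M j), forall w, 0 <= M j w,
    forall k w, (k <= n)%N -> `|psum (f j) (p j) k w| <= M j w &
    (\int[P]_w (M j w ^+ Q)%:E <= ((C * Num.sqrt n%:R * x `^ (2 / theta)) ^+ Q)%:E)%E].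
  exact: proj2_sig (cid (H j)).
have c0 : 0 < C * Num.sqrt n%:R * x `^ (2 / theta) by rewrite !mulr_gt0// powR_gt0.
have Q0 : (0 < Q)%N by exact: leq_trans Q_ge4.
have [U [mU U0 MU EU]] := @finite_max_bound _ _ _ P J Q _ M Q0 c0
  (fun j => let: And4 h _ _ _ := HM j in h) (fun j => let: And4 _ h _ _ := HM j in h)
  (fun j => let: And4 _ _ _ h := HM j in h).
exists (fun w => (Num.sqrt n%:R)^-1 * U w); split.
- exact: measurable_funM.
- by move=> w; rewrite mulr_ge0// invr_ge0 ltW.
- move=> j k w kn; rewrite mulVKf ?gt_eqF//; case: (HM j) => _ _ h _.
  by rewrite (le_trans (h k w kn))// MU.
under eq_integral do rewrite EFinM.
have sni : (0 <= ((Num.sqrt n%:R)^-1 : R)%:E)%E by rewrite lee_fin invr_ge0 ltW.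
have mUE : measurable_fun setT (fun w => (U w)%:E) by exact/measurable_EFinP.
have UE0 w : setT w -> (0 <= (U w)%:E)%E by move=> _; rewrite lee_fin.
rewrite ge0_integralZl//.
apply: (le_trans (lee_wpmul2l sni EU)).
rewrite -EFinM lee_fin.
have sne : Num.sqrt n%:R != 0 :> R by rewrite gt_eqF.
have -> : 2 * (C * Num.sqrt n%:R * x `^ (2 / theta)) * #|J|%:R `^ Q%:R^-1 =
    Num.sqrt n%:R * (2 * C * x `^ (2 / theta) * #|J|%:R `^ Q%:R^-1) by ring.
by rewrite mulKf.
Qed.

End finite_family.
End partial_sums.

(** * Chaining *)

Section chaining.
Context {R : realType} {d dE : measure_display} {T : measurableType d}
  {E : measurableType dE}.
Variables (P : probability T R) (Y : nat -> T -> E).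
Hypothesis mY : forall i, measurable_fun setT (Y i).
Hypothesis stationary : forall i (g : E -> R), (0 < i)%N ->
  measurable_fun setT g -> (forall x, 0 <= g x) ->
  (\int[P]_w (g (Y i w))%:E = \int[P]_w (g (Y 1%N w))%:E)%E.
Variables (theta kap : R) (Q : nat) (C : R).
Hypothesis theta_gt2 : 2 < theta.
Hypothesis kap01 : 0 < kap < 1.
Hypothesis Q_ge4 : (4 <= Q)%N.
Hypothesis C_gt0 : 0 < C.
Local Notation integ f := (P.-integrable setT (EFin \o f)).
Local Notation S k f w := (psum P Y f 1 k w).
Hypothesis finite_family : finite_family_inequality P Y theta kap Q C.

Variable F : set (E -> R).
Hypothesis F_measurable : forall phi, F phi -> measurable_fun setT phi.
Hypothesis F_integrable : forall phi i, F phi -> (0 < i)%N -> integ (fun w => phi (Y i w)).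

Definition scale (k : nat) : R := (2 ^+ k)^-1.
Definition rate (k : nat) : R := scale k `^ (2 / theta).

Unset Implicit Arguments.
Variables (N : nat -> nat) (a b : forall k, 'I_(N k) -> E -> R).
Hypothesis aF : forall k i, F (a k i).
Hypothesis cover : forall k phi, F phi -> exists i j, forall x, `|phi x - a k i x| <= b k j x.
Hypothesis mb : forall k j, measurable_fun setT (b k j).
Hypothesis b_moments : forall k j, moments_le P Y theta Q (b k j) (scale k).
(** Needed for the means of the brackets: the moments above would only bound them by a multiple of
    [rate k], and sqrt n * rate k is not small at admissible levels. *)
Hypothesis b_L2 : forall k j,
  (\int[P]_w (`|b k j (Y 1%N w)| `^ 2)%:E <= (scale k ^+ 2)%:E)%E.

Set Implicit Arguments.

(** Cost of the N k links at level [k], and also twice a lower bound for the part of the entropy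
    integral between scale k.+1 and scale k. *)
Definition entropy_term (k : nat) : R := rate k * (N k)%:R `^ Q%:R^-1.

(** The condition under which the maximal inequality applies to level-[k] links of [n] summands; it
    caps the depth of the chain. *)
Definition admissible (n k : nat) := n%:R `^ kap <= n%:R * (rate k) ^+ 2.

Lemma scale_gt0 k : 0 < scale k. Proof. by rewrite invr_gt0 exprn_gt0. Qed.

Lemma rate_gt0 k : 0 < rate k. Proof. by rewrite powR_gt0// scale_gt0. Qed.

(** Links from level k.+1 to level k number N k.+1 but have the size of level k; this turns their
    cost into [entropy_term k.+1]. *)
Lemma rate_succ k : rate k <= 2 * rate k.+1.
Proof.
have -> : rate k = 2 `^ (2 / theta) * rate k.+1.
  rewrite /rate -powRM ?(ltW (scale_gt0 _))// /scale exprS invfM mulVKf//.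
rewrite ler_wpM2r ?(ltW (rate_gt0 _))// ler1_powR ?ler1n//.
by rewrite ler_pdivrMr ?mul1r ?(ltW theta_gt2)// (lt_trans _ theta_gt2).
Qed.

Lemma rate_antitone k l : (k <= l)%N -> rate l <= rate k.
Proof.
move=> kl; rewrite /rate ge0_ler_powR ?nnegrE ?(ltW (scale_gt0 _))//.
  by rewrite divr_ge0// ltW// (lt_trans _ theta_gt2).
by rewrite /scale lef_pV2 ?posrE ?exprn_gt0// ler_weXn2l// ler1n.
Qed.

Lemma admissible_le n k l : (k <= l)%N -> admissible n l -> admissible n k.
Proof.
move=> kl h; apply: (le_trans h); rewrite ler_wpM2l// lerXn2r ?nnegrE ?(ltW (rate_gt0 _))//.
exact: rate_antitone.
Qed.

Lemma moments_le_dominated (f g : E -> R) x : measurable_fun setT f -> measurable_fun setT g ->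
  (forall y, `|f y| <= g y) -> moments_le P Y theta Q g x -> moments_le P Y theta Q f x.
Proof.
move=> mf mg fg gx q qQ; apply: le_trans (gx q qQ); apply: ge0_le_integral => //.
- by apply/measurable_EFinP; apply: measurable_norm_powR; exact: measurableT_comp.
- by apply/measurable_EFinP; apply: measurable_norm_powR; exact: measurableT_comp.
- move=> w _; rewrite lee_fin ge0_ler_powR ?nnegrE//.
    by rewrite mulr_ge0// divr_ge0// ltW// (lt_trans _ theta_gt2).
  by rewrite (le_trans (fg _))// ler_norm.
Qed.

Lemma psum_link (J : finType) (phi psi : J -> E -> R) (k n : nat) (g : J -> 'I_(N k)) :
  (forall j, F (phi j)) -> (forall j, F (psi j)) ->
  (forall j x, `|phi j x - psi j x| <= b k (g j) x) ->
  (0 < n)%N -> admissible n k ->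
  exists U : T -> R, [/\ measurable_fun setT U, forall w, 0 <= U w,
    forall j l w, (l <= n)%N -> `|S l (phi j) w - S l (psi j) w| <= Num.sqrt n%:R * U w &
    (\int[P]_w (U w)%:E <= (2 * C * rate k * #|J|%:R `^ Q%:R^-1)%:E)%E].
Proof.
move=> Fphi Fpsi hb n0 nk.
have md j : measurable_fun setT (fun x => phi j x - psi j x).
  by apply: measurable_funB; exact: F_measurable.
have hm j : moments_le P Y theta Q (fun x => phi j x - psi j x) (scale k).
  exact: (moments_le_dominated (md j) (mb k (g j)) (hb j) (b_moments k (g j))).
have [U [mU U0 hU EU]] := @finite_family J (fun j x => phi j x - psi j x) (fun=> 1%N)
  (scale k) n md (scale_gt0 k) hm (fun=> isT) n0 nk.
exists U; split => // j l w ln; rewrite -(psumB (P := P) (Y := Y))//; first exact: hU.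
- by move=> i i0; exact: F_integrable.
- by move=> i i0; exact: F_integrable.
Qed.

Lemma integral_sum2 (U1 U2 : T -> R) (c1 c2 : R) :
  measurable_fun setT U1 -> measurable_fun setT U2 -> (forall w, 0 <= U1 w) ->
  (forall w, 0 <= U2 w) -> (\int[P]_w (U1 w)%:E <= c1%:E)%E ->
  (\int[P]_w (U2 w)%:E <= c2%:E)%E -> (\int[P]_w (U1 w + U2 w)%:E <= (c1 + c2)%:E)%E.
Proof.
move=> m1 m2 p1 p2 e1 e2; under eq_integral do rewrite EFinD.
have m1' : measurable_fun setT (fun w => (U1 w)%:E) by exact/measurable_EFinP.
have m2' : measurable_fun setT (fun w => (U2 w)%:E) by exact/measurable_EFinP.
have p1' w : setT w -> (0 <= (U1 w)%:E)%E by rewrite lee_fin.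
have p2' w : setT w -> (0 <= (U2 w)%:E)%E by rewrite lee_fin.
by rewrite ge0_integralD// EFinD leeD.
Qed.

(** Approximants belong to F, so each one of level k.+1 is itself covered at level k. Following this
    parent map, level k.+1 contributes N k.+1 links only, and [c] is the composition of the parent
    maps. *)
Lemma psum_chain k0 e n : (0 < n)%N -> admissible n (k0 + e) ->
  exists (U : T -> R) (c : 'I_(N (k0 + e)) -> 'I_(N k0)),
   [/\ measurable_fun setT U, forall w, 0 <= U w,
    forall i l w, (l <= n)%N ->
      `|S l (a (k0 + e) i) w - S l (a k0 (c i)) w| <= Num.sqrt n%:R * U w &
    (\int[P]_w (U w)%:E <= (4 * C * \sum_(k0 <= k < (k0 + e).+1) entropy_term k)%:E)%E].
Proof.
have T0 k : 0 <= entropy_term k by rewrite mulr_ge0 ?powR_ge0 ?(ltW (rate_gt0 _)).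
move=> n0; elim: e => [|e IH].
  rewrite addn0 => _; exists (fun=> 0), id; split => //.
    by move=> i l w _; rewrite subrr normr0 mulr0.
  by rewrite integral0 lee_fin mulr_ge0 ?sumr_ge0// mulr_ge0// ltW.
rewrite addnS => ad; set k := (k0 + e)%N in IH ad *.
have [U [c [mU U0 hU EU]]] := IH (admissible_le (leqnSn k) ad).
have H i := cover k _ (aF k.+1 i).
pose pi i := proj1_sig (cid (H i)).
pose pj i := proj1_sig (cid (proj2_sig (cid (H i)))).
have hpi i x : `|a k.+1 i x - a k (pi i) x| <= b k (pj i) x.
  exact: (proj2_sig (cid (proj2_sig (cid (H i))))).
have [W [mW W0 hW EW]] := @psum_link _ (a k.+1) (fun i => a k (pi i)) k n pj
  (aF k.+1) (fun i => aF k (pi i)) hpi n0 (admissible_le (leqnSn k) ad).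
exists (fun w => W w + U w), (c \o pi); split.
- exact: measurable_funD.
- by move=> w; rewrite addr_ge0.
- move=> i l w ln; rewrite mulrDr -(subrKA (S l (a k (pi i)) w)).
  by rewrite (le_trans (ler_normD _ _))// lerD ?hW ?hU.
apply: le_trans (integral_sum2 mW mU W0 U0 EW EU) _.
rewrite lee_fin [in leRHS]big_nat_recr/=; last by exact: leq_trans (leq_addr e k0) (leqnSn _).
rewrite mulrDr addrC lerD2l card_ord /entropy_term.
have := rate_succ k; set z := _ `^ Q%:R^-1; have z0 : 0 <= z by exact: powR_ge0.
move=> h; rewrite mulrA ler_wpM2r//.
have -> : 4 * C * rate k.+1 = 2 * C * (2 * rate k.+1) by ring.
by rewrite ler_wpM2l// mulr_ge0// ltW.
Qed.

(** Infinitely many functions share one bracket [b], so the link is bounded by b plus its mean: the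
    centered sum of [b], of which there are N k, plus 2 E b <= 4 scale k for each summand. Summed
    over at most n times and divided by sqrt n, the latter gives 4 sqrt n * scale k. *)
Lemma psum_bottom k n : (0 < n)%N -> admissible n k ->
  exists U : T -> R, [/\ measurable_fun setT U, forall w, 0 <= U w,
    forall phi, F phi -> exists i, forall l w, (l <= n)%N ->
      `|S l phi w - S l (a k i) w| <= Num.sqrt n%:R * U w &
    (\int[P]_w (U w)%:E <=
      (2 * C * entropy_term k + 4 * Num.sqrt n%:R * scale k)%:E)%E].
Proof.
move=> n0 ad.
have [U [mU U0 hU EU]] := @finite_family _ (b k) (fun=> 1%N)
  (scale k) n (mb k) (scale_gt0 k) (b_moments k) (fun=> isT) n0 ad.
have sn0 : 0 < Num.sqrt n%:R :> R by rewrite sqrtr_gt0 ltr0n.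
have c0 : 0 <= 4 * Num.sqrt n%:R * scale k.
  by rewrite mulr_ge0 ?(ltW (scale_gt0 _))// mulr_ge0// ltW.
exists (fun w => U w + 4 * Num.sqrt n%:R * scale k); split.
- exact: measurable_funD.
- by move=> w; rewrite addr_ge0.
- move=> phi Fphi; have [i [j hij]] := cover k _ Fphi; exists i => l w ln.
  have mYi ii : measurable_fun setT (fun w => b k j (Y ii w)) by exact: measurableT_comp.
  have b2 ii : (0 < ii)%N -> (\int[P]_w (`|b k j (Y ii w)| `^ 2)%:E <= (scale k `^ 2)%:E)%E.
    by move=> i0; rewrite (stationary_moment stationary)// [scale k `^ _]powR_mulrn ?(ltW (scale_gt0 _))//.
  have ib ii : (0 < ii)%N -> integ (fun w => b k j (Y ii w)).
    by move=> i0; apply: (moment_le_integ _ (mYi ii) (b2 ii i0)); rewrite ler1n.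
  have eb ii : (0 < ii)%N -> `|\int[P]_w b k j (Y ii w)| <= 2 * scale k.
    by move=> i0; apply: (moment_le_mean _ (scale_gt0 k) (mYi ii) (b2 ii i0)); rewrite ler1n.
  rewrite -(psumB (P := P) (Y := Y))//; [|by move=> ? ?; exact: F_integrable|by move=> ? ?; exact: F_integrable].
  have step ii : (0 < ii)%N -> `|centered P Y (fun x => phi x - a k i x) ii w| <=
      centered P Y (b k j) ii w + 4 * scale k.
    move=> i0; rewrite /centered.
    have iphi : integ (fun w => phi (Y ii w) - a k i (Y ii w)).
      by apply: integB; apply: F_integrable.
    have h1 := ler_norm_Rintegral iphi (ib ii i0) (fun w => hij (Y ii w)).
    have h2 := hij (Y ii w); have h3 := eb ii i0.
    move: h1 h2 h3; set m := \int[P]_w (_ - _); set m' := \int[P]_w b k j _.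
    by rewrite !ler_norml; lra.
  rewrite /psum (le_trans (ler_norm_sum _ _ _))//.
  apply: (@le_trans _ _ (\sum_(1 <= ii < 1 + l) (centered P Y (b k j) ii w + 4 * scale k))).
    by rewrite big_nat [leRHS]big_nat; apply: ler_sum => ii /andP[i0 _]; exact: step.
  rewrite big_split/= mulrDr lerD//.
    by rewrite (le_trans (ler_norm _))//; exact: hU.
  rewrite big_const_nat iter_addr_0 addKn -[_ *+ l]mulr_natl.
  have -> : Num.sqrt n%:R * (4 * Num.sqrt n%:R * scale k) =
    (Num.sqrt n%:R * Num.sqrt n%:R) * (4 * scale k) by ring.
  rewrite -[_ * Num.sqrt _]expr2 sqr_sqrtr//.
  by rewrite ler_wpM2r ?ler_nat// mulr_ge0// ltW// scale_gt0.
- apply: (integral_sum2 mU _ U0) => //.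
    by rewrite /entropy_term mulrA; move: EU; rewrite card_ord.
  by rewrite integral_cstT.
Qed.

Lemma powR_nat_unbounded (B p : R) : 0 < p -> exists n0, forall n, (n0 <= n)%N ->
  B <= n%:R `^ p.
Proof.
move=> p0; exists (Num.truncn (`|B| `^ p^-1)).+1 => n n0n.
have h : `|B| `^ p^-1 <= n%:R.
  by rewrite (le_trans (ltW (truncnS_gt _)))// ler_nat.
rewrite (le_trans (ler_norm B))//.
have -> : `|B| = (`|B| `^ p^-1) `^ p by rewrite -powRrM mulVf ?gt_eqF// powRr1.
by rewrite ge0_ler_powR ?nnegrE ?powR_ge0// ltW.
Qed.

Hypothesis entropy_bounded : exists B, forall K, \sum_(0 <= k < K) entropy_term k <= B.
Hypothesis kap_small : 2 < (1 - kap) * theta.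

Let entropy_ge0 k : 0 <= entropy_term k.
Proof. by rewrite mulr_ge0 ?powR_ge0 ?(ltW (rate_gt0 _)). Qed.

Lemma entropy_tail (eta : R) : 0 < eta -> exists k0, forall K,
  \sum_(k0 <= k < K) entropy_term k <= eta.
Proof.
move=> e0; have [B hB] := entropy_bounded.
pose u K := \sum_(0 <= k < K) entropy_term k.
have hs : has_sup (range u).
  by split; [exists (u 0%N); exists 0%N|exists B => _ [K _ <-]; exact: hB].
have [_ [k0 _ <-] h0] := sup_adherent e0 hs.
exists k0 => K; have [Kk|kK] := leqP K k0; first by rewrite big_geq ?(ltW e0).
have hK : u K <= sup (range u) by apply: ub_le_sup; [case: hs|exists K].
have : u K = u k0 + \sum_(k0 <= k < K) entropy_term k.
  by rewrite /u (@big_cat_nat _ _ _ k0 0 K)//; exact: ltnW.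
by move: h0 hK; lra.
Qed.

(** Take 2^K within a factor 2 below the integer part of y = n^t, t = (1 - kap) theta / 4. Then rate
    K ^ 2 >= y^(-4/theta) = n^(kap - 1), which is admissibility, and sqrt n * scale K is of order
    n^(1/2 - t), where [kap_small] says that t > 1/2. *)
Lemma admissible_level : forall (eta : R) (k0 : nat), 0 < eta ->
  exists n0, forall n, (n0 <= n)%N -> (0 < n)%N /\
    exists K, [/\ (k0 <= K)%N, admissible n K & 4 * Num.sqrt n%:R * scale K <= eta].
Proof.
move=> eta k0 e0; have /andP[kp0 kp1] := kap01.
have th0 : 0 < theta by exact: lt_trans theta_gt2.
pose t := (1 - kap) * theta / 4.
have t12 : 0 < t - 2^-1 by rewrite /t; move: kap_small; lra.
have t0 : 0 < t by move: t12; lra.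
have [n1 hn1] := @powR_nat_unbounded (2 ^+ k0) t t0.
have [n2 hn2] := @powR_nat_unbounded (8 / eta) (t - 2^-1) t12.
exists (maxn (maxn n1 n2) 1) => n; rewrite !geq_max => /andP[/andP[n1n n2n] n0]; split=> //.
have nR : 1 <= n%:R :> R by rewrite ler1n.
have nR0 : 0 < n%:R :> R by exact: lt_le_trans nR.
pose y := n%:R `^ t : R.
have y1 : 1 <= y by rewrite -[leLHS](powRr0 (n%:R : R)) ler_powR// ltW.
have y0 : 0 < y by exact: lt_le_trans y1.
have ty0 : (0 < Num.truncn y)%N by rewrite -[(0 < _)%N]/(1 <= _)%N truncn_ge_nat// ltW.
pose K := trunc_log 2 (Num.truncn y).
have /andP[h1 h2] := trunc_log_bounds (isT : 1 < 2)%N ty0.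
have h1' : 2 ^+ K <= y.
  rewrite -natrX (le_trans (_ : _ <= (Num.truncn y)%:R))// ?ler_nat//.
  by rewrite truncn_le// ltW.
have h2' : y < 2 ^+ K.+1.
  rewrite -natrX (lt_le_trans (truncnS_gt _))// ler_nat//.
have kk : (k0 <= K)%N.
  by rewrite -ltnS; have := le_lt_trans (hn1 n n1n) h2'; rewrite ltr_eXn2l ?ltr1n.
exists K; split => //.
- have sy : y^-1 <= scale K by rewrite /scale lef_pV2 ?posrE ?exprn_gt0.
  have r2 : n%:R `^ (kap - 1) <= rate K ^+ 2.
    have -> : n%:R `^ (kap - 1) = (y^-1 `^ (2 / theta)) ^+ 2.
      rewrite -powR_inv1 ?(ltW y0)// -[RHS]powR_mulrn ?powR_ge0// /y -!powRrM.
      congr (_ `^ _); rewrite /t; have := gt_eqF th0 => /negbT tn; by field.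
    rewrite lerXn2r ?nnegrE ?powR_ge0// /rate ge0_ler_powR ?nnegrE//.
    + by rewrite divr_ge0// ltW.
    + by rewrite invr_ge0 ltW.
    + by rewrite ltW// scale_gt0.
  rewrite /admissible; apply: (@le_trans _ _ (n%:R * n%:R `^ (kap - 1))).
    rewrite -{2}(powRr1 (ltW nR0)) -powRD; last by rewrite (gt_eqF nR0) implybT.
    by rewrite addrC subrK.
  by rewrite ler_wpM2l// ltW.
- have sc : scale K <= 2 / y.
    rewrite /scale ler_pdivlMr// ler_pdivrMl ?exprn_gt0// mulrC -exprS; exact: ltW.
  have -> : Num.sqrt n%:R = n%:R `^ 2^-1 :> R by rewrite powR12_sqrt// ltW.
  apply: (@le_trans _ _ (4 * n%:R `^ 2^-1 * (2 / y))).
    by rewrite ler_wpM2l// mulr_ge0// powR_ge0.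
  have -> : 4 * n%:R `^ 2^-1 * (2 / y) = 8 / n%:R `^ (t - 2^-1).
    rewrite powRB; last by rewrite (gt_eqF nR0) implybT.
    rewrite invf_div -/y; field; exact: (negbT (gt_eqF y0)).
  by rewrite ler_pdivrMr ?powR_gt0// mulrC -ler_pdivrMr//; exact: hn2.
Qed.

Lemma psum_approx_level (eta : R) : 0 < eta -> exists k0 n0, forall n, (n0 <= n)%N ->
  (0 < n)%N /\ exists U : T -> R, [/\ measurable_fun setT U, forall w, 0 <= U w,
    forall phi, F phi -> exists i, forall l w, (l <= n)%N ->
      `|S l phi w - S l (a k0 i) w| <= Num.sqrt n%:R * U w &
    (\int[P]_w (U w)%:E <= eta%:E)%E].
Proof.
move=> e0; have e2 : 0 < eta / 2 by rewrite divr_gt0.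
(* The chain costs 4 C times the entropy tail and the bottom link 2 C times its last term, together
   at most 6 C times the tail. *)
have ec : 0 < eta / (12 * C) by rewrite divr_gt0// mulr_gt0.
have [k0 hk0] := entropy_tail ec; have [n0 hn0] := admissible_level k0 e2.
exists k0, n0 => n /hn0[np [K [k0K ad hs]]]; split => //.
have := @psum_chain k0 (K - k0) n np; rewrite subnKC// => /(_ ad).
move=> [U1 [c [mU1 U10 hU1 EU1]]].
have [U2 [mU2 U20 hU2 EU2]] := psum_bottom np ad.
exists (fun w => U2 w + U1 w); split.
- exact: measurable_funD.
- by move=> w; rewrite addr_ge0.
- move=> phi /hU2[i hi]; exists (c i) => l w ln.
  rewrite mulrDr -(subrKA (S l (a K i) w)) (le_trans (ler_normD _ _))//.
  by rewrite lerD ?hi ?hU1.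
apply: le_trans (integral_sum2 mU2 mU1 U20 U10 EU2 EU1) _; rewrite lee_fin.
have tl := hk0 K.+1; rewrite big_nat_recr//= in tl *.
have C0 := C_gt0; have s0 : 0 <= \sum_(k0 <= i < K) entropy_term i by exact: sumr_ge0.
have tK := entropy_ge0 K.
rewrite ler_pdivlMr ?mulr_gt0// in tl.
move: tl hs s0 tK; set s := \sum_(k0 <= i < K) _; set z := entropy_term K.
set q := 4 * _ * _ => tl hs s0 tK.
have : 0 <= C * s by rewrite mulr_ge0// ltW.
have : 0 <= C * z by rewrite mulr_ge0// ltW.
lra.
Qed.

Definition covers k (phi : E -> R) (i : 'I_(N k)) :=
  exists j, forall x, `|phi x - a k i x| <= b k j x.

Lemma rate_small (eta : R) : 0 < eta -> exists k, rate k <= eta.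
Proof.
move=> e0; have th0 : 0 < theta by exact: lt_trans theta_gt2.
have [n hn] := @powR_nat_unbounded eta^-1 (2 / theta) ltac:(by rewrite divr_gt0).
exists n; have := hn n (leqnn n).
have n2 : n%:R <= 2 ^+ n :> R by rewrite -natrX ler_nat ltnW// ltn_expl.
have : n%:R `^ (2 / theta) <= (2 ^+ n) `^ (2 / theta) :> R.
  by rewrite ge0_ler_powR ?nnegrE ?exprn_ge0// divr_ge0// ltW.
move=> h1 h2; rewrite /rate /scale.
have -> : ((2 ^+ n)^-1) `^ (2 / theta) = ((2 ^+ n) `^ (2 / theta))^-1 :> R.
  by rewrite -powR_inv1 ?exprn_ge0// powRAC powR_inv1// powR_ge0.
rewrite -[leRHS]invrK lef_pV2 ?posrE ?invr_gt0 ?powR_gt0 ?exprn_gt0//.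
exact: le_trans h1.
Qed.

Lemma admissible_eventually k : exists n0, forall n, (n0 <= n)%N -> (0 < n)%N -> admissible n k.
Proof.
have /andP[kp0 kp1] := kap01.
have [n0 hn0] := @powR_nat_unbounded (rate k ^+ 2)^-1 (1 - kap) ltac:(by rewrite subr_gt0).
exists n0 => n n0n np; have h := hn0 n n0n.
have nR0 : 0 < n%:R :> R by rewrite ltr0n.
have nk : 0 < n%:R `^ kap :> R by rewrite powR_gt0.
have E1 : n%:R = n%:R `^ kap * n%:R `^ (1 - kap) :> R.
  rewrite -powRD; last by rewrite (gt_eqF nR0) implybT.
  by rewrite addrC subrK powRr1// ltW.
rewrite /admissible {2}E1 -mulrA ler_peMr ?(ltW nk)//.
have r0 : 0 < rate k ^+ 2 by rewrite exprn_gt0// rate_gt0.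
by rewrite -ler_pdivrMr// div1r.
Qed.

(* The approximant reached by chaining depends on [n]; comparing with one
   representative of each pair of level-[k0] indices, at most [N k0 ^ 2] links,
   replaces it by the approximant of a single level [k1] independent of [n]. *)
Lemma psum_approx_fixed_level (eta : R) : 0 < eta -> exists k1 n0, forall n, (n0 <= n)%N ->
  (0 < n)%N /\ exists U : T -> R, [/\ measurable_fun setT U, forall w, 0 <= U w,
    forall phi i, F phi -> covers phi i -> forall l w, (l <= n)%N ->
      `|S l phi w - S l (a k1 i) w| <= Num.sqrt n%:R * U w &
    (\int[P]_w (U w)%:E <= eta%:E)%E].
Proof.
move=> e0; have e8 : 0 < eta / 8 by rewrite divr_gt0.
have [k0 [n0 hn0]] := psum_approx_level e8.
pose D := 2 * C * (N k0 * N k0)%:R `^ Q%:R^-1.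
have D0 : 0 <= D by rewrite mulr_ge0 ?powR_ge0// mulr_ge0// ltW.
have [k1 hk1] := @rate_small (eta / 2 / (D + 1)) ltac:(by rewrite !divr_gt0// ltr_wpDl).
have [n1 hn1] := admissible_eventually k1.
exists k1, (maxn n0 n1) => n; rewrite geq_max => /andP[/hn0[np [U0 [mU0 U00 hU0 EU0]]] n1n].
split => //; have ad := hn1 n n1n np.
pose near (phi : E -> R) i := forall l w, (l <= n)%N -> `|S l phi w - S l (a k0 i) w| <= Num.sqrt n%:R * U0 w.
pose rep (p : 'I_(N k0) * 'I_(N k0)) (q : (E -> R) * 'I_(N k1)) :=
  [/\ F q.1, covers q.1 q.2, near q.1 p.1 & near (a k1 q.2) p.2].
(* Keeping only the pairs that are realized makes the choice of a representative possible. This set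
   varies with [n], the bound on its size does not. *)
pose J := {p : 'I_(N k0) * 'I_(N k0) | `[< exists q, rep p q >]}.
have H (j : J) : exists q, rep (sval j) q by apply/asboolP; exact: (svalP j).
pose qj (j : J) := proj1_sig (cid (H j)).
have hq j : rep (sval j) (qj j) by exact: proj2_sig (cid (H j)).
have hc (j : J) : covers (qj j).1 (qj j).2 by case: (hq j).
pose g (j : J) := proj1_sig (cid (hc j)).
have hg (j : J) x : `|(qj j).1 x - a k1 (qj j).2 x| <= b k1 (g j) x.
  exact: (proj2_sig (cid (hc j))).
have Fq (j : J) : F (qj j).1 by case: (hq j).
have [U1 [mU1 U10 hU1 EU1]] := @psum_link J (fun j => (qj j).1) (fun j => a k1 (qj j).2)
  k1 n g Fq (fun j => aF k1 _) hg np ad.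
exists (fun w => 4 * U0 w + U1 w); split.
- by apply: measurable_funD => //; exact: measurable_funM.
- by move=> w; rewrite addr_ge0// mulr_ge0.
- move=> phi i Fphi cphi l w ln.
  have [p hp] := hU0 _ Fphi; have [p' hp'] := hU0 _ (aF k1 i).
  have hJ : `[< exists q, rep (p, p') q >] by apply/asboolP; exists (phi, i).
  pose j : J := exist _ (p, p') hJ.
  case: (hq j) => /= _ _ n1' n2'.
  (* The path runs from phi to [a k0 p], to the representative, along its link to level k1, to
     [a k0 p'] and to [a k1 i]: four steps bounded by [U0] and one by [U1], which explains eta /
     8. *)
  have i1 := hp l w ln; have i2 := n1' l w ln; have i3 := hU1 j l w ln.
  have i4 := n2' l w ln; have i5 := hp' l w ln.
  rewrite /= in i2 i3 i4.
  move: i1 i2 i3 i4 i5; rewrite mulrDr mulrCA !ler_norml; lra.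
have E4 : (\int[P]_w (4 * U0 w)%:E <= (4 * (eta / 8))%:E)%E.
  under eq_integral do rewrite EFinM.
  have mUE : measurable_fun setT (fun w => (U0 w)%:E) by exact/measurable_EFinP.
  have UE0 w : setT w -> (0 <= (U0 w)%:E)%E by rewrite lee_fin.
  by rewrite ge0_integralZl// EFinM lee_wpmul2l.
have m4 : measurable_fun setT (fun w => 4 * U0 w) by exact: measurable_funM.
apply: le_trans (integral_sum2 m4 mU1 (fun w => mulr_ge0 (ler0n _ 4) (U00 w)) U10 E4 EU1) _.
rewrite lee_fin.
have cJ : #|{: J}|%:R `^ Q%:R^-1 <= (N k0 * N k0)%:R `^ Q%:R^-1 :> R.
  rewrite ge0_ler_powR ?nnegrE ?invr_ge0// ler_nat card_sig.
  by rewrite (leq_trans (max_card _))// card_prod !card_ord.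
have h2 : 2 * C * rate k1 * #|{: J}|%:R `^ Q%:R^-1 <= eta / 2.
  apply: (@le_trans _ _ (D * rate k1)).
    rewrite /D -!mulrA ler_wpM2l// ler_wpM2l ?(ltW C_gt0)// mulrC.
    by rewrite ler_wpM2r// ltW// rate_gt0.
  apply: (@le_trans _ _ (D * (eta / 2 / (D + 1)))); first by rewrite ler_wpM2l.
  rewrite mulrA ler_pdivrMr ?ltr_wpDl// mulrC ler_wpM2l ?divr_ge0 ?(ltW e0)//.
  by rewrite lerDl.
lra.
Qed.

Lemma psum_sub f m l w : (m <= l)%N -> S l f w - S m f w = psum P Y f m.+1 (l - m) w.
Proof.
move=> ml; rewrite /psum (@big_cat_nat _ _ _ (1 + m) 1 (1 + l))//=.
by rewrite [LHS]addrC addKr !add1n addSn subnKC.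
Qed.

(** Over a block of about n/J times the oscillation, relative to sqrt n, has size J^(-1/2), and the
    maximum over blocks and functions costs (J M)^(1/Q). As Q >= 4, the product decays at least like
    J^(-1/4). *)
Lemma psum_time_blocks (M : nat) (f : 'I_M -> E -> R) (x eta : R) :
  (forall i, measurable_fun setT (f i)) -> 1 <= x ->
  (forall i, moments_le P Y theta Q (f i) x) -> 0 < eta ->
  exists J, (0 < J)%N /\ forall n, (J <= n)%N ->
  exists U : T -> R, [/\ measurable_fun setT U, forall w, 0 <= U w,
    forall i j l w, (j <= J)%N -> (n * j %/ J <= l <= n * j %/ J + (n %/ J).+1)%N ->
      `|S l (f i) w - S (n * j %/ J) (f i) w| <= Num.sqrt n%:R * U w &
    (\int[P]_w (U w)%:E <= eta%:E)%E].
Proof.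
move=> mf x1 fx e0; have x0 : 0 < x by exact: lt_le_trans x1.
have th0 : 0 < theta by exact: lt_trans theta_gt2.
have q4 : 0 < (4^-1 : R) by rewrite invr_gt0.
pose X := x `^ (2 / theta).
have X1 : 1 <= X by rewrite -[leLHS](powRr0 x) ler_powR// divr_ge0// ltW.
have X0 : 0 <= X by exact: le_trans X1.
pose B := 8 * C * X * M.+1%:R.
have [J0 hJ0] := powR_nat_unbounded (B / eta) q4.
pose J := J0.+1; have hJ := hJ0 J (leqnSn _).
exists J; split => // n Jn.
have n0 : (0 < n)%N by exact: leq_trans Jn.
set l0 := (n %/ J).+1.
have l0J : (l0 * J <= 2 * n)%N.
  have h1 : (0 < n %/ J)%N by rewrite divn_gt0.
  rewrite /l0 -addn1 (leq_trans (_ : _ <= (n %/ J + n %/ J) * J)%N)//.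
    by rewrite leq_mul2r leq_add2l h1 orbT.
  by rewrite addnn -mul2n -mulnA leq_mul2l/= leq_trunc_div.
have JR : 0 < J%:R :> R by rewrite ltr0n.
have nR : 0 < n%:R :> R by rewrite ltr0n.
have l1R : 1 <= l0%:R :> R by rewrite ler1n.
(* Immediate for every block length, since kap < 1 and x >= 1. *)
have ad : l0%:R `^ kap <= l0%:R * X ^+ 2.
  rewrite (@le_trans _ _ l0%:R)//.
    by rewrite ler1_powR// ltW//; case/andP: kap01.
  by rewrite ler_peMr// -[leLHS](expr1n _ 2) lerXn2r ?nnegrE.
(* There are J + 1 starting points: time s = 1 corresponds to j = J. *)
pose JT := ('I_J.+1 * 'I_M)%type.
have [U [mU U0 hU EU]] := @finite_family {: JT} (fun p => f p.2) (fun p => (n * p.1 %/ J).+1)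
  x l0 (fun p => mf p.2) x0 (fun p => fx p.2) (fun=> isT) (ltn0Sn _) ad.
pose r := Num.sqrt l0%:R / Num.sqrt n%:R : R.
have sn0 : 0 < Num.sqrt n%:R :> R by rewrite sqrtr_gt0.
have r0 : 0 <= r by rewrite divr_ge0// ?sqrtr_ge0.
exists (fun w => r * U w); split.
- exact: measurable_funM.
- by move=> w; rewrite mulr_ge0.
- move=> i j l w jJ /andP[h1 h2]; rewrite psum_sub// mulrA /r mulrCA divff ?gt_eqF// mulr1.
  have jJ' : (j < J.+1)%N by [].
  by apply: (hU (Ordinal jJ', i)); rewrite leq_subLR.
under eq_integral do rewrite EFinM.
have mUE : measurable_fun setT (fun w => (U w)%:E) by exact/measurable_EFinP.
have UE0 w : setT w -> (0 <= (U w)%:E)%E by rewrite lee_fin.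
rewrite ge0_integralZl//.
have rE : (0 <= r%:E)%E by rewrite lee_fin.
apply: (le_trans (lee_wpmul2l rE EU)); rewrite -EFinM lee_fin.
have rJ : r <= 2 * J%:R `^ (- 2^-1).
  have rr : r ^+ 2 <= 4 * J%:R^-1.
    rewrite /r expr_div_n !sqr_sqrtr// ler_pdivrMr// mulrAC ler_pdivlMr//.
    rewrite -natrM (@le_trans _ _ (2 * n)%:R) ?ler_nat//.
    by rewrite natrM ler_wpM2r// ler_nat.
  have -> : 2 * J%:R `^ (- 2^-1) = Num.sqrt (4 * J%:R^-1) :> R.
    rewrite sqrtrM// powRN powR12_sqrt// sqrtrV//; congr (_ * _).
    by rewrite -[4%R]/((2 * 2)%:R) natrM -expr2 sqrtr_sqr ger0_norm.
  by rewrite -[leLHS](ger0_norm r0) -sqrtr_sqr ler_sqrt// mulr_ge0// invr_ge0.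
have cJ : #|{: JT}|%:R `^ Q%:R^-1 <= J%:R `^ 4^-1 * (2 * M.+1%:R) :> R.
  have c1 : 1 <= J%:R * (2 * M.+1%:R) :> R.
    by rewrite -natrM -natrM ler1n.
  apply: (@le_trans _ _ ((J%:R * (2 * M.+1%:R)) `^ Q%:R^-1)).
    rewrite ge0_ler_powR ?nnegrE ?invr_ge0 ?mulr_ge0//.
    rewrite card_prod !card_ord -!natrM ler_nat mulnA leq_mul// ?leqnSn//.
    by rewrite muln2 -addnn -addn1 leq_add2l.
  apply: (@le_trans _ _ ((J%:R * (2 * M.+1%:R)) `^ 4^-1)).
    by rewrite ler_powR// lef_pV2 ?posrE ?ler_nat// ltr0n (leq_trans _ Q_ge4).
  rewrite powRM ?mulr_ge0// ler_wpM2l ?powR_ge0// ler1_powR//; last by lra.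
  by rewrite -natrM ler1n.
have CX0 : 0 <= 2 * C * X by rewrite !mulr_ge0// ltW.
apply: (@le_trans _ _ ((2 * J%:R `^ (- 2^-1)) * (2 * C * X * (J%:R `^ 4^-1 * (2 * M.+1%:R))))).
  by apply: ler_pM => //; [rewrite mulr_ge0 ?powR_ge0|rewrite ler_wpM2l].
have -> : (2 * J%:R `^ (- 2^-1)) * (2 * C * X * (J%:R `^ 4^-1 * (2 * M.+1%:R))) =
   B * (J%:R `^ (- 2^-1) * J%:R `^ 4^-1) by rewrite /B; ring.
rewrite -powRD; last by rewrite (gt_eqF JR) implybT.
have -> : - 2^-1 + 4^-1 = - 4^-1 :> R by lra.
rewrite powRN ler_pdivrMr ?powR_gt0// mulrC -ler_pdivrMr//.
Qed.

End chaining.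

(** * Bracketing entropy and mixing rates *)

Section lower_sums.
Context {R : realType} {d : measure_display} {T : measurableType d}.
Variable mu : {measure set T -> \bar R}.
Import HBNNSimple.

(* No measurability is required of [f]: the integral of a nonnegative function
   is the supremum of the integrals of the simple functions below it. *)
Lemma integral_nnsfun_le (D : set T) (h : {nnsfun T >-> R}) (f : T -> \bar R) :
  (forall x, D x -> (0 <= f x)%E) -> (forall x, ((h x)%:E <= (f \_ D) x)%E) ->
  (\int[mu]_x (h x)%:E <= \int[mu]_(x in D) f x)%E.
Proof.
move=> f0 hf; rewrite [leRHS]ge0_integralE// integral_nnsfun// patch_setT.
by apply: ereal_sup_ubound; exists h.
Qed.

End lower_sums.

Section entropy_integral.
Context {R : realType}.
Variables (theta : R) (Q : nat) (N : nat -> nat) (br : R -> \bar R).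
Hypothesis theta_gt2 : 2 < theta.
Hypothesis br_ge0 : forall x, (0 <= br x)%E.
Hypothesis br_antitone : forall x y, 0 < x -> x <= y -> (br y <= br x)%E.
Hypothesis br_scale : forall k, br (scale k) = ((N k)%:R)%:E.
Import HBNNSimple.

Let cell (k : nat) : set R := `]scale k.+1, scale k]%classic.

Let mcell k : measurable (cell k : set (measurableTypeR R)).
Proof. exact: measurable_itv. Qed.

(** The integrand at the right end of [cell k], its least value there because both factors are
    antitone. *)
Let weight k : R := scale k `^ (- (1 - 2 / theta)) * (N k)%:R `^ Q%:R^-1.

Let weight_ge0 k : 0 <= weight k. Proof. by rewrite mulr_ge0 ?powR_ge0. Qed.

Let scale_ltS k : scale k.+1 < scale k :> R.
Proof. by rewrite /scale ltf_pV2 ?posrE ?exprn_gt0// ltr_eXn2l// ltr1n. Qed.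

Let scale_anti k l : (k <= l)%N -> scale l <= scale k :> R.
Proof.
by move=> kl; rewrite /scale lef_pV2 ?posrE ?exprn_gt0// ler_weXn2l// ler1n.
Qed.

Let cell_disjoint k l x : cell k x -> cell l x -> k = l.
Proof.
rewrite /cell /= !in_itv/= => /andP[a1 a2] /andP[b1 b2].
have [kl|lk|//] := ltngtP k l.
  by have := lt_le_trans a1 (le_trans b2 (scale_anti kl)); rewrite ltxx.
by have := lt_le_trans b1 (le_trans a2 (scale_anti lk)); rewrite ltxx.
Qed.

Let weight_le k x : cell k x ->
  ((weight k)%:E <= (x `^ (- (1 - 2 / theta)))%:E * br x `^ Q%:R^-1)%E.
Proof.
rewrite /cell /= in_itv/= => /andP[x1 x2].
have x0 : 0 < x by apply: lt_trans x1; exact: scale_gt0.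
rewrite /weight EFinM -[X in (_ * X <= _)%E]poweR_EFin; apply: lee_pmul.
- by rewrite lee_fin powR_ge0.
- exact: poweR_ge0.
- rewrite lee_fin !powRN lef_pV2 ?posrE ?powR_gt0 ?scale_gt0//.
  rewrite ge0_ler_powR ?nnegrE ?(ltW x0) ?(ltW (scale_gt0 _))//.
  rewrite subr_ge0 ler_pdivrMr ?mul1r ?ltW//.
  exact: lt_trans theta_gt2.
- rewrite -br_scale gt0_ler_poweR ?invr_ge0//.
  + by rewrite in_itv/= br_ge0 leey.
  + by rewrite in_itv/= br_ge0 leey.
  + exact: br_antitone.
Qed.

Lemma entropy_bounded_of_integral :
  (\int[lebesgue_measure]_(x in `]0%R, 1%R])
      ((x `^ (- (1 - 2 / theta)))%:E * br x `^ (Q%:R^-1)) < +oo)%E ->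
  exists B, forall K, \sum_(0 <= k < K) entropy_term theta Q N k <= B.
Proof.
set I := (\int[_]_(x in _) _)%E => Ioo.
have I0 : (0 <= I)%E.
  by apply: integral_ge0 => x _; rewrite mule_ge0 ?lee_fin ?powR_ge0// poweR_ge0.
have Ifin : I \is a fin_num by rewrite ge0_fin_numE.
(* [cell k] has length scale k.+1, half of scale k, so each entropy term is twice the integral of
   the step function [h] over its cell. *)
exists (2 * fine I) => K.
pose h := sum_nnsfun (fun k => scale_nnsfun (indic_nnsfun R (mcell k)) (weight_ge0 k)) K.
have hE x : h x = \sum_(k < K) weight k * \1_(cell k) x.
  by rewrite /h sum_nnsfunE; apply: eq_bigr => k _.
have hI : (\int[lebesgue_measure]_x (h x)%:E <= I)%E.
  apply: integral_nnsfun_le => [x _|x].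
    by rewrite mule_ge0 ?lee_fin ?powR_ge0// poweR_ge0.
  rewrite hE patchE; case: ifPn => xD.
    have [[k ck]|nc] := pselect (exists k : 'I_K, cell k x).
      rewrite (bigD1 k)//= big1 ?addr0.
        by rewrite indicE mem_set// mulr1; exact: weight_le.
      move=> l lk; rewrite indicE memNset ?mulr0// => cl.
      by move/eqP: lk; apply; apply/val_inj; exact: cell_disjoint cl ck.
    rewrite big1 ?mule_ge0 ?lee_fin ?powR_ge0 ?poweR_ge0// => l _.
    by rewrite indicE memNset ?mulr0// => cl; apply: nc; exists l.
  rewrite big1// => l _; rewrite indicE memNset ?mulr0// => cl.
  move/negP: xD; apply; rewrite inE/= in_itv/=.
  move: cl; rewrite /cell /= in_itv/= => /andP[c1 c2].
  rewrite (lt_trans _ c1) ?scale_gt0//= (le_trans c2)//.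
  by rewrite (le_trans (scale_anti (leq0n l)))// /scale expr0 invr1.
have hint : (\int[lebesgue_measure]_x (h x)%:E = (\sum_(k < K) weight k * scale k.+1)%:E)%E.
  under eq_integral do rewrite hE -sumEFin.
  rewrite ge0_integral_sum//=; last 2 first.
  - by move=> k; apply/measurable_EFinP; apply: measurable_funM.
  - by move=> k x _; rewrite lee_fin mulr_ge0.
  rewrite -sumEFin; apply: eq_bigr => k _.
  under eq_integral do rewrite EFinM.
  have mi : measurable_fun setT (fun x : measurableTypeR R => (\1_(cell k) x)%:E : \bar R).
    by apply/measurable_EFinP; exact: measurable_indic.
  have i0 (x : measurableTypeR R) : setT x -> (0 <= (\1_(cell k) x)%:E :> \bar R)%E.
    by move=> _; rewrite lee_fin.
  have w0 : (0 <= (weight k)%:E)%E by rewrite lee_fin.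
  rewrite ge0_integralZl//.
  have mk : lebesgue_measure (cell k) = (scale k.+1)%:E :> \bar R.
    rewrite /cell lebesgue_measure_itv/= lte_fin scale_ltS -EFinD; congr EFin.
    rewrite /scale exprS invfM; set a := (2 ^+ k)^-1; lra.
  have -> : (\int[lebesgue_measure]_x (\1_(cell k) x)%:E = (scale k.+1)%:E :> \bar R)%E.
    by rewrite integral_indic// setIT; exact: mk.
  by rewrite EFinM.
move: hI; rewrite hint -(fineK Ifin) lee_fin big_mkord => hI.
have -> : \sum_(i < K) entropy_term theta Q N i = 2 * \sum_(k < K) weight k * scale k.+1.
  rewrite mulr_sumr; apply: eq_bigr => k _.
  rewrite /entropy_term /rate /weight.
  have -> : scale k.+1 = scale k / 2 :> R by rewrite /scale exprS invfM mulrC.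
  have -> : scale k `^ (2 / theta) = scale k `^ (- (1 - 2 / theta)) * scale k.
    rewrite -{3}(powRr1 (ltW (scale_gt0 k))) -powRD; last by rewrite (gt_eqF (scale_gt0 k)) implybT.
    by congr (_ `^ _); ring.
  by field.
by rewrite ler_wpM2l.
Qed.

End entropy_integral.

Section mixing_coefficients.
Context {R : realType} {d dE : measure_display} {T : measurableType d}
  {E : measurableType dE}.
Variables (P : probability T R) (Y : nat -> T -> E).
Hypothesis mY : forall i, measurable_fun setT (Y i).

Lemma sigma_gen_sub J A : sigma_gen Y J A -> measurable A.
Proof.
move: A; apply: smallest_sub; first exact: sigma_algebra_measurable.
by move=> A [j _ [B mB <-]]; apply: mY.
Qed.

Lemma probability_cov_le1 A B : measurable A -> measurable B ->
  `|fine (P (A `&` B)) - fine (P A) * fine (P B)| <= 1.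
Proof.
move=> mA mB; have pr D : measurable D -> 0 <= fine (P D) <= 1.
  move=> mD; rewrite fine_ge0//=.
  by rewrite -lee_fin fineK ?fin_num_measure// probability_le1.
have := pr _ (measurableI _ _ mA mB); have := pr _ mA; have := pr _ mB.
rewrite ler_norml; nra.
Qed.

Lemma probability_covE A B : measurable A -> measurable B ->
  (`|P (A `&` B) - P A * P B| = `|fine (P (A `&` B)) - fine (P A) * fine (P B)|%:E)%E.
Proof.
move=> mA mB; have mAB := measurableI _ _ mA mB.
rewrite -(fineK (fin_num_measure P _ mA)) -(fineK (fin_num_measure P _ mB)).
by rewrite -(fineK (fin_num_measure P _ mAB)).
Qed.

Local Notation alpha := (alpha_mixing P (fun _ => Y)).

Lemma alpha_mixing_ge0 t : (0 <= alpha t)%E.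
Proof.
rewrite /alpha_mixing; case: ifP => // _; apply: ereal_sup_ubound; exists 0%N => //.
Qed.

Lemma alpha_mixing_le1 t : (alpha t <= 1)%E.
Proof.
rewrite /alpha_mixing; case: ifP => // _; apply: ge_ereal_sup => _ [n _ <-].
rewrite /alpha_row; case: ifP => // _; apply: ge_ereal_sup => _ [k _ <-].
apply: ge_ereal_sup => _ [A gA [B gB <-]].
by rewrite probability_covE ?lee_fin ?probability_cov_le1//; apply: sigma_gen_sub; [exact: gA|exact: gB|exact: gA|exact: gB].
Qed.

Lemma alpha_mixing_bound k t n A B : (0 < k)%N -> (k + t <= n)%N ->
  sigma_gen Y [set j | (1 <= j <= k)%N] A ->
  sigma_gen Y [set j | (k + t <= j <= n)%N] B ->
  `|fine (P (A `&` B)) - fine (P A) * fine (P B)| <= fine (alpha t).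
Proof.
move=> k0 ktn gA gB; have mA := sigma_gen_sub gA; have mB := sigma_gen_sub gB.
have [t0|t0] := eqVneq t 0%N.
  by rewrite t0 /alpha_mixing eqxx /= probability_cov_le1.
have fa : alpha t \is a fin_num.
  by rewrite ge0_fin_numE ?alpha_mixing_ge0// (le_lt_trans (alpha_mixing_le1 t))// ltry.
rewrite -lee_fin fineK// -probability_covE// /alpha_mixing (negbTE t0).
have tn : (t < n)%N by apply: leq_trans ktn; rewrite -add1n leq_add2r.
apply: (@le_trans _ _ (alpha_row P (fun _ => Y) n t)); last first.
  by apply: ereal_sup_ubound; exists n.
rewrite /alpha_row tn; apply: le_trans; last first.
  apply: ereal_sup_ubound; exists k => //=; rewrite k0/=.
  by rewrite leq_subRL ?(ltnW tn)// addnC.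
apply: ereal_sup_ubound => /=; exists A => //; by exists B.
Qed.

(** The covariance inequality divides by the mixing coefficient, which may vanish. Taking the
    maximum with the positive sequence [c], whose weighted sum is at most 2, makes the rate positive
    and keeps it summable. *)
Lemma mixing_rates (Q : nat) (k' : R) : 0 < k' ->
  (\sum_(1 <= t <oo) ((t%:R ^+ (Q - 2))%:E * alpha t `^ k') < +oo)%E ->
  exists v V, [/\ forall t, 0 < v t, forall t, v t <= 1,
    forall n, \sum_(0 <= r < n) r.+1%:R ^+ (Q - 2) * v r <= V &
    forall k t n A B, (0 < k)%N -> (k + t <= n)%N ->
      sigma_gen Y [set j | (1 <= j <= k)%N] A ->
      sigma_gen Y [set j | (k + t <= j <= n)%N] B ->
      `|fine (P (A `&` B)) - fine (P A) * fine (P B)| <= v t `^ k'^-1].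
Proof.
move=> k0 Soo; pose al t := fine (alpha t).
have fa t : alpha t \is a fin_num.
  by rewrite ge0_fin_numE ?alpha_mixing_ge0// (le_lt_trans (alpha_mixing_le1 t))// ltry.
have al0 t : 0 <= al t by rewrite fine_ge0// alpha_mixing_ge0.
have al1 t : al t <= 1 by rewrite -lee_fin fineK// alpha_mixing_le1.
pose c t : R := (2 ^+ t)^-1 / t.+1%:R ^+ (Q - 2).
have c0 t : 0 < c t by rewrite divr_gt0 ?invr_gt0 ?exprn_gt0.
have t1 t : 1 <= t.+1%:R ^+ (Q - 2) :> R by rewrite exprn_ege1// ler1n.
have c1 t : c t <= 1.
  rewrite /c ler_pdivrMr ?exprn_gt0// mul1r (le_trans _ (t1 t))//.
  by rewrite invf_le1 ?exprn_gt0// exprn_ege1// ler1n.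
pose v t := Num.max (al t `^ k') (c t).
set SS := (\sum_(1 <= t <oo) _)%E in Soo.
have term0 t : (0 <= (t%:R ^+ (Q - 2))%:E * alpha t `^ k')%E.
  by rewrite mule_ge0 ?lee_fin ?exprn_ge0// poweR_ge0.
have SS0 : (0 <= SS)%E by apply: nneseries_ge0 => t _ _; exact: term0.
have Sfin : SS \is a fin_num by rewrite ge0_fin_numE.
have part n : \sum_(1 <= t < n) t%:R ^+ (Q - 2) * al t `^ k' <= fine SS.
  rewrite -lee_fin fineK//.
  apply: (@le_trans _ _ (\sum_(1 <= t < n) ((t%:R ^+ (Q - 2))%:E * alpha t `^ k'))%E).
    rewrite -sumEFin; apply: lee_sum => t _.
    by rewrite EFinM -[X in (_ * X <= _)%E]poweR_EFin fineK.
  exact: nneseries_lim_ge.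
(* The 1 is the term r = 0, where the coefficient is 1; the power of 2 comes from t + 1 <= 2 t for t
   >= 1; the last 2 bounds the sum of the padding [c]. *)
exists v, (1 + 2 ^+ (Q - 2) * fine SS + 2); split.
- by move=> t; rewrite lt_max c0 orbT.
- move=> t; rewrite ge_max c1 andbT.
  have [->|an] := eqVneq (al t) 0; first by rewrite powR0 ?gt_eqF.
  by rewrite -[leRHS](powRr0 (al t)) ger_powR ?lt_neqAle 1?eq_sym ?an ?al0 ?al1// ltW.
- move=> n.
  have cs : \sum_(0 <= r < n) r.+1%:R ^+ (Q - 2) * c r <= 2.
    have -> : \sum_(0 <= r < n) r.+1%:R ^+ (Q - 2) * c r = 2 - 2 / 2 ^+ n.
      elim: n => [|n IH]; first by rewrite big_geq// expr0 divr1 subrr.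
      rewrite big_nat_recr//= IH /c mulrCA mulfV ?gt_eqF ?exprn_gt0// mulr1 exprS invfM.
      set x := (2 ^+ n)^-1; lra.
    by rewrite gerBl divr_ge0// exprn_ge0.
  have as' : \sum_(0 <= r < n) r.+1%:R ^+ (Q - 2) * al r `^ k' <= 1 + 2 ^+ (Q - 2) * fine SS.
    have S0 : 0 <= 2 ^+ (Q - 2) * fine SS by rewrite mulr_ge0 ?exprn_ge0 ?fine_ge0.
    case: n {cs} => [|n]; first by rewrite big_geq// addr_ge0.
    rewrite big_ltn// lerD//.
      rewrite expr1n mul1r /al /alpha_mixing eqxx/= powR1//.
    apply: (@le_trans _ _ (2 ^+ (Q - 2) * \sum_(1 <= t < n.+1) t%:R ^+ (Q - 2) * al t `^ k')).
      rewrite mulr_sumr big_nat [leRHS]big_nat; apply: ler_sum => t /andP[t0 _].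
      rewrite mulrA ler_wpM2r ?powR_ge0// -exprMn lerXn2r ?nnegrE//.
      by rewrite -natrM ler_nat mul2n -addnn -addn1 leq_add2l.
    by rewrite ler_wpM2l// exprn_ge0.
  apply: (@le_trans _ _ (\sum_(0 <= r < n) (r.+1%:R ^+ (Q - 2) * al r `^ k' + r.+1%:R ^+ (Q - 2) * c r))).
    apply: ler_sum => r _; rewrite -mulrDr ler_wpM2l ?exprn_ge0// ge_max.
    by rewrite lerDl (ltW (c0 r)) lerDr powR_ge0.
  by rewrite big_split/= lerD.
- move=> k t n A B kp ktn gA gB; rewrite (le_trans (alpha_mixing_bound kp ktn gA gB))//.
  have -> : fine (alpha t) = (al t `^ k') `^ k'^-1.
    by rewrite -powRrM mulfV ?gt_eqF// powRr1.
  by rewrite ge0_ler_powR ?nnegrE ?powR_ge0 ?invr_ge0 ?(ltW k0)// le_max ?powR_ge0 ?lexx.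
Qed.

End mixing_coefficients.

Lemma stationary_integral {R : realType} {d dE : measure_display} {T : measurableType d}
    {E : measurableType dE} (P : probability T R) (X : int -> {RV P >-> E}) :
  strictly_stationary P X -> forall (i : int) (g : E -> R), measurable_fun setT g ->
  (forall x, 0 <= g x) ->
  (\int[P]_w (g (X i w))%:E = \int[P]_w (g (X 1 w))%:E)%E.
Proof.
move=> st i g mg g0.
have mgE : measurable_fun setT (fun y => (g y)%:E) by exact/measurable_EFinP.
have g0E y : (0 <= (g y)%:E)%E by rewrite lee_fin.
have h1 := ge0_integral_distribution (X i) mgE g0E.
have h2 := ge0_integral_distribution (X 1) mgE g0E.
rewrite -[LHS]h1 -[RHS]h2; apply: eq_measure_integral => A mA _.
have mA' : measurable [set u : 1.-tuple E | A (tnth u ord0)].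
  by rewrite -[X in measurable X]setTI; exact: (measurable_tnth ord0 measurableT mA).
have := st (i - 1) 1%N [tuple 1] _ mA'; rewrite /fidi /pushforward.
rewrite /distribution /pushforward.
rewrite (_ : _ @^-1` _ = X i @^-1` A); last first.
  by apply/seteqP; split => w /=; rewrite tnth_mktuple (tnth_nth 0)/= addrC subrK.
rewrite (_ : (fun w => [tuple X (tnth [tuple 1] i0) w | i0 < 1]) @^-1` _ = X 1 @^-1` A)//.
by apply/seteqP; split => w /=; rewrite tnth_mktuple (tnth_nth 0)/=.
Qed.

Section bracketing_facts.
Context {R : realType} {d : measure_display} {E : measurableType d}
  (F : set (E -> R)) (rho : (E -> R) -> \bar R).

Lemma bracketing_number_ge0 x : (0 <= bracketing_number F rho x)%E.
Proof. by apply: le_ereal_inf_tmp => _ [N _ <-]; rewrite lee_fin. Qed.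

Lemma bracketing_number_antitone x y : x <= y ->
  (bracketing_number F rho y <= bracketing_number F rho x)%E.
Proof.
move=> xy; apply: le_ereal_inf => _ [N [B [A [c AF Bx cov']]] <-]; exists N => //.
exists B, A; split => // b /Bx[mb bx]; split => //.
by rewrite (lt_le_trans bx)// lee_fin.
Qed.

Lemma card_eq_enum (S : pointedType) (A : set S) N : (A #= `I_N)%card ->
  exists e : 'I_N -> S, (forall i, A (e i)) /\ forall x, A x -> exists i, e i = x.
Proof.
rewrite card_eq_sym => /card_set_bijP[f [fA _ fs]].
exists f; split; first by move=> i; apply: fA => /=.
by move=> x /fs[k /= kN <-]; exists (Ordinal kN).
Qed.

End bracketing_facts.

Lemma poweR_half_le {R : realType} (y : \bar R) (eps : R) : (0 <= y)%E -> 0 <= eps ->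
  (y `^ 2^-1 <= eps%:E)%E -> (y <= (eps ^+ 2)%:E)%E.
Proof.
move=> y0 e0 h.
have -> : y = ((y `^ 2^-1) `^ 2)%E by rewrite -poweRrM mulVf// poweRe1.
rewrite -powR_mulrn// -poweR_EFin; apply: gt0_ler_poweR => //.
- by rewrite in_itv/= poweR_ge0 leey.
- by rewrite in_itv/= lee_fin e0 leey.
Qed.

(** From j/J <= s < (j+1)/J one gets n s <= n j / J + n / J, and the integer part of a sum exceeds
    the sum of the integer parts by at most 1. *)
Lemma truncn_grid {R : realType} (s : R) (J n : nat) : (0 < J)%N -> 0 <= s <= 1 ->
  let j := Num.truncn (s * J%:R) in
  [/\ (j <= J)%N, Num.truncn (n%:R * (j%:R / J%:R) : R) = (n * j %/ J)%N &
    (n * j %/ J <= Num.truncn (n%:R * s) <= n * j %/ J + (n %/ J).+1)%N].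
Proof.
move=> J0 /andP[s0 s1] j.
have JR : 0 < J%:R :> R by rewrite ltr0n.
have n0 : 0 <= n%:R :> R by rewrite ler0n.
have sJ0 : 0 <= s * J%:R by rewrite mulr_ge0// ltW.
have /andP[jl ju] : j%:R <= s * J%:R < j.+1%:R by exact: truncn_itv.
have jJ : (j <= J)%N by rewrite -(ler_nat R) (le_trans jl)// ler_piMl// ltW.
have floorE a : (a %/ J)%:R * J%:R <= a%:R :> R /\ a%:R < (a %/ J).+1%:R * J%:R :> R.
  by rewrite -!natrM ler_nat ltr_nat leq_trunc_div ltn_ceil.
have [ql qu] := floorE (n * j)%N; have [rl ru] := floorE n.
rewrite natrM in ql qu.
have tE : Num.truncn (n%:R * (j%:R / J%:R) : R) = (n * j %/ J)%N.
  by apply: truncn_def; rewrite mulrA ler_pdivlMr// ltr_pdivrMr// ql qu.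
have js : j%:R / J%:R <= s by rewrite ler_pdivrMr.
split => //; apply/andP; split.
  by rewrite -tE; apply: le_truncn; rewrite ler_wpM2l.
rewrite -ltnS -(ltr_nat R).
have ns0 : 0 <= n%:R * s by rewrite mulr_ge0.
have /andP[tl _] := truncn_itv ns0; apply: (le_lt_trans tl).
rewrite -(ltr_pM2r JR) (@le_lt_trans _ _ (n%:R * j%:R + n%:R))//.
  rewrite -mulrA -[X in _ + X]mulr1 -mulrDr ler_wpM2l//.
  by rewrite ltW// (lt_le_trans ju)// -addn1 natrD.
by rewrite (lt_le_trans (ltrD qu ru))// -mulrDl -natrD addSn.
Qed.

Lemma abs_momentE {R : realType} {d : measure_display} {T : measurableType d}
    (P : probability T R) (Y : T -> R) p :
  abs_moment P Y p = (\int[P]_w (`|Y w| `^ p)%:E)%E.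
Proof. by rewrite /abs_moment unlock. Qed.

Section bracketing_choice.
Context {R : realType} {d dE : measure_display} {T : measurableType d}
  {E : measurableType dE} (P : probability T R) (Z : T -> E) (F : set (E -> R)).
Variables (theta : R) (Q : nat).

Lemma bracketing_sequence :
  (forall eps : R, 0 < eps -> exists N B A,
    [/\ bracketing_number F (L2_norm_at P Z) eps = (N%:R)%:E,
        is_bracketing F (L2_norm_at P Z) eps N B A &
        forall i : nat, (2 <= i <= Q)%N -> forall b, B b ->
          (abs_moment P (b \o Z) (i%:R * (theta / 2)) `^ 2^-1 <= eps%:E)%E]) ->
  exists (N : nat -> nat) (a b : forall k, 'I_(N k) -> E -> R),
  [/\ forall k, bracketing_number F (L2_norm_at P Z) (scale k) = (N k)%:R%:E,
      forall k i, F (a k i),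
      forall k phi, F phi -> exists i j, forall x, `|phi x - a k i x| <= b k j x &
      forall k j, [/\ measurable_fun setT (b k j),
        forall q, (2 <= q <= Q)%N ->
          (\int[P]_w (`|b k j (Z w)| `^ (q%:R * (theta / 2)))%:E <= (scale k ^+ 2)%:E)%E &
        (\int[P]_w (`|b k j (Z w)| `^ 2)%:E <= (scale k ^+ 2)%:E)%E]].
Proof.
move=> brk.
have H k : {N : nat & {a : 'I_N -> E -> R & {b : 'I_N -> E -> R |
  [/\ bracketing_number F (L2_norm_at P Z) (scale k) = N%:R%:E,
      forall i, F (a i),
      forall phi, F phi -> exists i j, forall x, `|phi x - a i x| <= b j x &
      forall j, [/\ measurable_fun setT (b j),
        forall q, (2 <= q <= Q)%N ->
          (\int[P]_w (`|b j (Z w)| `^ (q%:R * (theta / 2)))%:E <= (scale k ^+ 2)%:E)%E &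
        (\int[P]_w (`|b j (Z w)| `^ 2)%:E <= (scale k ^+ 2)%:E)%E]]}}}.
  have sk0 : 0 <= scale k :> R by rewrite ltW// scale_gt0.
  have /cid[N /cid[B /cid[A [NE [[cB cA] AF mB cov] mom]]]] := brk _ (scale_gt0 (R := R) k).
  have [b [bB bS]] := cid (card_eq_enum cB).
  have [a [aA aS]] := cid (card_eq_enum cA).
  exists N, a, b; split => //.
  - by move=> i; apply: AF; exact: aA.
  - move=> phi /cov[a' [b' [/aS[i <-] /bS[j <-] h]]]; by exists i, j.
  - move=> j; have [mbj bL2] := mB _ (bB j); split => //.
      move=> q qQ; rewrite -abs_momentE; apply: poweR_half_le => //; last exact: mom.
      by rewrite abs_momentE; apply: integral_ge0 => w _; rewrite lee_fin powR_ge0.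
    rewrite -(abs_momentE P (b j \o Z)); apply: poweR_half_le => //; last exact: ltW.
    by rewrite abs_momentE; apply: integral_ge0 => w _; rewrite lee_fin powR_ge0.
exists (fun k => projT1 (H k)), (fun k => projT1 (projT2 (H k))),
  (fun k => sval (projT2 (projT2 (H k)))).
by split=> k; have [] := svalP (projT2 (projT2 (H k))).
Qed.

End bracketing_choice.

(** * Weak convergence in l^oo by finite approximation *)

Section discretization.
Context {R : realType} {d : measure_display} {T : measurableType d}.

Definition grid (m : nat) (x : R) : int := Num.floor (m.+1%:R * x).

Lemma measurable_grid_eq m (f : T -> R) (z : int) : measurable_fun setT f ->
  measurable [set w | grid m (f w) = z].
Proof.
move=> mf; rewrite [X in measurable X](_ : _ = setT `&`
  (fun w => m.+1%:R * f w) @^-1` (`[z%:~R, (z + 1)%:~R[%classic : set R)).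
  have mg : measurable_fun setT (fun w => m.+1%:R * f w) by apply: measurable_funM.
  by apply: mg => //; exact: measurable_itv.
apply/seteqP; split => w /=; rewrite in_itv/= /grid.
  by move=> <-; split => //; exact: floor_itv.
by move=> [_ h]; exact: floor_def.
Qed.

(** [S] and [A] are arbitrary: a function of finitely many integer-valued variables takes countably
    many values, so every preimage is measurable. This sidesteps the lack of separability of
    l^oo. *)
Lemma measurable_preimage_grid (S : Type) K m (f : 'I_K -> T -> R)
    (phi : {ffun 'I_K -> int} -> S) (A : set S) :
  (forall k, measurable_fun setT (f k)) ->
  measurable [set w | A (phi [ffun k => grid m (f k w)])].
Proof.
move=> mf; rewrite [X in measurable X](_ : _ = \bigcup_(z : {ffun 'I_K -> int})
   ((\bigcap_(k in [set: 'I_K]) [set w | grid m (f k w) = z k]) `&`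
    [set w | A (phi z)])).
  apply: countable_bigcupT_measurable; first exact: countableP.
  move=> z; apply: measurableI.
    by apply: fin_bigcap_measurable => // k _; exact: measurable_grid_eq.
  case: (pselect (A (phi z))) => Az.
    by rewrite (_ : [set w | _] = setT)//; apply/seteqP; split.
  by rewrite (_ : [set w | _] = set0)//; apply/seteqP; split.
apply/seteqP; split => w /=.
  move=> Aw; exists [ffun k => grid m (f k w)] => //; split => //.
  by move=> k _ /=; rewrite ffunE.
move=> [z _ [zk Az]].
suff -> : [ffun k => grid m (f k w)] = z by [].
by apply/ffunP => k; rewrite ffunE; exact: zk.
Qed.

Definition grid_row K m (z : {ffun 'I_K -> int}) : 'rV[R]_K :=
  \row_k ((z k)%:~R / m.+1%:R).

Definition row_of K (f : 'I_K -> T -> R) (w : T) : 'rV[R]_K := \row_k f k w.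

Definition grid_row_of K m (f : 'I_K -> T -> R) (w : T) : 'rV[R]_K :=
  grid_row m [ffun k => grid m (f k w)].

Lemma grid_row_of_close K m (f : 'I_K -> T -> R) w k :
  `|grid_row_of m f w 0 k - row_of f w 0 k| <= m.+1%:R^-1.
Proof.
rewrite /grid_row_of /grid_row /row_of !mxE ffunE /grid.
have m0 : 0 < m.+1%:R :> R by rewrite ltr0n.
set x := f k w; have /andP[h1 h2] := floor_itv (m.+1%:R * x).
rewrite intrD in h2.
rewrite -(ler_pM2l m0) mulfV ?gt_eqF// -[X in X * _]gtr0_norm// -normrM mulrBr mulrC mulfVK ?gt_eqF//.
rewrite ler_norml; move: h1 h2; lra.
Qed.

(** Lipschitz for the largest entry, expressed by a common bound [e] so that no norm on rows is
    involved. *)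
Definition entry_lipschitz K (h : 'rV[R]_K -> R) (L : R) :=
  forall (u v : 'rV[R]_K) (e : R), 0 <= e -> (forall k, `|u 0 k - v 0 k| <= e) -> `|h u - h v| <= L * e.

(** Pointwise limit of the same function of the entries rounded to finer and finer grids. *)
Lemma measurable_entry_lipschitz K (h : 'rV[R]_K -> R) L (f : 'I_K -> T -> R) :
  0 <= L -> entry_lipschitz h L -> (forall k, measurable_fun setT (f k)) ->
  measurable_fun setT (fun w => h (row_of f w)).
Proof.
move=> L0 hL mf.
apply: (measurable_fun_cvg (h := fun m w => h (grid_row_of m f w))).
  move=> m _ B mB; rewrite setTI.
  exact: (measurable_preimage_grid m (h \o @grid_row K m) B mf).
move=> w _; apply/cvgrPdist_le => e e0; near=> m.
rewrite distrC (le_trans (hL _ _ m.+1%:R^-1 _ _))//.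
  by move=> k; exact: grid_row_of_close.
rewrite ler_pdivrMr ?ltr0n// mulrC -ler_pdivrMr//.
rewrite (le_trans (ltW (truncnS_gt _)))// ler_nat ltnS.
near: m; exact: nbhs_infty_ge.
Unshelve. all: by end_near. Qed.

Lemma entry_lipschitz_continuous K (h : 'rV[R]_K -> R) L : 0 <= L ->
  entry_lipschitz h L -> continuous h.
Proof.
move=> L0 hL v; apply/(@cvgrPdist_le _ _ _ _ (nbhs_filter v)) => e e0.
have d0 : 0 < e / (L + 1) by rewrite divr_gt0// ltr_wpDl.
have := nbhsx_ballx v _ d0; apply: filterS => u vu.
rewrite (le_trans (hL _ _ (e / (L + 1)) (ltW d0) _))//.
  have vu' : forall i j, ball (v i j) (e / (L + 1)) (u i j) by case: vu.
  by move=> k; have := vu' 0 k; rewrite /ball/= => /ltW.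
rewrite mulrA ler_pdivrMr ?ltr_wpDl// mulrC ler_wpM2l ?(ltW e0)//.
by rewrite lerDl.
Qed.

End discretization.

Section linfty_facts.
Context {R : realType} {I : Type}.
Local Notation linf := (linfty R I).

Lemma linftyB (f g : linf) t : (f - g) t = f t - g t.
Proof. by []. Qed.

Lemma le_linf_norm (f : linf) t : `|f t| <= `|f|.
Proof. exact: le_linfty_norm. Qed.

Lemma linf_norm_le (f : linf) M : 0 <= M -> (forall t, `|f t| <= M) -> `|f| <= M.
Proof. exact: linfty_norm_le. Qed.

Definition to_linfty (f : I -> R) (b : exists M, forall t, `|f t| <= M) : linf :=
  Linfty (asboolT b : f \in @linfty_pred R I).

Lemma row_bounded K (c : I -> 'I_K) (v : 'rV[R]_K) :
  exists M, forall t, `|v 0 (c t)| <= M.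
Proof.
exists (\sum_k `|v 0 k|) => t; rewrite (bigD1 (c t))//= lerDl.
by apply: sumr_ge0.
Qed.

(** Functions constant on the classes of [c]. The map does not increase distances, so a Lipschitz
    functional on l^oo becomes a Lipschitz test function of finitely many coordinates. *)
Definition lift_row K (c : I -> 'I_K) (v : 'rV[R]_K) : linf :=
  to_linfty (row_bounded c v).

Definition linf_lipschitz (h : linf -> R) (L : R) :=
  forall x y, `|h x - h y| <= L * `|x - y|.

Lemma lift_row_lipschitz K (c : I -> 'I_K) (u v : 'rV[R]_K) e : 0 <= e ->
  (forall k, `|u 0 k - v 0 k| <= e) -> `|lift_row c u - lift_row c v| <= e.
Proof. by move=> e0 uv; apply: linf_norm_le => // t; exact: uv. Qed.

Lemma linf_lipschitz_lift K (c : I -> 'I_K) h L : 0 <= L -> linf_lipschitz h L ->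
  entry_lipschitz (h \o lift_row c) L.
Proof.
move=> L0 hL u v e e0 uv /=; rewrite (le_trans (hL _ _))// ler_wpM2l//.
exact: lift_row_lipschitz.
Qed.

(** Each lower bound u m - C / 2^m lies below each upper bound u k + C / 2^k; the limit is the
    supremum of the former. *)
Lemma geometric_limit (u : nat -> R) (C : R) (M : nat) :
  (forall m k, (M <= m)%N -> (m <= k)%N -> `|u k - u m| <= C / 2 ^+ m) ->
  exists l, forall m, (M <= m)%N -> `|l - u m| <= C / 2 ^+ m.
Proof.
move=> uC; pose A := [set u m - C / 2 ^+ m | m in [set m | (M <= m)%N]].
have ubA k : (M <= k)%N -> ubound A (u k + C / 2 ^+ k).
  move=> Mk _ [m /= Mm <-]; have [mk|km] := leqP m k.
    have /andP[h1 h2] : - (C / 2 ^+ m) <= u k - u m <= C / 2 ^+ m by rewrite -ler_norml uC.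
    have /andP[h3 h4] : - (C / 2 ^+ k) <= u k - u k <= C / 2 ^+ k by rewrite -ler_norml uC.
    lra.
  have /andP[h1 h2] : - (C / 2 ^+ k) <= u m - u k <= C / 2 ^+ k by rewrite -ler_norml uC// ltnW.
  have /andP[h3 h4] : - (C / 2 ^+ m) <= u m - u m <= C / 2 ^+ m by rewrite -ler_norml uC// (leq_trans Mk) // ltnW.
  lra.
have A0 : A !=set0 by exists (u M - C / 2 ^+ M); exists M => //=.
exists (sup A) => m Mm; rewrite ler_norml; apply/andP; split.
  rewrite lerBrDl; apply: ub_le_sup; last by exists m.
  by exists (u m + C / 2 ^+ m); exact: ubA.
rewrite lerBlDl; apply: ge_sup => //; exact: ubA.
Qed.

Lemma linf_geometric_limit (x : nat -> linf) (C : R) (M : nat) : 0 <= C ->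
  (forall m, (M <= m)%N -> `|x m.+1 - x m| <= C / 2 ^+ m) ->
  exists z, forall m, (M <= m)%N -> `|z - x m| <= 2 * C / 2 ^+ m.
Proof.
move=> C0 xC.
have tele m j : (M <= m)%N -> `|x (m + j)%N - x m| <= 2 * C / 2 ^+ m - 2 * C / 2 ^+ (m + j).
  move=> Mm; elim: j => [|j IH]; first by rewrite addn0 !subrr normr0.
  rewrite addnS -(subrKA (x (m + j)%N)) (le_trans (ler_normD _ _))//.
  have := xC (m + j)%N (leq_trans Mm (leq_addr _ _)).
  move=> h; rewrite (le_trans (lerD h IH))// [2 ^+ (_).+1]exprS invfM.
  set a := (2 ^+ (m + j))^-1; set b := (2 ^+ m)^-1; lra.
have tele' m k : (M <= m)%N -> (m <= k)%N -> `|x k - x m| <= 2 * C / 2 ^+ m.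
  move=> Mm mk; rewrite -(subnKC mk) (le_trans (tele _ _ Mm))//.
  by rewrite gerBl divr_ge0// ?mulr_ge0// exprn_ge0.
have [z zE] : exists z : I -> R, forall t m, (M <= m)%N -> `|z t - x m t| <= 2 * C / 2 ^+ m.
  have h t : exists l, forall m, (M <= m)%N -> `|l - x m t| <= 2 * C / 2 ^+ m.
    apply: (@geometric_limit (fun m => x m t)) => m k Mm mk.
    by rewrite -linftyB (le_trans (le_linf_norm _ _))// tele'.
  by exists (fun t => proj1_sig (cid (h t))) => t; exact: (proj2_sig (cid (h t))).
have zb : exists B, forall t, `|z t| <= B.
  exists (2 * C / 2 ^+ M + `|x M|) => t; rewrite -[z t](subrK (x M t)).
  by rewrite (le_trans (ler_normD _ _))// lerD ?zE// le_linf_norm.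
exists (to_linfty zb) => m Mm; apply: linf_norm_le => [|t]; last exact: zE.
by rewrite divr_ge0// ?mulr_ge0// exprn_ge0.
Qed.

(* As [k] grows, these Lipschitz functions increase to [H] if [H] is bounded and
   continuous. *)
Definition lip_reg (H : linf -> R) (k : R) (x : linf) : R :=
  inf (range (fun y => H y + k * `|x - y|)).

Section lip_reg.
Variables (H : linf -> R) (M : R).
Hypothesis HM : forall x, `|H x| <= M.

Let lb k x : 0 <= k -> has_lbound (range (fun y => H y + k * `|x - y|)).
Proof.
move=> k0; exists (- M) => _ [y _ <-]; rewrite -[leLHS]addr0 lerD ?mulr_ge0//.
by have := HM y; rewrite ler_norml => /andP[].
Qed.

Lemma lip_reg_le k x : 0 <= k -> lip_reg H k x <= H x.
Proof.
move=> k0; apply: ge_inf; first exact: lb.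
by exists x => //; rewrite subrr normr0 mulr0 addr0.
Qed.

Lemma lip_reg_ge k x b : (forall y, b <= H y + k * `|x - y|) -> b <= lip_reg H k x.
Proof.
move=> hb; apply: lb_le_inf; first by exists (H x + k * `|x - x|); exists x.
by move=> _ [y _ <-].
Qed.

Lemma lip_reg_bound k x : 0 <= k -> `|lip_reg H k x| <= M.
Proof.
move=> k0; rewrite ler_norml (le_trans (lip_reg_le x k0)).
  rewrite andbT; apply: lip_reg_ge => y; rewrite -[leLHS]addr0 lerD ?mulr_ge0//.
  by have := HM y; rewrite ler_norml => /andP[].
by have := HM x; rewrite ler_norml => /andP[].
Qed.

Lemma lip_reg_lipschitz k : 0 <= k -> linf_lipschitz (lip_reg H k) k.
Proof.
move=> k0 x y.
have h a b : lip_reg H k a <= lip_reg H k b + k * `|a - b|.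
  rewrite -lerBlDr; apply: lip_reg_ge => z; rewrite lerBlDr.
  apply: (@le_trans _ _ (H z + k * `|a - z|)).
    by apply: ge_inf; [exact: lb|exists z].
  by rewrite -addrA lerD2l -mulrDr ler_wpM2l// [leRHS]addrC -(subrKA b a) ler_normD.
have dist_le (u v c : R) : u <= v + c -> v <= u + c -> `|u - v| <= c.
  by rewrite ler_norml; lra.
by apply: dist_le; [|rewrite distrC]; exact: h.
Qed.

(** Points near [x] have values above H x - e; at the others the penalty exceeds 2 M, the largest
    possible drop of [H]. *)
Lemma lip_reg_cvg x : {for x, continuous H} -> forall e, 0 < e ->
  exists n0, forall n, (n0 <= n)%N -> H x - e <= lip_reg H n%:R x.
Proof.
move=> cH e e0.
have /cvgrPdist_lt /(_ e e0) /nbhs_ballP[dl /= d0 hd] := cH.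
have M0 : 0 <= M by exact: le_trans (HM x).
exists (Num.truncn (2 * M / dl)).+1 => n n0n; apply: lip_reg_ge => y.
have hHx := HM x; have hHy := HM y; rewrite !ler_norml in hHx hHy.
have [xy|xy] := ltP `|x - y| dl.
  have := hd y; rewrite -ball_normE/= => /(_ xy); rewrite ltr_norml => h.
  have : 0 <= n%:R * `|x - y| by rewrite mulr_ge0.
  lra.
have : 2 * M <= n%:R * `|x - y|.
  apply: (@le_trans _ _ (n%:R * dl)); last by rewrite ler_wpM2l.
  rewrite -ler_pdivrMr// (le_trans (ltW (truncnS_gt _)))// ler_nat//.
lra.
Qed.

End lip_reg.
End linfty_facts.

Section probability_facts.
Context {R : realType} {d : measure_display} {T : measurableType d}.
Variable P : probability T R.
Local Notation integ f := (P.-integrable setT (EFin \o f)).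

Lemma full_setC (A : set T) : measurable A -> P A = 1%E -> P (~` A) = 0%E.
Proof. by move=> mA PA; rewrite probability_setC// PA subee. Qed.

Lemma full_set_ae (A : set T) (Q : T -> Prop) : measurable A -> P A = 1%E ->
  A `<=` Q -> {ae P, forall w, Q w}.
Proof.
move=> mA PA AQ; exists (~` A); split; [exact: measurableC| |].
  by exact: (full_setC mA PA).
by move=> w /= nQ Aw; apply: nQ; exact: AQ.
Qed.

Lemma full_set_Rintegral (A : set T) (f g : T -> R) : measurable A -> P A = 1%E ->
  measurable_fun setT f -> measurable_fun setT g ->
  (forall w, A w -> f w = g w) -> \int[P]_w f w = \int[P]_w g w.
Proof.
move=> mA PA mf mg fg; rewrite /Rintegral; congr fine.
apply: ae_eq_integral => //; [exact/measurable_EFinP|exact/measurable_EFinP|].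
by apply: full_set_ae mA PA _ => w Aw _ /=; rewrite fg.
Qed.

Lemma full_set_measure_eq (A B C : set T) : measurable A -> P A = 1%E ->
  measurable B -> measurable C -> B `&` A = C `&` A -> P B = P C.
Proof.
move=> mA PA mB mC BC.
have PI (D : set T) : measurable D -> P D = P (D `&` A).
  move=> mD; rewrite -(setIT D) -{1}(setUv A) setIUr measureU//.
  - rewrite [X in (_ + X)%E](_ : _ = 0%E) ?adde0 ?setIT//.
    apply: (@subset_measure0 _ _ _ P _ (~` A)) => //.
    + by apply: measurableI => //; exact: measurableC.
    + exact: measurableC.
    + by exact: (full_setC mA PA).
  - exact: measurableI.
  - by apply: measurableI => //; exact: measurableC.
  - by apply/seteqP; split => // w [[_ a] [_ b]]; exact: b.
by rewrite (PI B)// (PI C)// BC.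
Qed.

(** The weighted series of 2^m g_m has mean at most 2 C, hence is finite almost surely, and its sum
    serves as [c]. *)
Lemma summable_full_set (g : nat -> T -> R) (C : R) : 0 <= C ->
  (forall m, measurable_fun setT (g m)) -> (forall m w, 0 <= g m w) ->
  (forall m, (\int[P]_w (g m w)%:E <= (C / 4 ^+ m)%:E)%E) ->
  exists A, [/\ measurable A, P A = 1%E & forall w, A w ->
    exists2 c, 0 <= c & forall m, g m w <= c / 2 ^+ m].
Proof.
move=> C0 mg g0 Eg.
pose f w := (\sum_(0 <= m <oo) (2 ^+ m * g m w)%:E)%E.
have mf m : measurable_fun setT (fun w => (2 ^+ m * g m w)%:E).
  by apply/measurable_EFinP; apply: measurable_funM.
have f0 m w : (0 <= (2 ^+ m * g m w)%:E)%E by rewrite lee_fin mulr_ge0.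
have mF : measurable_fun setT f by apply: ge0_emeasurable_sum => // m w _ _.
have f_ge0 w : (0 <= f w)%E by apply: nneseries_ge0 => m _ _.
have Ef : (\int[P]_w f w <= (2 * C)%:E)%E.
  rewrite integral_nneseries//.
  apply: lime_le.
    by apply: is_cvg_nneseries => m _ _; apply: integral_ge0 => w _.
  apply: nearW => n.
  apply: (@le_trans _ _ (\sum_(0 <= m < n) (C / 2 ^+ m)%:E)%E).
    apply: lee_sum => m _; under eq_integral do rewrite EFinM.
    rewrite ge0_integralZl//; last 2 first.
    - exact/measurable_EFinP.
    - by move=> w _; rewrite lee_fin.
    apply: (@le_trans _ _ ((2 ^+ m)%:E * (C / 4 ^+ m)%:E)%E).
      by rewrite lee_wpmul2l// lee_fin.
    rewrite -EFinM lee_fin mulrCA ler_wpM2l//.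
    have -> : 4 ^+ m = 2 ^+ m * 2 ^+ m :> R by rewrite -exprMn; congr (_ ^+ _); lra.
    by rewrite invfM mulVKf.
  rewrite sumEFin lee_fin.
  have -> : \sum_(0 <= i < n) C / 2 ^+ i = 2 * C - 2 * C / 2 ^+ n.
    elim: n => [|n IH]; first by rewrite big_geq// expr0 divr1 subrr.
    rewrite big_nat_recr//= IH exprS invfM; set a := (2 ^+ n)^-1; lra.
  by rewrite gerBl divr_ge0// mulr_ge0.
have iF : P.-integrable setT f.
  apply/integrableP; split => //.
  rewrite (eq_integral f); first exact: le_lt_trans Ef (ltry _).
  by move=> w _; rewrite gee0_abs.
have [N [mN PN fN]] := integrable_ae measurableT iF.
exists (~` N); split; first exact: measurableC.
  by rewrite probability_setC// PN sube0.
move=> w Nw; have fw : f w \is a fin_num.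
  by apply: contrapT => h; apply: Nw; apply: fN => /= h'; apply: h; exact: h'.
exists (fine (f w)); first by rewrite fine_ge0.
move=> m; rewrite ler_pdivlMr ?exprn_gt0// mulrC -lee_fin fineK//.
apply: (@le_trans _ _ (\sum_(0 <= i < m.+1) (2 ^+ i * g i w)%:E)%E).
  rewrite big_nat_recr//= -[leLHS]add0e leeD2r//.
  by apply: sume_ge0 => i _.
exact: nneseries_lim_ge.
Qed.

Lemma outer_expectation_le (f : T -> \bar R) (U : T -> R) : integ U ->
  (forall w, f w <= (U w)%:E)%E -> (outer_expectation P f <= (\int[P]_w U w)%:E)%E.
Proof.
move=> iU fU; rewrite EFin_Rintegral//; apply: ereal_inf_lbound.
exists (EFin \o U) => //; split => //.
- exact: measurable_int iU.
- by left; exact: integral_funepos_lt_pinfty iU.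
Qed.

Lemma outer_expectation_ge (f : T -> \bar R) (W : T -> R) : integ W ->
  (forall w, (W w)%:E <= f w)%E -> ((\int[P]_w W w)%:E <= outer_expectation P f)%E.
Proof.
move=> iW Wf; rewrite EFin_Rintegral//; apply: le_ereal_inf_tmp => _ [U [mU fU _] <-].
rewrite integralE [leRHS]integralE.
have WU w : ((EFin \o W) w <= U w)%E by apply: le_trans (fU w); exact: Wf.
have mW : measurable_fun setT (EFin \o W) by exact: measurable_int iW.
apply: leeB; apply: ge0_le_integral => //; try exact: measurable_funepos;
  try exact: measurable_funeneg.
- by move=> w _; rewrite !funeposE ge_max !le_max WU lexx orbT.
- by move=> w _; rewrite !funenegE ge_max !le_max leeN2 WU lexx orbT.
Qed.

Lemma bounded_fun_of (S : Type) (h : S -> R) M : (forall x, `|h x| <= M) ->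
  bounded_fun h.
Proof.
move=> hM; exists M; split; first by rewrite num_real.
by move=> x Mx y _; exact: le_trans (hM y) (ltW Mx).
Qed.

Lemma expectation_Rintegral (f : T -> R) : integ f ->
  ('E_P[f])%E = (\int[P]_w f w)%:E.
Proof. by move=> fi; rewrite EFin_Rintegral// unlock. Qed.

Lemma cvge_squeeze_eps (u : nat -> \bar R) (l : R) :
  (forall e, 0 < e -> exists n0, forall n, (n0 <= n)%N ->
    ((l - e)%:E <= u n <= (l + e)%:E)%E) -> u @ \oo --> l%:E.
Proof.
move=> h; apply/fine_cvgP; split.
  have [n0 hn] := h 1 ltr01; near=> n.
  have /andP[h1 h2] : ((l - 1)%:E <= u n <= (l + 1)%:E)%E.
    by apply: hn; near: n; exact: nbhs_infty_ge.
  by rewrite fin_numE -ltNye -ltey (lt_le_trans (ltNyr _) h1) (le_lt_trans h2 (ltry _)).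
apply/cvgrPdist_le => e e0; have [n0 hn] := h e e0; near=> n => /=.
have /andP[h1 h2] : ((l - e)%:E <= u n <= (l + e)%:E)%E.
  by apply: hn; near: n; exact: nbhs_infty_ge.
move: h1 h2; case: (u n) => [r| |]//=; rewrite ?lee_fin ?leye_eq ?leeNy_eq//.
by rewrite ler_norml; lra.
Unshelve. all: by end_near. Qed.

End probability_facts.

Section weak_convergence.
Context {R : realType} {d d' : measure_display} {Omega : measurableType d}
  (P : probability Omega R) {Omega' : measurableType d'}
  (P' : probability Omega' R) {I : Type}.
Variables (Yn : nat -> I -> Omega -> R) (G : I -> {RV P' >-> R}).
Hypothesis mY : forall n t, measurable_fun setT (Yn n t).
Hypothesis Yfidi : fidi_cvg P P' Yn G.
Local Notation linf := (linfty R I).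

Let mG t : measurable_fun setT (G t).
Proof. exact: measurable_funPT. Qed.

Lemma integ_row d0 (T0 : measurableType d0) (P0 : probability T0 R) K
    (h : 'rV[R]_K -> R) L M (f : 'I_K -> T0 -> R) :
  0 <= L -> entry_lipschitz h L -> (forall x, `|h x| <= M) ->
  (forall k, measurable_fun setT (f k)) ->
  P0.-integrable setT (EFin \o (fun w => h (row_of f w))).
Proof.
move=> L0 hL hM mf; apply: (@integ_bounded _ _ _ P0 _ M) => //.
exact: measurable_entry_lipschitz hL mf.
Qed.

Lemma fidi_entry_lipschitz K (tau : 'I_K -> I) (h : 'rV[R]_K -> R) L M :
  0 <= L -> entry_lipschitz h L -> (forall x, `|h x| <= M) ->
  forall e, 0 < e -> exists n0, forall n, (n0 <= n)%N ->
  `|\int[P]_w h (row_of (fun k => Yn n (tau k)) w) -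
    \int[P']_w h (row_of (fun k => G (tau k)) w)| <= e.
Proof.
move=> L0 hL hM e e0.
have := @Yfidi K tau h (entry_lipschitz_continuous L0 hL) (bounded_fun_of hM).
rewrite [X in _ --> X -> _](_ : _ = (\int[P']_w h (row_of (fun k => G (tau k)) w))%:E); last first.
  by rewrite -(expectation_Rintegral (integ_row P' L0 hL hM (fun k => mG (tau k)))).
move=> /fine_cvgP[_ /cvgrPdist_le /(_ e e0)] [n0 _ hn].
exists n0 => n n0n; have := hn n n0n; rewrite distrC /=.
by rewrite [X in fine X](expectation_Rintegral (integ_row P L0 hL hM (fun k => mY n (tau k)))).
Qed.

(** The cap at 1 makes this distance a bounded function, to which the convergence of the
    finite-dimensional distributions applies. *)
Definition dist_row K (c1 c2 : I -> 'I_K) (v : 'rV[R]_K) : R :=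
  Num.min 1 `|lift_row c1 v - lift_row c2 v|.

Lemma dist_row_lipschitz K (c1 c2 : I -> 'I_K) : entry_lipschitz (dist_row c1 c2) 2.
Proof.
move=> u v e e0 uv; rewrite /dist_row.
set a := `|lift_row c1 u - _|; set b := `|lift_row c1 v - _|.
have h1 := lift_row_lipschitz c1 e0 uv. have h2 := lift_row_lipschitz c2 e0 uv.
have : `|a - b| <= 2 * e.
  apply: (le_trans (ler_dist_dist _ _)).
  rewrite opprD addrACA -opprD (le_trans (ler_normB _ _))// mulr2n mulrDl mul1r.
  exact: lerD.
rewrite /Num.min; case: ifP => ha; case: ifP => hb; rewrite !ler_norml; move: ha hb; lra.
Qed.

Lemma dist_row_ge0 K (c1 c2 : I -> 'I_K) v : 0 <= dist_row c1 c2 v <= 1.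
Proof. by rewrite /dist_row le_min ler01 normr_ge0 ge_min lexx. Qed.

Lemma dist_row_bound K (c1 c2 : I -> 'I_K) v : `|dist_row c1 c2 v| <= 1.
Proof. by have := dist_row_ge0 c1 c2 v; rewrite ler_norml; lra. Qed.

Lemma measurable_dist_row d0 (T0 : measurableType d0) K (c1 c2 : I -> 'I_K)
    (f : 'I_K -> T0 -> R) : (forall k, measurable_fun setT (f k)) ->
  measurable_fun setT (fun w => dist_row c1 c2 (row_of f w)).
Proof. exact: measurable_entry_lipschitz (ler0n _ _) (dist_row_lipschitz c1 c2). Qed.

(** Carries approximation bounds from the [Yn] over to [G]: the distance depends on finitely many
    coordinates only. *)
Lemma fidi_dist_le K (tau : 'I_K -> I) (c1 c2 : I -> 'I_K) (eta : R) n0 :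
  0 <= eta ->
  (forall n, (n0 <= n)%N -> exists U : Omega -> R, [/\ measurable_fun setT U,
     forall w, 0 <= U w,
     forall t w, `|Yn n (tau (c1 t)) w - Yn n (tau (c2 t)) w| <= U w &
     (\int[P]_w (U w)%:E <= eta%:E)%E]) ->
  (\int[P']_w (dist_row c1 c2 (row_of (fun k => G (tau k)) w))%:E <= eta%:E)%E.
Proof.
move=> eta0 hU.
have hL := dist_row_lipschitz c1 c2; have hM := dist_row_bound c1 c2.
have iG := integ_row P' (ler0n _ _) hL hM (fun k => mG (tau k)).
rewrite -EFin_Rintegral// lee_fin; apply/ler_addgt0Pr => e e0.
have [n1 hn1] := fidi_entry_lipschitz tau (ler0n _ _) hL hM e0.
have [U [mU U0 YU EU]] := hU (maxn n0 n1) (leq_maxl _ _).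
have := hn1 (maxn n0 n1) (leq_maxr _ _).
have iU : P.-integrable setT (EFin \o U) by exact: ge0_integ EU.
have iY := integ_row P (ler0n _ _) hL hM (fun k => mY (maxn n0 n1) (tau k)).
have : \int[P]_w dist_row c1 c2 (row_of (fun k => Yn (maxn n0 n1) (tau k)) w) <= eta.
  apply: le_trans (Rintegral_le_EFin iU EU); apply: ler_Rintegral => // w.
  rewrite /dist_row ge_min; apply/orP; right; apply: linf_norm_le => // t.
  by rewrite linftyB/= !mxE.
by rewrite ler_norml; lra.
Qed.

Section limit_construction.
Variables (K : nat -> nat) (e : forall m, 'I_(K m) -> I) (c : forall m, I -> 'I_(K m)).
Hypothesis approx : forall m, exists n0, forall n, (n0 <= n)%N ->
  exists U : Omega -> R, [/\ measurable_fun setT U, forall w, 0 <= U w,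
    forall t w, `|Yn n t w - Yn n (e (c m t)) w| <= U w &
    (\int[P]_w (U w)%:E <= (1 / 4 ^+ m)%:E)%E].

Definition Zstep m (w : Omega') : linf :=
  lift_row (c m) (row_of (fun k => G (e k)) w).

Lemma ZstepE m w t : Zstep m w t = G (e (c m t)) w.
Proof. by rewrite /= mxE. Qed.

(** Concatenates the nodes of two consecutive levels, so that both discretizations are liftings of
    one and the same vector. *)
Let pair_idx m (k : 'I_(K m.+1 + K m)) : I :=
  match fintype.split k with inl i => e i | inr j => e j end.

Let Zstep_pair m w : dist_row (fun t => lshift (K m) (c m.+1 t))
    (fun t => rshift (K m.+1) (c m t)) (row_of (fun k => G (pair_idx k)) w) =
  Num.min 1 `|Zstep m.+1 w - Zstep m w|.
Proof.
rewrite /dist_row; congr (Num.min 1 `|_ - _|); apply/val_inj/funext => t /=;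
  rewrite !mxE /pair_idx.
- by rewrite (unsplitK (inl (c m.+1 t))).
- by rewrite (unsplitK (inr (c m t))).
Qed.

Lemma Zstep_dist m :
  (\int[P']_w (Num.min 1 `|Zstep m.+1 w - Zstep m w|)%:E <= (2 / 4 ^+ m)%:E)%E.
Proof.
under eq_integral do rewrite -Zstep_pair.
have [n0 hn0] := approx m; have [n1 hn1] := approx m.+1.
have p4 : 0 <= 1 / 4 ^+ m :> R by rewrite divr_ge0// exprn_ge0.
apply: (@fidi_dist_le _ (@pair_idx m) _ _ _ (maxn n0 n1)).
  by rewrite divr_ge0// exprn_ge0.
move=> n; rewrite geq_max => /andP[n0n n1n].
have [U0 [mU0 U00 YU0 EU0]] := hn0 n n0n; have [U1 [mU1 U10 YU1 EU1]] := hn1 n n1n.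
exists (fun w => U1 w + U0 w); split.
- exact: measurable_funD.
- by move=> w; rewrite addr_ge0.
- move=> t w; rewrite /pair_idx (unsplitK (inl (c m.+1 t))) (unsplitK (inr (c m t))).
  rewrite -(subrKA (Yn n t w)) (le_trans (ler_normD _ _))// lerD//.
  by rewrite distrC.
- under eq_integral do rewrite EFinD.
  rewrite ge0_integralD//; try exact/measurable_EFinP; try (by move=> w _; rewrite lee_fin).
  apply: (le_trans (leeD EU1 EU0)); rewrite -EFinD lee_fin exprS invfM.
  set a := (4 ^+ m)^-1; have : 0 <= a by rewrite invr_ge0 exprn_ge0.
  lra.
Qed.

(** Two coordinates and constant index maps reduce [dist_row] to the distance at the single point
    [t]. This is what will identify the limit with [G t] almost surely. *)
Lemma Zstep_eval_dist t m :
  (\int[P']_w (Num.min 1 `|G t w - Zstep m w t|)%:E <= (1 / 4 ^+ m)%:E)%E.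
Proof.
pose tau (k : 'I_2) := if k == 0 then t else e (c m t).
have [n0 hn0] := approx m.
have h : (\int[P']_w (dist_row (fun _ : I => 0 : 'I_2) (fun=> 1) (row_of (fun k => G (tau k)) w))%:E
    <= (1 / 4 ^+ m)%:E)%E.
  apply: (@fidi_dist_le _ tau _ _ _ n0); first by rewrite divr_ge0// exprn_ge0.
  by move=> n /hn0[U [mU U0 YU EU]]; exists U; split => // _ w; exact: YU.
apply: le_trans h; apply: ge0_le_integral => //.
- apply/measurable_EFinP; apply: measurable_minr => //.
  apply: measurableT_comp => //; apply: measurable_funB => //.
  by rewrite (_ : (fun w => Zstep m w t) = G (e (c m t)))//; apply/funext => w; rewrite ZstepE.
- by apply/measurable_EFinP; apply: measurable_dist_row.
- move=> w _; rewrite lee_fin /dist_row.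
  have hf := le_linf_norm (lift_row (fun _ : I => 0 : 'I_2)
    (row_of (fun k => G (tau k)) w) - lift_row (fun=> 1) (row_of (fun k => G (tau k)) w)) t.
  rewrite linftyB /= !mxE in hf.
  by rewrite le_min ge_min lexx; apply: le_trans hf; rewrite ge_min ZstepE lexx orbT.
Qed.

Let mZstep_dist m : measurable_fun setT (fun w => Num.min 1 `|Zstep m.+1 w - Zstep m w|).
Proof.
rewrite (_ : (fun w => _) = (fun w => dist_row (fun t => lshift (K m) (c m.+1 t))
    (fun t => rshift (K m.+1) (c m t)) (row_of (fun k => G (pair_idx k)) w))).
  exact: measurable_dist_row.
by apply/funext => w; rewrite Zstep_pair.
Qed.

Lemma geometric_small (a eps : R) : 0 < eps -> exists M, forall m, (M <= m)%N ->
  a / 2 ^+ m <= eps.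
Proof.
move=> e0; exists (Num.truncn (a / eps)).+1 => m Mm.
rewrite ler_pdivrMr ?exprn_gt0// mulrC -ler_pdivrMr//.
rewrite (le_trans (ltW (truncnS_gt _)))// (le_trans (_ : _ <= m%:R))// ?ler_nat//.
by rewrite -natrX ler_nat ltnW// ltn_expl.
Qed.

(** On the full set [A] the discretizations converge uniformly in t. Rounding their values to a
    grid, and putting 0 off [A], gives countably valued [Y m] that converge to [Z] at every sample
    point; they carry the measurability of [Z]. *)
Lemma limit_process : exists (A : set Omega') (Y : nat -> Omega' -> linf) (Z : Omega' -> linf),
  [/\ measurable A /\ P' A = 1%E,
      forall m (B : set linf), measurable [set w | B (Y m w)],
      forall w eps, 0 < eps -> exists M, forall m, (M <= m)%N -> `|Z w - Y m w| <= eps,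
      forall w, A w -> forall eps, 0 < eps ->
        exists M, forall m, (M <= m)%N -> `|Z w - Zstep m w| <= eps &
      forall t w, A w -> (fun m => Zstep m w t) @ \oo --> Z w t].
Proof.
have [A [mA PA hA]] := @summable_full_set _ _ _ P' (fun m w => Num.min 1 `|Zstep m.+1 w - Zstep m w|)
  2 (ler0n _ _) mZstep_dist (fun m w => ltac:(by rewrite le_min ler01 normr_ge0)) Zstep_dist.
pose Y m w : linf := if w \in A then lift_row (c m) (grid_row_of m (fun k => G (@e m k)) w) else 0.
have limA w : A w -> exists z : linf, forall eps, 0 < eps -> exists M, forall m, (M <= m)%N ->
    `|z - Zstep m w| <= eps.
  move=> /hA[C C0 hC].
  (* Below 1/2 the cap at 1 is inactive, so the bound concerns the distance itself. *)
  have [M hM] := @geometric_small C (2^-1) ltac:(by rewrite invr_gt0).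
  have h m : (M <= m)%N -> `|Zstep m.+1 w - Zstep m w| <= C / 2 ^+ m.
    move=> Mm; have := hC m; have := hM m Mm; rewrite /Num.min; case: ifP => //.
    by move=> _ h1 h2; exfalso; move: h1 h2; lra.
  have [z hz] := linf_geometric_limit C0 h.
  exists z => eps e0; have [M' hM'] := geometric_small (2 * C) e0.
  exists (maxn M M') => m; rewrite geq_max => /andP[Mm M'm].
  by rewrite (le_trans (hz m Mm))// hM'.
have close m w : A w -> `|Zstep m w - Y m w| <= m.+1%:R^-1.
  move=> Aw; rewrite /Y mem_set// distrC; apply: lift_row_lipschitz; first by rewrite invr_ge0.
  by move=> k; exact: grid_row_of_close.
have inv_small eps : 0 < eps -> exists M, forall m, (M <= m)%N -> m.+1%:R^-1 <= eps :> R.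
  move=> e0; exists (Num.truncn eps^-1) => m Mm.
  rewrite -[leRHS]invrK lef_pV2 ?posrE ?invr_gt0// (le_trans (ltW (truncnS_gt _)))//.
  by rewrite ler_nat.
have lim w : exists z : linf, (forall eps, 0 < eps -> exists M, forall m, (M <= m)%N -> `|z - Y m w| <= eps) /\
   (A w -> forall eps, 0 < eps -> exists M, forall m, (M <= m)%N -> `|z - Zstep m w| <= eps).
  have [Aw|nAw] := pselect (A w); last first.
    exists 0; split=> // eps e0; exists 0%N => m _.
    by rewrite /Y memNset// subrr normr0 ltW.
  have [z hz] := limA w Aw; exists z; split=> // eps e0.
  have e2 : 0 < eps / 2 by rewrite divr_gt0.
  have [M1 h1] := hz _ e2; have [M2 h2] := inv_small _ e2.
  exists (maxn M1 M2) => m; rewrite geq_max => /andP[m1 m2].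
  rewrite -(subrKA (Zstep m w)) (le_trans (ler_normD _ _))//.
  by rewrite [leRHS]splitr lerD ?h1// (le_trans (close m w Aw))// h2.
exists A, Y, (fun w => proj1_sig (cid (lim w))); split => //.
- move=> m B; rewrite (_ : [set w | B (Y m w)] =
    (A `&` [set w | B (lift_row (c m) (grid_row_of m (fun k => G (@e m k)) w))]) `|`
    (~` A `&` [set w | B 0])).
    apply: measurableU; apply: measurableI => //.
    - exact: (measurable_preimage_grid m (@lift_row R I _ (c m) \o @grid_row R _ m) B (fun k => mG (@e m k))).
    - exact: measurableC.
    - case: (pselect (B 0)) => B0.
        by rewrite (_ : [set w | _] = setT)//; apply/seteqP; split.
      by rewrite (_ : [set w | _] = set0)//; apply/seteqP; split.
  apply/seteqP; split => w /=; rewrite /Y.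
    by have [Aw|nAw] := pselect (A w); [rewrite mem_set//; left|rewrite memNset//; right].
  by move=> [[Aw]|[nAw]]; [rewrite mem_set|rewrite memNset].
- by move=> w; case: (proj2_sig (cid (lim w))).
- by move=> w Aw; case: (proj2_sig (cid (lim w))) => _; exact.
- move=> t w Aw; apply/cvgrPdist_le => eps e0.
  case: (proj2_sig (cid (lim w))) => _ /(_ Aw eps e0)[M hM].
  near=> m; rewrite -linftyB (le_trans (le_linf_norm _ _))// hM//.
  near: m; exact: nbhs_infty_ge.
Unshelve. all: by end_near. Qed.

End limit_construction.
End weak_convergence.

Section leadsto_criterion.
Context {R : realType} {d d' : measure_display} {Omega : measurableType d}
  (P : probability Omega R) {Omega' : measurableType d'}
  (P' : probability Omega' R) {I : Type}.
Local Notation linf := (linfty R I).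

Section countable_valued_limit.
Variables (Y : nat -> Omega' -> linf) (Z : Omega' -> linf).
Hypothesis mY : forall m (B : set linf), measurable [set w | B (Y m w)].
Hypothesis YZ : forall w eps, 0 < eps ->
  exists M, forall m, (M <= m)%N -> `|Z w - Y m w| <= eps.

Lemma limit_cvg w : (fun m => Y m w) @ \oo --> Z w.
Proof.
apply/cvgrPdist_le => eps e0; have [M hM] := YZ w e0.
by exists M => // m /= Mm; exact: hM.
Qed.

Lemma limit_continuous_cvg (H : linf -> R) w : continuous H ->
  (fun m => H (Y m w)) @ \oo --> H (Z w).
Proof. by move=> cH; apply: continuous_cvg; [exact: cH|exact: limit_cvg]. Qed.

Lemma limit_measurable (H : linf -> R) : continuous H ->
  measurable_fun setT (fun w => H (Z w)).
Proof.
move=> cH; apply: (measurable_fun_cvg (h := fun m w => H (Y m w))).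
  by move=> m _ B mB; rewrite setTI; exact: (mY m (H @^-1` B)).
by move=> w _; exact: limit_continuous_cvg.
Qed.

Lemma limit_borel_measurable : borel_measurable Z.
Proof.
have m := @measurability _ _ Omega' (g_sigma_algebraType (@open linf)) setT Z (@open linf) erefl.
apply: m => _ [B oB <-]; rewrite setTI.
(* [Z w] lies in the open set [B] exactly when, for some k, all late [Y m w] lie in the inner set
   [V k], whose preimages under [Y m] are measurable like those of any set. *)
pose V k := [set x : linf | forall y, `|x - y| < k.+1%:R^-1 -> B y].
rewrite (_ : Z @^-1` B = \bigcup_k \bigcup_M \bigcap_(m in [set m | (M <= m)%N]) [set w | V k (Y m w)]).
  apply: bigcupT_measurable => k; apply: bigcupT_measurable => M.
  by apply: bigcap_measurableType => m _; exact: mY.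
have kpos k : 0 < k.+1%:R^-1 :> R by rewrite invr_gt0 ltr0n.
apply/seteqP; split => w /=.
  move=> BZ; have /nbhs_ballP[r /= r0 hr] : nbhs (Z w) B by exact: open_nbhs_nbhs.
  pose k := Num.truncn (2 / r).
  have kr : k.+1%:R^-1 <= r / 2.
    rewrite -[leRHS]invrK lef_pV2 ?posrE ?invr_gt0 ?divr_gt0//.
    by rewrite invf_div ltW// truncnS_gt.
  have [M hM] := YZ w (kpos k).
  exists k => //; exists M => // m /= Mm y hy; apply: hr; rewrite -ball_normE/=.
  rewrite -(subrKA (Y m w)) (le_lt_trans (ler_normD _ _))//.
  rewrite [ltRHS]splitr ler_ltD//; last exact: lt_le_trans kr.
  by rewrite (le_trans (hM m Mm)).
move=> [k _ [M _ hM]].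
have k2 : 0 < k.+1%:R^-1 / 2 :> R by rewrite divr_gt0.
have [M' hM'] := YZ w k2.
have := hM (maxn M M') (leq_maxl _ _) (Z w); apply.
rewrite distrC (le_lt_trans (hM' _ (leq_maxr _ _)))//.
by rewrite ltr_pdivrMr// ltr_pMr// ltr1n.
Qed.

End countable_valued_limit.

Lemma linf_lipschitz_continuous (h : linf -> R) L : 0 <= L -> linf_lipschitz h L ->
  continuous h.
Proof.
move=> L0 hL x; apply/(@cvgrPdist_le _ _ _ _ (nbhs_filter x)) => eps e0.
have L1 : 0 < L + 1 by rewrite ltr_wpDl.
apply/nbhs_ballP; exists (eps / (L + 1)); first by rewrite /= divr_gt0.
move=> y; rewrite -ball_normE/= => /ltW xy; rewrite (le_trans (hL x y))//.
apply: (@le_trans _ _ (L * (eps / (L + 1)))); first by rewrite ler_wpM2l.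
by rewrite mulrA ler_pdivrMr// mulrC ler_wpM2l ?(ltW e0)// lerDl.
Qed.

Variables (Yn : nat -> I -> Omega -> R) (G : I -> {RV P' >-> R}).
Hypothesis mY : forall n t, measurable_fun setT (Yn n t).
Hypothesis bY : forall n w, exists M, forall t, `|Yn n t w| <= M.
Hypothesis Yfidi : fidi_cvg P P' Yn G.
Hypothesis approx : forall eta, 0 < eta -> exists K (e : 'I_K -> I) (c : I -> 'I_K) n0,
  forall n, (n0 <= n)%N -> exists U : Omega -> R, [/\ measurable_fun setT U,
    forall w, 0 <= U w, forall t w, `|Yn n t w - Yn n (e (c t)) w| <= U w &
    (\int[P]_w (U w)%:E <= eta%:E)%E].

Let mG t : measurable_fun setT (G t).
Proof. exact: measurable_funPT. Qed.

Lemma outer_expectation_mono (f g : Omega -> \bar R) : (forall w, f w <= g w)%E ->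
  (outer_expectation P f <= outer_expectation P g)%E.
Proof.
move=> fg; apply: le_ereal_inf => _ [U [mU gU iU] <-]; exists U => //; split => // w.
exact: le_trans (fg w) (gU w).
Qed.

Section weak_limit.
Variables (K : nat -> nat) (e : forall m, 'I_(K m) -> I) (c : forall m, I -> 'I_(K m)).
Hypothesis Happ : forall m, exists n0, forall n, (n0 <= n)%N ->
  exists U : Omega -> R, [/\ measurable_fun setT U, forall w, 0 <= U w,
    forall t w, `|Yn n t w - Yn n (e (c m t)) w| <= U w &
    (\int[P]_w (U w)%:E <= (1 / 4 ^+ m)%:E)%E].
Variables (A : set Omega') (Y : nat -> Omega' -> linf) (Z : Omega' -> linf).
Hypothesis mA : measurable A.
Hypothesis PA : P' A = 1%E.
Hypothesis mYm : forall m (B : set linf), measurable [set w | B (Y m w)].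
Hypothesis YZ : forall w eps, 0 < eps ->
  exists M, forall m, (M <= m)%N -> `|Z w - Y m w| <= eps.
Hypothesis ZA : forall w, A w -> forall eps, 0 < eps ->
  exists M, forall m, (M <= m)%N -> `|Z w - Zstep G e c m w| <= eps.
Let Zn n w : linf := to_linfty (bY n w).

Let integ_Z (h : linf -> R) M : continuous h -> (forall x, `|h x| <= M) ->
  P'.-integrable setT (EFin \o (fun w => h (Z w))).
Proof.
move=> ch hM; apply: (@integ_bounded _ _ _ P' _ M) => //.
exact: (limit_measurable mYm YZ).
Qed.

Lemma Zstep_integral_cvg (h : linf -> R) L M : 0 <= L -> linf_lipschitz h L ->
  (forall x, `|h x| <= M) -> forall eps, 0 < eps -> exists m0, forall m, (m0 <= m)%N ->
  `|\int[P']_w h (Z w) - \int[P']_w h (Zstep G e c m w)| <= eps.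
Proof.
move=> L0 hL hM eps e0; have ch := linf_lipschitz_continuous L0 hL.
have mh m : measurable_fun setT (fun w => h (Zstep G e c m w)).
  exact: (@measurable_entry_lipschitz _ _ _ _ _ L (fun k => G (@e m k)) L0 (linf_lipschitz_lift (c m) L0 hL) (fun k => mG (@e m k))).
(* The modification off [A] leaves the integrals unchanged and makes the convergence hold
   everywhere. *)
pose g m w := if w \in A then h (Zstep G e c m w) else h (Z w).
have mg m : measurable_fun setT (g m).
  apply: measurable_fun_ifT => //; last exact: (limit_measurable mYm YZ).
  by apply: (measurable_fun_bool true); rewrite setTI (_ : _ @^-1` _ = A)//;
    apply/seteqP; split => w /=; [move/set_mem|move/mem_set].
have iZ := integ_Z ch hM.
have hcvg : (\int[P']_w (g m w)%:E)%E @[m --> \oo] --> (\int[P']_w (h (Z w))%:E)%E.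
  apply: (@dominated_cvg _ _ _ P' setT measurableT (fun m w => (g m w)%:E) _ (fun=> M%:E)) => //.
  - by move=> m; exact/measurable_EFinP.
  - move=> w _; apply/fine_cvgP; split; first by apply: nearW.
    apply/cvgrPdist_le => d1 d0; have [Aw|nAw] := pselect (A w); last first.
      by apply: nearW => m /=; rewrite /g memNset// subrr normr0 ltW.
    have L1 : 0 < L + 1 by rewrite ltr_wpDl.
    have [m0 hm] := ZA Aw (divr_gt0 d0 L1).
    exists m0 => // m /= m0m; rewrite /g mem_set// (le_trans (hL _ _))//.
    apply: (@le_trans _ _ (L * (d1 / (L + 1)))); first by rewrite ler_wpM2l// hm.
    by rewrite mulrA ler_pdivrMr// mulrC ler_wpM2l ?(ltW d0)// lerDl.
  - exact: finite_measure_integrable_cst.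
  - by move=> m w _; rewrite lee_fin /g; case: ifP.
move: hcvg; rewrite -(EFin_Rintegral iZ) => /fine_cvgP[_ /cvgrPdist_le /(_ eps e0)] [m0 _ hm].
exists m0 => m m0m; have := hm m m0m => /=.
rewrite (@full_set_Rintegral _ _ _ P' A (fun w => h (Zstep G e c m w)) (g m))//.
by move=> w Aw; rewrite /g mem_set.
Qed.

(** [h (Zn n w)] may fail to be measurable, but it lies between the measurable functions obtained
    from the discretization by adding or subtracting L U. One third of [eps] each goes to the
    majorant, the finite-dimensional convergence and the discretization of the limit. *)
Lemma lipschitz_outer_cvg (h : linf -> R) L M : 0 <= L -> linf_lipschitz h L ->
  (forall x, `|h x| <= M) -> forall eps, 0 < eps -> exists n0, forall n, (n0 <= n)%N ->
  ((\int[P']_w h (Z w) - eps)%:E <= outer_expectation P (fun w => (h (Zn n w))%:E)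
    <= (\int[P']_w h (Z w) + eps)%:E)%E.
Proof.
move=> L0 hL hM eps e0; have e3 : 0 < eps / 3 by rewrite divr_gt0.
have [m0 hm0] := Zstep_integral_cvg L0 hL hM e3.
have [m1 hm1] := geometric_small L e3.
pose m := maxn m0 m1; have [n0 hn0] := Happ m.
have hl := linf_lipschitz_lift (c m) L0 hL.
have hlM x : `|(h \o lift_row (c m)) x| <= M by exact: hM.
have [n1 hn1] := @fidi_entry_lipschitz _ _ _ _ P _ P' _ _ _ mY Yfidi _ (@e m) _ _ _ L0 hl hlM _ e3.
exists (maxn n0 n1) => n; rewrite geq_max => /andP[n0n n1n].
have [U [mU U0 YU EU]] := hn0 n n0n.
have iU : P.-integrable setT (EFin \o U) by exact: ge0_integ EU.
have iW := integ_row P L0 hl hlM (fun k => mY n (@e m k)).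
have EUr := Rintegral_le_EFin iU EU.
have h1 := hn1 n n1n.
have h2 := hm0 m (leq_maxl _ _).
have LE : L * \int[P]_w U w <= eps / 3.
  apply: (@le_trans _ _ (L / 2 ^+ m)); last by rewrite hm1// leq_maxr.
  rewrite ler_wpM2l// (le_trans EUr)// mul1r lef_pV2 ?posrE ?exprn_gt0//.
  by rewrite lerXn2r ?nnegrE//; lra.
have close w : `|h (Zn n w) - (h \o lift_row (c m)) (row_of (fun k => Yn n (@e m k)) w)| <= L * U w.
  rewrite (le_trans (hL _ _))// ler_wpM2l//; apply: linf_norm_le => // t.
  by rewrite linftyB/= mxE.
have iLU := integZ L iU.
have RZ := RintegralZl L measurableT iU.
apply/andP; split.
- apply: (@le_trans _ _ (\int[P]_w ((h \o lift_row (c m)) (row_of (fun k => Yn n (@e m k)) w) - L * U w))%:E).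
    rewrite lee_fin RintegralB// RZ.
    by move: h1 h2 LE; rewrite !ler_norml; lra.
  apply: outer_expectation_ge; first exact: integB.
  by move=> w; rewrite lee_fin; move: (close w); rewrite ler_norml; lra.
- apply: (@le_trans _ _ (\int[P]_w ((h \o lift_row (c m)) (row_of (fun k => Yn n (@e m k)) w) + L * U w))%:E).
    apply: outer_expectation_le; first exact: integD.
    by move=> w; rewrite lee_fin; move: (close w); rewrite ler_norml; lra.
  rewrite lee_fin RintegralD// RZ.
  by move: h1 h2 LE; rewrite !ler_norml; lra.
Qed.

Lemma lip_reg_integral_cvg (H : linf -> R) M : continuous H -> (forall x, `|H x| <= M) ->
  forall eps, 0 < eps -> exists k : nat,
  \int[P']_w H (Z w) - eps <= \int[P']_w lip_reg H k%:R (Z w).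
Proof.
move=> cH HM eps e0; have iZ := integ_Z cH HM.
have ck k : continuous (lip_reg H k%:R).
  exact: (linf_lipschitz_continuous (ler0n R k) (lip_reg_lipschitz HM (ler0n _ k))).
have bk k x : `|lip_reg H k%:R x| <= M by exact: lip_reg_bound.
have hcvg : (\int[P']_w (lip_reg H m%:R (Z w))%:E)%E @[m --> \oo] --> (\int[P']_w (H (Z w))%:E)%E.
  apply: (@dominated_cvg _ _ _ P' setT measurableT (fun m w => (lip_reg H m%:R (Z w))%:E) _ (fun=> M%:E)) => //.
  - by move=> m; apply/measurable_EFinP; exact: (limit_measurable mYm YZ (@ck m)).
  - move=> w _; apply/fine_cvgP; split; first by apply: nearW.
    apply/cvgrPdist_le => d1 d0; have [m0 hm] := lip_reg_cvg HM (cH (Z w)) d0.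
    exists m0 => // m /= m0m; have := hm m m0m; have := lip_reg_le HM (Z w) (ler0n R m).
    by move=> h1 h2; rewrite ler_norml; lra.
  - exact: finite_measure_integrable_cst.
  - by move=> m w _; rewrite lee_fin.
move: hcvg; rewrite -(EFin_Rintegral iZ) => /fine_cvgP[_ /cvgrPdist_le /(_ eps e0)] [m0 _ hm].
exists m0; have := hm m0 (leqnn _) => /=; rewrite /Rintegral ler_norml; lra.
Qed.

(** [H] lies between the Lipschitz functions [lip_reg H k1] and minus [lip_reg (- H) k2], whose
    integrals along [Z] are close to that of [H]; the outer expectation is monotone. *)
Lemma limit_weakly_converges : weakly_converges P P' Zn Z.
Proof.
move=> H cH [M0 [_ hM0]]; pose M := M0 + 1.
have HM x : `|H x| <= M by apply: (hM0 M) => //; rewrite ltrDl.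
have nHM x : `|- H x| <= M by rewrite normrN.
have cN : continuous (fun x => - H x) by move=> x; apply: continuousN; exact: cH.
rewrite (expectation_Rintegral (integ_Z cH HM)).
apply: cvge_squeeze_eps => eps e0; have e2 : 0 < eps / 2 by rewrite divr_gt0.
have [k1 hk1] := lip_reg_integral_cvg cH HM e2.
have [k2 hk2] := lip_reg_integral_cvg cN nHM e2.
have [n1 hn1] := lipschitz_outer_cvg (ler0n _ k1) (lip_reg_lipschitz HM (ler0n _ k1))
   (fun x => lip_reg_bound HM x (ler0n _ k1)) e2.
have lipN : linf_lipschitz (fun x => - lip_reg (fun x => - H x) k2%:R x) k2%:R.
  move=> x y; rewrite -opprD normrN; exact: (lip_reg_lipschitz nHM (ler0n _ k2)).
have bN x : `|- lip_reg (fun x => - H x) k2%:R x| <= M.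
  by rewrite normrN; exact: lip_reg_bound.
have [n2 hn2] := lipschitz_outer_cvg (ler0n _ k2) lipN bN e2.
exists (maxn n1 n2) => n; rewrite geq_max => /andP[n1n n2n].
have /andP[l1 _] := hn1 n n1n; have /andP[_ u2] := hn2 n n2n.
apply/andP; split.
  apply: le_trans (le_trans l1 _); first by rewrite lee_fin; lra.
  by apply: outer_expectation_mono => w; rewrite lee_fin; exact: lip_reg_le.
apply: (@le_trans _ _ (outer_expectation P (fun w => (- lip_reg (fun x => - H x) k2%:R (Zn n w))%:E))).
  apply: outer_expectation_mono => w; rewrite lee_fin lerNr.
  exact: (lip_reg_le nHM (Zn n w) (ler0n R k2)).
apply: (le_trans u2); rewrite lee_fin.
have RN (f : Omega' -> R) : P'.-integrable setT (EFin \o f) ->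
    \int[P']_w (- f w) = - \int[P']_w f w.
  move=> fi; rewrite (@eq_Rintegral _ _ _ _ _ (fun w => -1 * f w)); last by move=> w _; rewrite mulN1r.
  by rewrite RintegralZl// mulN1r.
have iR : P'.-integrable setT (EFin \o (fun w => lip_reg (fun x => - H x) k2%:R (Z w))).
  apply: (integ_Z (M := M)); last by move=> x; exact: lip_reg_bound.
  exact: (linf_lipschitz_continuous (ler0n R k2) (lip_reg_lipschitz nHM (ler0n _ k2))).
by move: hk2; rewrite (RN _ (integ_Z cH HM)) (RN _ iR); lra.
Qed.

End weak_limit.

(** [Z] lives on the probability space of [G] and is a modification of it: for each fixed t, the
    discretizations at t converge almost surely both to [Z t] and to [G t]. Finitely many such null
    sets give equality of the finite-dimensional distributions. *)
Lemma leadsto_of_approximation : leadsto P P' Yn G.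
Proof.
have H m : {K : nat & {e : 'I_K -> I & {c : I -> 'I_K | exists n0, forall n, (n0 <= n)%N ->
  exists U : Omega -> R, [/\ measurable_fun setT U, forall w, 0 <= U w,
    forall t w, `|Yn n t w - Yn n (e (c t)) w| <= U w &
    (\int[P]_w (U w)%:E <= (1 / 4 ^+ m)%:E)%E]}}}.
  have := @approx (1 / 4 ^+ m) ltac:(by rewrite divr_gt0// exprn_gt0).
  by move=> /cid[K /cid[e /cid[c h]]]; exists K, e, c.
have [K [e [c Happ]]] : exists (K : nat -> nat) (e : forall m, 'I_(K m) -> I)
   (c : forall m, I -> 'I_(K m)), forall m, exists n0, forall n, (n0 <= n)%N ->
  exists U : Omega -> R, [/\ measurable_fun setT U, forall w, 0 <= U w,
    forall t w, `|Yn n t w - Yn n (e m (c m t)) w| <= U w &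
    (\int[P]_w (U w)%:E <= (1 / 4 ^+ m)%:E)%E].
  exists (fun m => projT1 (H m)), (fun m => projT1 (projT2 (H m))),
    (fun m => proj1_sig (projT2 (projT2 (H m)))) => m.
  exact: proj2_sig (projT2 (projT2 (H m))).
have [A [Y [Z [[mA PA] mYm YZ ZA Zt]]]] := limit_process mY Yfidi Happ.
pose Zn n w : linf := to_linfty (bY n w).
exists Zn => //; exists d', Omega', P', Z; split.
- exact: limit_borel_measurable mYm YZ.
- move=> k t B mB; rewrite /fidi /pushforward.
  have mZ s : measurable_fun setT (fun w => Z w s).
    apply: (limit_measurable mYm YZ (H := fun x : linf => x s)).
    apply: (@linf_lipschitz_continuous _ 1) => // x y.
    by rewrite -linftyB mul1r le_linf_norm.
  have mtup (f : I -> Omega' -> R) : (forall s, measurable_fun setT (f s)) ->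
      measurable_fun setT (fun w => [tuple f (tnth t i) w | i < k]).
    move=> mf; apply/measurable_fun_tnthP => i.
    rewrite (_ : _ \o _ = f (tnth t i))//.
    by apply/funext => w /=; rewrite tnth_mktuple.
  have mgt s m : measurable_fun setT (fun w => Num.min 1 `|G s w - Zstep G e c m w s|).
    apply: measurable_minr => //; apply: measurableT_comp => //.
    apply: measurable_funB => //; rewrite (_ : (fun w => Zstep G e c m w s) = G (e m (c m s)))//.
    by apply/funext => w; rewrite ZstepE.
  have hA i : exists A', [/\ measurable A', P' A' = 1%E &
      forall w, A' w -> A w -> Z w (tnth t i) = G (tnth t i) w].
    set s := tnth t i.
    have [A' [mA' PA' hA']] := @summable_full_set _ _ _ P'
      (fun m w => Num.min 1 `|G s w - Zstep G e c m w s|) 1 ler01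
      (mgt s) (fun m w => ltac:(by rewrite le_min ler01 normr_ge0))
      (Zstep_eval_dist mY Yfidi Happ s).
    exists A'; split => // w A'w Aw; have [C C0 hC] := hA' w A'w.
    have h : (fun m => Zstep G e c m w s) @ \oo --> G s w.
      apply/cvgrPdist_le => eps e0.
      (* The bound 1/2 again keeps the cap at 1 inactive. *)
      have me : 0 < Num.min eps (2^-1) by rewrite lt_min e0 invr_gt0 ltr0n.
      have [M hM] := @geometric_small R C _ me.
      exists M => // m /= Mm; have := hC m; have := hM m Mm.
      rewrite le_min => /andP[h1 h2]; rewrite {1}/Num.min; case: ifP.
        by move=> _ h3; exfalso; move: h2 h3; lra.
      by move=> _ h3; exact: le_trans h1.
    by rewrite -(cvg_lim (@Rhausdorff R) h); apply/esym/cvg_lim => //; exact: Zt.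
  have [AA hAA] : exists AA : 'I_k -> set Omega', forall i, [/\ measurable (AA i), P' (AA i) = 1%E &
      forall w, AA i w -> A w -> Z w (tnth t i) = G (tnth t i) w].
    by exists (fun i => proj1_sig (cid (hA i))) => i; exact: (proj2_sig (cid (hA i))).
  pose A0 := A `&` \bigcap_(i in [set: 'I_k]) AA i.
  have mA0 : measurable A0.
    by apply: measurableI => //; apply: fin_bigcap_measurable => // i _; case: (hAA i).
  have PA0 : P' A0 = 1%E.
    have nA : P'.-negligible (~` A0).
      rewrite /A0 setCI setC_bigcap; apply: negligibleU.
        by apply/negligibleP; [exact: measurableC|exact: full_setC].
      (* Reindexes the finite union by the natural numbers; [F j] is empty for j >= k. *)
      pose F j := [set w | exists2 i : 'I_k, val i = j & ~ AA i w].
      apply: (@negligibleS _ _ _ P' (\bigcup_j F j)).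
        by move=> w [i _ nA]; exists (val i) => //; exists i.
      apply: negligible_bigcup => j; have [jk|kj] := ltnP j k; last first.
        apply: negligibleS (negligible_set0 P') => w [i ij _].
        by move: kj; rewrite -ij leqNgt ltn_ord.
      case: (hAA (Ordinal jk)) => mi Pi _.
      apply: (@negligibleS _ _ _ P' (~` AA (Ordinal jk))).
        by move=> w [i ij nA] /=; rewrite (_ : Ordinal jk = i)//; exact/val_inj.
      by apply/negligibleP; [exact: measurableC|exact: full_setC].
    have := probability_setC P' (measurableC mA0); rewrite setCK => ->.
    by rewrite (_ : P' (~` A0) = 0%E) ?sube0//; apply/negligibleP => //; exact: measurableC.
  apply: (full_set_measure_eq mA0 PA0).
  + by rewrite -[X in measurable X]setTI; exact: (mtup (fun s w => Z w s) mZ).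
  + by rewrite -[X in measurable X]setTI; exact: (mtup G mG).
  + have tE w : A0 w -> [tuple Z w (tnth t i) | i < k] = [tuple G (tnth t i) w | i < k].
      move=> [Aw AAw]; apply: eq_from_tnth => i; rewrite !tnth_mktuple.
      by case: (hAA i) => _ _; apply => //; exact: AAw.
    apply/seteqP; split => w /= [Bw A0w]; split => //; first by rewrite -tE.
    by rewrite tE.
- exact: (limit_weakly_converges Happ mA PA mYm YZ ZA).
Qed.

End leadsto_criterion.

(** * The sequential empirical process *)

Section sequential_process.
Context {R : realType} {d dX : measure_display} {Omega : measurableType d}
  {calX : measurableType dX} (P : probability Omega R) (X : int -> {RV P >-> calX}).
Let Y (t : nat) : Omega -> calX := X t%:Z.

Lemma seq_empirical_psum n s (phi : calX -> R) w :
  seq_empirical P X n s phi w =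
    (Num.sqrt n%:R)^-1 * psum P Y phi 1 (Num.truncn (n%:R * s)) w.
Proof.
rewrite /seq_empirical /psum /centered add1n; congr (_ * _).
by apply: eq_bigr => i _; rewrite unlock.
Qed.

Lemma measurable_seq_empirical n s (phi : calX -> R) :
  measurable_fun setT phi -> measurable_fun setT (seq_empirical P X n s phi).
Proof.
move=> mphi; apply: measurable_funM => //; apply: measurable_sum => i.
by apply: measurable_funB => //; apply: measurableT_comp => //; exact: measurable_funPT.
Qed.

(** For fixed [w] the envelope at the n observed points bounds all summands, uniformly in s and phi;
    this places the sample paths in l^oo. *)
Lemma seq_empirical_bounded (F : set (calX -> R)) (h : calX -> R) (m : R) n w :
  (forall phi, F phi -> forall x, `|phi x| <= `|h x|) ->
  (forall phi i, F phi -> (0 < i)%N -> `|\int[P]_w phi (Y i w)| <= m) ->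
  exists M, forall s phi, s <= 1 -> F phi -> `|seq_empirical P X n s phi w| <= M.
Proof.
move=> Fh Fm; pose c i := `|h (Y i w)| + `|m|.
have c0 i : 0 <= c i by rewrite addr_ge0.
exists (`|(Num.sqrt n%:R)^-1| * \sum_(1 <= i < n.+1) c i) => s phi s1 Fphi.
rewrite seq_empirical_psum normrM ler_wpM2l// /psum add1n.
set l := Num.truncn _; have ln : (l <= n)%N.
  rewrite -(natrK (R := R) n); apply: le_truncn.
  by rewrite -[leRHS]mulr1 ler_wpM2l.
apply: (le_trans (ler_norm_sum _ _ _)).
rewrite (@big_cat_nat _ _ _ l.+1 1 n.+1)//= -[leLHS]addr0; apply: lerD; last exact: sumr_ge0.
rewrite big_nat [leRHS]big_nat; apply: ler_sum => i /andP[i0 _].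
rewrite (le_trans (ler_normB _ _))// lerD ?Fh//.
by rewrite (le_trans (Fm _ _ Fphi i0))// ler_norm.
Qed.

End sequential_process.

(** Lower powers are at most 1 plus the top one, and 1 + |M| is at most its square, the form that
    [moments_le] asks for. The size 1 + |M| is also at least 1, as the time blocks require. *)
Lemma moments_le_of_top_moment {R : realType} {d dE : measure_display} {T : measurableType d}
    {E : measurableType dE} (P : probability T R) (Y : nat -> T -> E) (theta : R) (Q : nat)
    (f : E -> R) (M : R) :
  measurable_fun setT (Y 1%N) -> measurable_fun setT f -> 0 <= theta ->
  (\int[P]_w (`|f (Y 1%N w)| `^ (Q%:R * (theta / 2)))%:E <= M%:E)%E ->
  moments_le P Y theta Q f (1 + `|M|).
Proof.
move=> mY mf th0 fM q /andP[_ qQ]; have mfY := measurableT_comp mf mY.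
have mp p : measurable_fun setT (fun w => `|f (Y 1%N w)| `^ p).
  exact: measurable_norm_powR.
have le_pow (u : R) : `|u| `^ (q%:R * (theta / 2)) <= 1 + `|u| `^ (Q%:R * (theta / 2)).
  have e0 n : 0 <= n%:R * (theta / 2) by rewrite mulr_ge0// divr_ge0.
  have [u1|u1] := leP `|u| 1.
    rewrite -[leLHS]addr0 lerD ?powR_ge0//.
    by rewrite (le_trans (ge0_ler_powR (e0 q) _ _ u1)) ?nnegrE// powR1.
  rewrite -[leLHS]add0r lerD// ler_powR ?(ltW u1)// ler_wpM2r ?ler_nat// divr_ge0//.
apply: (@le_trans _ _ (\int[P]_w (1 + `|f (Y 1%N w)| `^ (Q%:R * (theta / 2)))%:E)%E).
  have m1 : measurable_fun setT (fun w => (`|f (Y 1%N w)| `^ (q%:R * (theta / 2)))%:E).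
    exact/measurable_EFinP.
  have m2 : measurable_fun setT (fun w => (1 + `|f (Y 1%N w)| `^ (Q%:R * (theta / 2)))%:E).
    by apply/measurable_EFinP; apply: measurable_funD.
  by apply: ge0_le_integral => // w _; rewrite lee_fin ?powR_ge0.
apply: (@le_trans _ _ (1 + `|M|)%:E); last first.
  by rewrite lee_fin expr2 ler_peMl// lerDl.
apply: (@integral_sum2 _ _ _ _ (cst 1)) => //.
- by rewrite (integral_cstT P 1).
- by rewrite (le_trans fM)// lee_fin ler_norm.
Qed.

Theorem corollary2p7 (R : realType)
  (d : measure_display) (Omega : measurableType d) (P : probability Omega R)
  (dX : measure_display) (calX : measurableType dX)
  (X : int -> {RV P >-> calX}) (X_stationary : strictly_stationary P X)
  (F : set (calX -> R)) (F_measurable : F `<=` [set phi | measurable_fun setT phi])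
  (gamma : R) (gamma_gt0 : 0 < gamma)
  (Q : nat) (Q_even : ~~ odd Q) (Q_gt2 : (2 < Q)%N)
  (A1_mixing : strongly_mixing P (fun _ t => X t%:Z))
  (A1_sum : (\sum_(1 <= t <oo)
      ((t%:R ^+ (Q - 2))%:E *
       alpha_mixing P (fun _ t => X t%:Z) t `^ (gamma / (2 + gamma))) < +oo)%E)
  (A2_integral : (\int[lebesgue_measure]_(x in `]0%R, 1%R])
      ((x `^ (- (gamma / (2 + gamma))))%:E *
       bracketing_number F (L2_norm_at P (X 1%R)) x `^ (Q%:R^-1)) < +oo)%E)
  (A2_bounding : forall eps : R, 0 < eps ->
    exists (N : nat) (B A : set (calX -> R)),
      [/\ bracketing_number F (L2_norm_at P (X 1)) eps = (N%:R)%:E,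
          is_bracketing F (L2_norm_at P (X 1)) eps N B A &
          forall i : nat, (2 <= i <= Q)%N -> forall b, B b ->
            (abs_moment P (b \o X 1%R) (i%:R * ((2 + gamma) / 2)) `^ 2^-1
             <= eps%:E)%E])
  (A3_envelope : exists envF : calX -> R,
    [/\ measurable_fun setT envF,
        forall phi, F phi -> forall x, `|phi x| <= `|envF x| &
        (abs_moment P (envF \o X 1%R) Q%:R < +oo)%E])
  (A3_moment : exists M : R,
    (ereal_sup [set abs_moment P (phi \o X 1%R) (Q%:R * ((2 + gamma) / 2))
               | phi in F] <= M%:E)%E)
  (d' : measure_display) (Omega' : measurableType d')
  (P' : probability Omega' R) (G : seq_index F -> {RV P' >-> R})
  (G_gaussian : centered_gaussian_process P' G)
  (G_fidi : fidi_cvg P P' (@seq_empirical_process _ _ _ _ _ P X F) G) :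
  leadsto P P' (@seq_empirical_process _ _ _ _ _ P X F) G.
Proof.
(* Any [kap] in ]0, gamma / theta[ would do. *)
pose theta := 2 + gamma; pose kap := gamma / 2 / theta; pose Y t := X (Posz t).
have th2 : 2 < theta by rewrite /theta ltrDl.
have th0 : 0 < theta by exact: lt_trans th2.
(* 1 - 2/theta is the power of the mixing coefficient in the covariance inequality, and minus it the
   power of x that turns the entropy integral into the sum of the [entropy_term]s. *)
have k'E : gamma / (2 + gamma) = 1 - 2 / theta.
  by rewrite -/theta /theta; field; rewrite gt_eqF.
have k'0 : 0 < gamma / (2 + gamma) by rewrite divr_gt0.
have kap01 : 0 < kap < 1.
  rewrite divr_gt0 ?divr_gt0//= ltr_pdivrMr// mul1r /theta; lra.
have kap_small : 2 < (1 - kap) * theta.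
  rewrite mulrBl mul1r /kap divfK ?gt_eqF// /theta; lra.
have Q4 : (4 <= Q)%N.
  by rewrite ltn_neqAle Q_gt2 andbT; apply: contraNneq Q_even => <-.
have mY i : measurable_fun setT (Y i) by exact: measurable_funPT.
have stY i (g : calX -> R) : (0 < i)%N -> measurable_fun setT g -> (forall x, 0 <= g x) ->
    (\int[P]_w (g (Y i w))%:E = \int[P]_w (g (Y 1%N w))%:E)%E.
  by move=> _ mg g0; exact: (stationary_integral X_stationary).
have [v [V [v0 v1 vS mix]]] := mixing_rates mY k'0 A1_sum.
rewrite k'E in mix.
have [C C0 HC] := psum_maximal mY stY th2 kap01 Q4 Q_even v0 v1 vS mix.
have HF := psum_finite_family Q4 C0 HC.
have [N [a [b [brN aF cov hb]]]] := bracketing_sequence A2_bounding.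
rewrite k'E in A2_integral.
have [B hB] := entropy_bounded_of_integral th2 (fun x => bracketing_number_ge0 F (L2_norm_at P (X 1)) x)
  (fun x y _ => @bracketing_number_antitone _ _ _ F (L2_norm_at P (X 1)) x y) brN A2_integral.
have [M hM] := A3_moment; have [envF [_ Fenv _]] := A3_envelope.
pose xs := 1 + `|M|; have xs1 : 1 <= xs by rewrite lerDl.
have xs0 : 0 < xs by exact: lt_le_trans xs1.
have Fmom phi : F phi -> moments_le P Y theta Q phi xs.
  move=> Fphi; apply: moments_le_of_top_moment => //; [exact: F_measurable|exact: ltW|].
  rewrite -(abs_momentE P (phi \o X 1)); apply: le_trans hM.
  by apply: ereal_sup_ubound; exists phi.
have Fint phi i : F phi -> (0 < i)%N -> P.-integrable setT (EFin \o (fun w => phi (Y i w))).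
  move=> Fphi i0; apply: (moments_le_integ mY stY th2 Q4 _ i0 (Fmom _ Fphi)).
  exact: F_measurable.
have [m Fmean] : exists m : R, forall phi i, F phi -> (0 < i)%N -> `|\int[P]_w phi (Y i w)| <= m.
  exists (2 * (xs ^+ 2) `^ (2%:R * (theta / 2))^-1) => phi i Fphi i0.
  have p1 : 1 <= 2%:R * (theta / 2) by rewrite mulrC divfK// ltW// (lt_trans _ th2)// ltr1n.
  apply: (moment_le_mean p1); first by rewrite powR_gt0 ?exprn_gt0.
    by apply: measurableT_comp => //; exact: F_measurable.
  rewrite (stationary_moment stY)//; last exact: F_measurable.
  rewrite -powRrM mulVf ?gt_eqF ?(lt_le_trans ltr01 p1)// powRr1 ?exprn_ge0 ?(ltW xs0)//.
  by apply: (Fmom _ Fphi); rewrite (ltnW Q_gt2).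
apply: leadsto_of_approximation => //.
- move=> n t; apply: measurable_seq_empirical; apply: F_measurable.
  by have /set_mem[_] := valP t.
- move=> n w; have [M' hM'] := seq_empirical_bounded n w Fenv Fmean.
  exists M' => t; have /set_mem[/= s01 Ft] := valP t; apply: hM' => //.
  by move: s01; rewrite in_itv => /andP[].
move=> eta eta0; have e2 : 0 < eta / 2 by rewrite divr_gt0.
have [k1 [n0 hn0]] := psum_approx_fixed_level mY stY th2 kap01 C0 HF F_measurable Fint
  aF cov (fun k j => let: And3 h _ _ := hb k j in h) (fun k j => let: And3 _ h _ := hb k j in h)
  (fun k j => let: And3 _ _ h := hb k j in h) (ex_intro _ B hB) kap_small e2.
have [J [J0 hJ]] := psum_time_blocks th2 kap01 Q4 C0 HF (fun i => F_measurable _ (aF k1 i))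
  xs1 (fun i => Fmom _ (aF k1 i)) e2.
have [idx hidx] : exists idx : seq_index F -> 'I_(N k1),
    forall t, covers a b (set_val t).2 (idx t).
  have H (t : seq_index F) : {i : 'I_(N k1) | covers a b (set_val t).2 i}.
    by apply: cid; have /set_mem[_ Ft] := valP t; exact: cov.
  by exists (fun t => sval (H t)) => t; exact: svalP (H t).
have node_mem (ji : 'I_J.+1 * 'I_(N k1)) :
    (ji.1%:R / J%:R, a k1 ji.2) \in (seq_index F : set (R * (calX -> R))).
  apply/mem_set; split; last exact: aF.
  have JR : 0 < J%:R :> R by rewrite ltr0n.
  by rewrite /= in_itv/= divr_ge0//= ler_pdivrMr// mul1r ler_nat -ltnS.
pose node ji : seq_index F := SigSub (node_mem ji).
pose time (t : seq_index F) := Num.truncn ((set_val t).1 * J%:R).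
(* An index (s, phi) goes to the last grid time up to s and to an approximant covering phi, a choice
   free of [n]. [inord] keeps the value of [time t], which is at most J. *)
exists #|{: 'I_J.+1 * 'I_(N k1)}|, (fun kappa => node (enum_val kappa)),
  (fun t => enum_rank (inord (time t), idx t)), (maxn n0 J) => n.
rewrite geq_max => /andP[/hn0[np [U1 [mU1 U10 hU1 EU1]]] /hJ[U2 [mU2 U20 hU2 EU2]]].
exists (fun w => U1 w + U2 w); split.
- exact: measurable_funD.
- by move=> w; rewrite addr_ge0.
- move=> t w; rewrite enum_rankK /seq_empirical_process.
  have /set_mem[/= s01 Ft] := valP t; rewrite in_itv/= in s01.
  have [jJ nodeE tn] := truncn_grid n J0 s01.
  have ln : (Num.truncn (n%:R * (set_val t).1) <= n)%N.
    rewrite -(natrK (R := R) n); apply: le_truncn.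
    by rewrite -[leRHS]mulr1 natrK ler_wpM2l//; case/andP: s01.
  rewrite !seq_empirical_psum inordK ?ltnS// nodeE -mulrBr normrM.
  rewrite ger0_norm ?invr_ge0 ?sqrtr_ge0// ler_pdivrMl ?sqrtr_gt0 ?ltr0n//.
  rewrite mulrDr.
  (* First phi is replaced by its approximant at unchanged time; then the time is moved to its grid
     point, for one of finitely many functions. *)
  have h1 := hU1 _ _ Ft (hidx t) _ w ln.
  have h2 := hU2 (idx t) _ _ w jJ tn.
  by rewrite (le_trans (ler_distD _ _ _) (lerD h1 h2)).
- by rewrite (le_trans (integral_sum2 mU1 mU2 U10 U20 EU1 EU2))// lee_fin -splitr.
Qed.
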